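(* Let $X,Y$ be locally compact Hausdorff spaces and let $(Z,r,s,\mathcal{L})$ and $(Z',r',s',\mathcal{L}')$ be proper twisted topological $Y$-$X$-correspondences with $s$ and $s'$ surjective. Put $\mathcal{E}=\Gamma_0(Z,r,s,\mathcal{L})$, $\mathcal{E}'=\Gamma_0(Z',r',s',\mathcal{L}')$. Assume that either $C^*(\operatorname{Im}\iota_{\mathcal{E}},\operatorname{Im}\varphi_{\mathcal{E}})$ and $C^*(\operatorname{Im}\iota_{\mathcal{E}'},\operatorname{Im}\varphi_{\mathcal{E}'})$ both have constant rank, or their double commutants $C^*(\operatorname{Im}\iota_{\mathcal{E}},\operatorname{Im}\varphi_{\mathcal{E}})''$ (in $\mathcal{K}(\mathcal{E})$) and $C^*(\operatorname{Im}\iota_{\mathcal{E}'},\operatorname{Im}\varphi_{\mathcal{E}'})''$ (in $\mathcal{K}(\mathcal{E}')$) both have constant rank; write $D_{\mathcal{E}}$ and $D_{\mathcal{E}'}$ for the respective algebras. Then $\mathcal{E}$ and $\mathcal{E}'$ are isomorphic as $C^*$-correspondences if and only if both of the following hold: (a) $(Z,r,s,\mathcal{L})$ and $(Z',r',s',\mathcal{L}')$ are locally conjugate. (b) The vector bundle $\mathcal{V}_{\mathcal{E}}^D$ over $\widehat{D}_{\mathcal{E}}$ is isomorphic to the pullback of the vector bundle $\mathcal{V}_{\mathcal{E}'}^D$ along the map $\widehat{\Pi}^{-1}:\widehat{D}_{\mathcal{E}}\to\widehat{D}_{\mathcal{E}'}$, where $\Pi:D_{\mathcal{E}}\to D_{\mathcal{E}'}$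 is the $*$-isomorphism with $\Pi\circ\iota_{\mathcal{E}}=\iota_{\mathcal{E}'}$ and $\Pi\circ\varphi_{\mathcal{E}}=\varphi_{\mathcal{E}'}$ (which exists when (a) holds).
   Context: A proper twisted topological $Y$-$X$-correspondence $(Z,r,s,\mathcal{L})$ consists of a locally compact Hausdorff space $Z$, a local homeomorphism $s:Z\to X$ proper onto its image (hence a covering map onto its image with finite fibers), a proper continuous map $r:Z\to Y$, and a Hermitian line bundle $\mathcal{L}$ over $Z$. $\Gamma_0(Z,r,s,\mathcal{L})$ is the $C^*$-correspondence from $C_0(Y)$ to $C_0(X)$ given by $\Gamma_0(\mathcal{L})$ with $\langle\xi,\eta\rangle(x)=\sum_{s(z)=x}\langle\xi(z),\eta(z)\rangle_{\mathcal{L}}$, $(\xi f)(z)=\xi(z)f(s(z))$, $(\varphi(g)\xi)(z)=g(r(z))\xi(z)$ for $f\in C_0(X)$, $g\in C_0(Y)$. Isomorphisms of $C^*$-correspondences are inner-product preserving $C_0(X)$-linear bijections intertwining the left actions. Local conjugacy: every $x\in X$ has an open neighborhood $U$ and a homeomorphism $\phi:s^{-1}(U)\to (s')^{-1}(U)$ with $s'\circ\phi=s$ and $r'\circ\phi=r$ on $s^{-1}(U)$ (the line bundles play no role). $\varphi_{\mathcal{E}}:C_0(Y)\to\mathcal{K}(\mathcal{E})$ is the left action; $\iota_{\mathcal{E}}:C_0(X)\to\mathcal{K}(\mathcal{E})$, $\iota_{\mathcal{E}}(f)\xi=\xi f$. $C^*(\operatorname{Im}\iota_{\mathcal{E}},\operatorname{Im}\varphi_{\mathcal{E}})$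 is the (abelian) $C^*$-subalgebra of $\mathcal{K}(\mathcal{E})$ generated by both images; its double commutant relative to $\mathcal{K}(\mathcal{E})$ is also abelian. For an abelian subalgebra $D$ of $\mathcal{K}(\mathcal{E})$ containing $\operatorname{Im}\iota_{\mathcal{E}}$, let $D_x$ be the image of $D$ in $\mathcal{K}(\mathcal{E})_x=\operatorname{End}(\mathcal{E}_x)$, where $\mathcal{E}_x$ is the (finite-dimensional) fiber of $\mathcal{E}$ at $x$; $D$ has constant rank if $\dim D_x$ is the same for all $x\in X$. In this case the Gelfand dual $s_{\mathcal{E}}:\widehat{D}\to X$ of $\iota_{\mathcal{E}}:C_0(X)\to D$ is a finite covering; for $z\in s_{\mathcal{E}}^{-1}(x)$ let $p_z\in D_x$ be the minimal projection corresponding to $z$. $\mathcal{V}_{\mathcal{E}}^D$ is the vector bundle over $\widehat{D}$ with fiber $p_z\mathcal{E}_x$ over $z\in s_{\mathcal{E}}^{-1}(x)$, i.e. the vector bundle whose module of continuous sections vanishing at infinity is $\mathcal{E}$ regarded as a $D$-module, with $D$-valued inner product $\langle\xi,\eta\rangle_D(z)=\langle p_z\xi(x),\eta(x)\rangle$. $\widehat{\Pi}:\widehat{D}_{\mathcal{E}'}\to\widehat{D}_{\mathcal{E}}$ is the Gelfand dual of $\Pi$.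
   Formalization: Γ_0(Z,r,s,𝓛) is taken to be the sections ξ vanishing at infinity for which ⟨ξ,ξ⟩ also vanishes at infinity on X; this is automatic for fibers of bounded size, while for unbounded fibers (n points over n∈ℕ) the inner product on all of Γ_0(𝓛) is not C_0(X)-valued. *)

(* Defs.v *)
From HB Require Import structures.
From mathcomp Require Import all_boot all_order all_algebra.
From mathcomp Require Import complex generic_quotient ring_quotient.
From mathcomp Require Import all_classical all_reals all_analysis.
From mathcomp Require Import ring.

Set Implicit Arguments.
Unset Strict Implicit.
Unset Printing Implicit Defensive.

Import Order.TTheory GRing.Theory Num.Theory numFieldNormedType.Exports.

Local Open Scope classical_set_scope.
Local Open Scope ring_scope.

(* R[i] under a name that is syntactically a numFieldType, which is what the
   topology of numFieldNormedType.Exports is keyed on. *)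
Definition cplx (R : realType) : numClosedFieldType := complex R.

Section LinearSpan.
Variables (K : pzRingType) (V : lmodType K).

Definition submodule (W : set V) : Prop :=
  W 0 /\ forall (a : K) (u v : V), W u -> W v -> W (a *: u + v).

Definition lspan (S : set V) : set V := smallest submodule S.

Definition lspan_pred (S : set V) : {pred V} := [pred v | `[< lspan S v >]].

Lemma lspan_submodule (S : set V) : submodule (lspan S).
Proof.
split=> [W [[W0 _] _] //|a u v hu hv W WS].
by apply: WS.1.2; [exact: hu|exact: hv].
Qed.

Fact lspan_submod_closed (S : set V) : submod_closed (lspan_pred S).
Proof.
have [h0 hl] := lspan_submodule S.
split; first by rewrite inE.
by move=> a u v; rewrite !inE; apply: hl.
Qed.

HB.instance Definition _ (S : set V) :=
  GRing.isSubmodClosed.Build K V (lspan_pred S) (lspan_submod_closed S).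

End LinearSpan.

Section QuotientModule.
Variables (K : pzRingType) (V : lmodType K) (S : set V).
Local Open Scope quotient_scope.

Definition lquot : Type := Quotient.quot (lspan_pred S).

HB.instance Definition _ := GRing.Zmodule.on lquot.

Definition lclass (v : V) : lquot := \pi_(Quotient.quot (lspan_pred S)) v.
Definition lrepr (q : lquot) : V := repr (q : Quotient.quot (lspan_pred S)).

Definition lquot_scale (a : K) (q : lquot) : lquot := lclass (a *: lrepr q).

Lemma lreprK q : lclass (lrepr q) = q.
Proof. exact: reprK. Qed.

Lemma lclassP u v : lclass u = lclass v <-> lspan S (u - v).
Proof.
rewrite /lclass; split=> [/eqP|h].
  by rewrite -Quotient.idealrBE inE.
by apply/eqP; rewrite -Quotient.idealrBE inE.
Qed.

Lemma lclassD u v : lclass (u + v) = lclass u + lclass v.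
Proof. exact: Quotient.pi_add. Qed.

Lemma lclassZ a u : lquot_scale a (lclass u) = lclass (a *: u).
Proof.
apply/lclassP; rewrite -scalerBr.
have [h0 hl] := lspan_submodule S.
rewrite -[X in lspan _ X]addr0; apply: hl => //.
by apply/lclassP; rewrite lreprK.
Qed.

Fact lquot_scaleA a b q :
  lquot_scale a (lquot_scale b q) = lquot_scale (a * b) q.
Proof. by rewrite -(lreprK q) !lclassZ scalerA. Qed.
Fact lquot_scale1 : left_id 1 lquot_scale.
Proof. by move=> q; rewrite -(lreprK q) lclassZ scale1r. Qed.
Fact lquot_scaleDr : right_distributive lquot_scale +%R.
Proof.
move=> a p q; rewrite -(lreprK p) -(lreprK q) !lclassZ -!lclassD.
by rewrite lclassZ scalerDr.
Qed.
Fact lquot_scaleDl q : {morph lquot_scale^~ q : a b / a + b}.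
Proof. by move=> a b; rewrite -(lreprK q) !lclassZ -lclassD scalerDl. Qed.

HB.instance Definition _ := GRing.Zmodule_isLmodule.Build K lquot
  lquot_scaleA lquot_scale1 lquot_scaleDr lquot_scaleDl.

End QuotientModule.

Section SpanModule.
Variables (K : pzRingType) (V : lmodType K) (S : set V).

Record lspan_mod : Type :=
  LspanMod { lspan_val : V; lspan_valP : lspan_val \in lspan_pred S }.

HB.instance Definition _ := [isSub for lspan_val].
HB.instance Definition _ := [Choice of lspan_mod by <:].
HB.instance Definition _ := [SubChoice_isSubLmodule of lspan_mod by <:].

End SpanModule.

Definition has_dim (K : pzRingType) (V : lmodType K) (S : set V) (n : nat) :
    Prop :=
  submodule S /\ exists2 b : 'I_n -> V, (forall i, S (b i)) &
    forall v, S v -> exists! c : 'rV[K]_n, v = \sum_i c 0 i *: b i.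

Definition proper_map (X Y : topologicalType) (f : X -> Y) : Prop :=
  forall K : set Y, compact K -> compact (f @^-1` K).

Definition proper_onto_image (X Y : topologicalType) (f : X -> Y) : Prop :=
  forall K : set Y, compact K -> K `<=` range f -> compact (f @^-1` K).

Definition local_homeomorphism (X Y : topologicalType) (f : X -> Y) : Prop :=
  continuous f /\
  forall x, exists W : set X, [/\ open W, W x, set_inj W f &
    forall V : set X, open V -> V `<=` W -> open (f @` V)].

Definition gen_topology (T : Type) (S : set (set T)) : Type := T.

HB.instance Definition _ (T : choiceType) (S : set (set T)) :=
  Choice.on (gen_topology S).
HB.instance Definition _ (T : choiceType) (S : set (set T)) :=
  @isSubBaseTopological.Build (gen_topology S) (set T) S id.

Section Bundles.
Variable R : realType.
Notation C := (cplx R).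

(* A family of complex vector spaces over B: the fibers, and a topology on the
   total space. Local triviality is a separate condition. *)
Record vfamily (B : topologicalType) := VFamily {
  fib :> B -> lmodType C;
  tot_class : Topological {b : B & fib b} }.

Definition tot (B : topologicalType) (F : vfamily B) : topologicalType :=
  Topological.Pack (tot_class F).

Definition tpt (B : topologicalType) (F : vfamily B) (b : B) (v : F b) : tot F :=
  existT _ b v.
Definition tbase (B : topologicalType) (F : vfamily B) (t : tot F) : B :=
  projT1 t.
Definition tvec (B : topologicalType) (F : vfamily B) (t : tot F) :
  F (tbase t) := projT2 t.

(* Local trivializations U * C -> p^-1 U: psi with inverse psi'. *)
Definition line_bundle (B : topologicalType) (F : vfamily B) : Prop :=
  continuous (@tbase B F) /\
  forall b0 : B, exists U : set B,
    exists psi : forall b, C -> F b, exists psi' : forall b, F b -> C,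
    [/\ open_nbhs b0 U,
        forall b a c d, U b -> psi b (a * c + d) = a *: psi b c + psi b d,
        forall b, U b -> cancel (psi b) (psi' b) /\ cancel (psi' b) (psi b),
        {within U `*` [set: C],
           continuous (fun p : B * C => tpt (psi p.1 p.2))} &
        {within @tbase B F @^-1` U, continuous (fun t => psi' _ (tvec t))}].

(* Conjugate-linear in the first variable. Continuity of v |-> <v,v> on the
   total space is continuity of the metric, by polarization. *)
Definition hermitian_metric (B : topologicalType) (F : vfamily B)
    (h : forall b, F b -> F b -> C) : Prop :=
  [/\ forall b u a v w, h b u (a *: v + w) = a * h b u v + h b u w,
      forall b u v, h b v u = (h b u v)^*,
      forall b v, v != 0 -> 0 < h b v v &
      continuous (fun t : tot F => h _ (tvec t) (tvec t))].

Record hline_bundle (B : topologicalType) := HLineBundle {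
  lb_fam :> vfamily B;
  lb_met : forall b, lb_fam b -> lb_fam b -> C;
  lb_line : line_bundle lb_fam;
  lb_herm : hermitian_metric lb_met }.

Definition totmap (B : topologicalType) (F G : vfamily B)
  (h : forall b, F b -> G b) (t : tot F) : tot G := tpt (h _ (tvec t)).

Definition vbundle_iso (B : topologicalType) (F G : vfamily B) : Prop :=
  exists (h : forall b, {linear F b -> G b}) (k : forall b, G b -> F b),
    [/\ forall b, cancel (h b) (k b), forall b, cancel (k b) (h b),
        continuous (totmap h) & continuous (totmap k)].

(* The total space of f^*F is the subspace of B * tot F of the pairs (b, t)
   with t over f b. *)
Definition pullback (B B' : topologicalType) (f : B -> B') (F : vfamily B') :
    vfamily B :=
  @VFamily B (fun b => F (f b)) (Topological.class
    (initial_topology (fun t : {b : B & F (f b)} =>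
       (projT1 t, tpt (projT2 t)) : (B * tot F)%type))).

Definition vanishes_at_infinity (X : topologicalType) (f : X -> C) : Prop :=
  forall e : C, 0 < e ->
    exists2 K : set X, compact K & forall x, ~ K x -> `|f x| < e.

Record C0 (X : topologicalType) := MkC0 {
  C0_fun :> X -> C;
  C0_cont : continuous C0_fun;
  C0_van : vanishes_at_infinity C0_fun }.

Definition sections (B : topologicalType) (F : vfamily B) : Type :=
  forall b, F b.

Section SectionsModule.
Variables (B : topologicalType) (F : vfamily B).
Implicit Types u v w : sections F.

HB.instance Definition _ := gen_eqMixin (sections F).
HB.instance Definition _ := gen_choiceMixin (sections F).

Let sadd u v : sections F := fun b => u b + v b.
Let sopp u : sections F := fun b => - u b.
Let szero : sections F := fun b => 0.
Let sscale (a : C) u : sections F := fun b => a *: u b.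

Fact saddA : associative sadd.
Proof. by move=> u v w; apply: functional_extensionality_dep => b; apply: addrA. Qed.
Fact saddC : commutative sadd.
Proof. by move=> u v; apply: functional_extensionality_dep => b; apply: addrC. Qed.
Fact sadd0 : left_id szero sadd.
Proof. by move=> u; apply: functional_extensionality_dep => b; apply: add0r. Qed.
Fact saddN : left_inverse szero sopp sadd.
Proof. by move=> u; apply: functional_extensionality_dep => b; apply: addNr. Qed.
HB.instance Definition _ :=
  GRing.isZmodule.Build (sections F) saddA saddC sadd0 saddN.

Fact sscaleA a c u : sscale a (sscale c u) = sscale (a * c) u.
Proof. by apply: functional_extensionality_dep => b; apply: scalerA. Qed.
Fact sscale1 : left_id 1 sscale.
Proof. by move=> u; apply: functional_extensionality_dep => b; apply: scale1r. Qed.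
Fact sscaleDr : right_distributive sscale +%R.
Proof. by move=> a u v; apply: functional_extensionality_dep => b; apply: scalerDr. Qed.
Fact sscaleDl u : {morph sscale^~ u : a c / a + c}.
Proof. by move=> a c; apply: functional_extensionality_dep => b; apply: scalerDl. Qed.
HB.instance Definition _ := GRing.Zmodule_isLmodule.Build C (sections F)
  sscaleA sscale1 sscaleDr sscaleDl.

End SectionsModule.

(* A proper twisted topological Y-X-correspondence (Z, r, s, L). *)
Record tcorr (Y X : topologicalType) := TCorr {
  tc_Z : topologicalType;
  tc_r : tc_Z -> Y;
  tc_s : tc_Z -> X;
  tc_L : hline_bundle tc_Z;
  tc_lc : locally_compact [set: tc_Z];
  tc_T2 : hausdorff_space tc_Z;
  tc_r_cont : continuous tc_r;
  tc_r_proper : proper_map tc_r;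
  tc_s_lhomeo : local_homeomorphism tc_s;
  tc_s_proper : proper_onto_image tc_s }.

Section LineBundleSections.
Variables (B : topologicalType) (L : hline_bundle B).

Lemma open_setXT (U : set B) : open U -> open (U `*` [set: C]).
Proof.
move=> oU; rewrite (_ : _ `*` _ = fst @^-1` U).
  by apply: open_comp => // x _; exact: cvg_fst.
by apply/seteqP; split=> [x []|x Ux].
Qed.

Lemma continuous_section_lin (a : B -> C) (u v : sections L) :
  continuous a -> continuous (fun b => tpt (u b)) ->
  continuous (fun b => tpt (v b)) ->
  continuous (fun b => tpt (a b *: u b + v b)).
Proof.
move=> ca cu cv b0.
have [cbase triv] := lb_line L.
have [U [psi [psi' [[oU Ub0] plin pK cpsi cpsi']]]] := triv b0.
have oV : open (@tbase B L @^-1` U) by apply: open_comp.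
have oUT := open_setXT oU.
rewrite continuous_open_subspace// in cpsi'.
rewrite continuous_open_subspace// in cpsi.
have coord (w : sections L) : continuous (fun b => tpt (w b)) ->
    {for b0, continuous (fun b => psi' b (w b))}.
  move=> cw.
  apply: (@continuous_comp _ _ _ (fun b => tpt (w b))
    (fun t : tot L => psi' _ (tvec t))); first exact: cw.
  by apply: cpsi'; rewrite inE.
pose g b := a b * psi' b (u b) + psi' b (v b).
have cg : {for b0, continuous g}.
  apply: continuousD; last exact: coord.
  by apply: continuousM; [exact: ca|exact: coord].
have cw : {for b0, continuous (fun b => tpt (psi b (g b)))}.
  apply: (@continuous_comp _ _ _ (fun b => (b, g b))
    (fun p : B * C => tpt (psi p.1 p.2))).
    by apply: (cvg_pair (G := nbhs b0) (H := nbhs (g b0))).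
  by apply: cpsi; rewrite inE.
have E b : U b -> psi b (g b) = a b *: u b + v b.
  by move=> Ub; rewrite /g plin// (pK b Ub).2 (pK b Ub).2.
rewrite /prop_for/= /continuous_at -(E _ Ub0).
apply: cvg_trans cw; apply: near_eq_cvg.
by near=> b; rewrite E//; near: b; exact: open_nbhs_nbhs.
Unshelve. all: by end_near. Qed.

Lemma continuous_section0 : continuous (fun b => tpt (0 : L b)).
Proof.
move=> b0.
have [cbase triv] := lb_line L.
have [U [psi [psi' [[oU Ub0] plin pK cpsi cpsi']]]] := triv b0.
have oUT := open_setXT oU.
rewrite continuous_open_subspace// in cpsi.
have E b : U b -> psi b 0 = 0.
  move=> Ub; have := plin b 1 0 0 Ub.
  by rewrite mul1r add0r scale1r -[LHS]addr0 => /addrI.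
have cw : {for b0, continuous (fun b => tpt (psi b 0))}.
  apply: (@continuous_comp _ _ _ (fun b => (b, 0 : C))
    (fun p : B * C => tpt (psi p.1 p.2))).
    by apply: (cvg_pair (G := nbhs b0) (H := nbhs (0 : C))); [|exact: cvg_cst].
  by apply: cpsi; rewrite inE.
rewrite /continuous_at -(E _ Ub0).
apply: cvg_trans cw; apply: near_eq_cvg.
by near=> b; rewrite E//; near: b; exact: open_nbhs_nbhs.
Unshelve. all: by end_near. Qed.

Section Metric.
Variable b : B.
Notation h := (@lb_met B L b).

Lemma met_linr u (a : C) v w : h u (a *: v + w) = a * h u v + h u w.
Proof. by have [] := lb_herm L. Qed.
Lemma metC u v : h v u = (h u v)^*.
Proof. by have [] := lb_herm L. Qed.
Lemma met_r0 u : h u 0 = 0.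
Proof.
have := met_linr u 1 0 0.
by rewrite scale1r addr0 mul1r -[LHS]addr0 => /addrI.
Qed.
Lemma met_ge0 u : 0 <= h u u.
Proof.
have [->|u0] := eqVneq u 0; first by rewrite met_r0.
by have [_ _ hp _] := lb_herm L; exact/ltW/hp.
Qed.
Lemma met_linl u (a : C) v w : h (a *: v + w) u = a^* * h v u + h w u.
Proof. by rewrite metC met_linr rmorphD rmorphM /= -!metC. Qed.
Lemma met_scale (a : C) u : h (a *: u) (a *: u) = `|a| ^+ 2 * h u u.
Proof.
have e v w : h v (a *: w) = a * h v w.
  by rewrite -[a *: w]addr0 met_linr met_r0 addr0.
by rewrite e metC e rmorphM /= -metC mulrA normCK.
Qed.
Lemma met_add u v : h (u + v) (u + v) <= 2 * h u u + 2 * h v v.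
Proof.
have e1 : h (u + v) (u + v) = h u u + h v u + h u v + h v v.
  by rewrite -[u]scale1r met_linr !met_linl !conjC1 !mul1r !scale1r; ring.
have e2 : h (u - v) (u - v) = h u u - h v u - h u v + h v v.
  rewrite addrC -scaleN1r met_linr !met_linl conjCN1 !mulN1r; ring.
have := met_ge0 (u - v); rewrite e1 e2 -subr_ge0 => H.
rewrite -subr_ge0; apply: le_trans H _.
by rewrite subr0 le_eqVlt; apply/orP; left; apply/eqP; ring.
Qed.
End Metric.

End LineBundleSections.

Lemma vanish_comb (B : topologicalType) (k : C) (f g e : B -> C) : 0 <= k ->
  vanishes_at_infinity f -> vanishes_at_infinity g ->
  (forall b, `|e b| <= k * `|f b| + k * `|g b|) -> vanishes_at_infinity e.
Proof.
move=> k0 vf vg H d d0.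
pose d' := d / ((k + 1) * 2).
have k1 : 0 < k + 1 by apply: ltr_wpDl.
have d'0 : 0 < d' by rewrite divr_gt0// mulr_gt0.
have [K cK hK] := vf _ d'0; have [K' cK' hK'] := vg _ d'0.
exists (K `|` K'); first exact: compactU.
move=> b nb; apply: le_lt_trans (H b) _.
have kb : k < k + 1 by rewrite ltrDl.
have lt1 (x : C) : 0 <= x -> x < d' -> k * x <= k * d'.
  by move=> _ xd; apply: ler_wpM2l => //; exact: ltW.
have [/not_orP[nK nK']] : ~ (K b \/ K' b) /\ True by split.
move=> _.
have A : k * `|f b| + k * `|g b| <= k * d' + k * d'.
  by apply: lerD; apply: lt1 => //; [exact: hK|exact: hK'].
apply: le_lt_trans A _.
have -> : k * d' + k * d' = k * (d' * 2) by ring.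
have -> : d = (k + 1) * (d' * 2).
  by rewrite /d'; field; rewrite gt_eqF.
by rewrite ltr_pM2r// mulr_gt0.
Qed.

Lemma C0_bounded (X : topologicalType) (f : C0 X) :
  exists2 M : C, 0 <= M & forall x, `|f x| <= M.
Proof.
have [K cK hK] := C0_van f (@ltr01 C).
have cfK : compact (f @` K).
  by apply: continuous_compact => //; exact/continuous_subspaceT/C0_cont.
move: cfK; rewrite compact_cover.
move=> /(_ C setT (fun x => ball x 1) (fun x _ => ball_open x 1)).
case=> [x _|D _ cov]; first by exists x => //; exact: ballxx.
exists (\sum_(x <- finmap.enum_fset D) `|x| + 1); first by rewrite addr_ge0// sumr_ge0.
move=> y; have [Ky|nKy] := pselect (K y); last first.
  by apply: le_trans (ltW (hK _ nKy)) _; rewrite lerDr sumr_ge0.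
have [|x /= Dx Uxy] := cov (f y); first by exists y.
apply: (@le_trans _ _ (`|x| + 1)).
  rewrite -lerBlDl; apply: le_trans (lerB_dist _ _) _.
  by rewrite distrC; exact: ltW.
by rewrite lerD2r (big_rem x)//= lerDl sumr_ge0.
Qed.

Section Gamma0.
Variables (Y X : topologicalType) (c : tcorr Y X).
Notation B := (tc_Z c).
Notation L := (tc_L c).
Notation s := (@tc_s _ _ c).

Lemma tc_s_fiber_finite (x : X) : finite_set (s @^-1` [set x]).
Proof.
have [[z0 /= z0x]|nz] := pselect (exists z, s z = x); last first.
  by rewrite (_ : _ @^-1` _ = set0)//; apply/seteqP; split=> // z zx; case: nz; exists z.
have cK : compact (s @^-1` [set x]).
  apply: tc_s_proper; first exact: compact_set1.
  by move=> _ ->; exists z0.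
pose F : set_system (set B) := [set A | exists2 S0, finite_set S0 &
  forall S, finite_set S -> S0 `<=` S -> A S].
have FF : Filter F.
  split.
  - by exists set0.
  - move=> P Q [S fS hS] [S' fS' hS']; exists (S `|` S').
      by rewrite finite_setU.
    move=> T fT sub; split; [apply: hS|apply: hS'] => // z Sz; apply: sub.
      by left.
    by right.
  - by move=> P Q PQ [S fS hS]; exists S => // T fT ST; apply: PQ; exact: hS.
have /compact_near_coveringP nc := cK.
have /(_ _) [] := nc _ F (fun S z => s z = x -> S z) FF.
  move=> z /= zx; have [_ /(_ z) [W [oW Wz inj _]]] := tc_s_lhomeo c.
  exists (W, [set S | S z]) => /=.
    split; first exact: open_nbhs_nbhs.
    by exists [set z]; [exact: finite_set1|move=> S _; apply].
  move=> [z' S] /= [Wz' Sz] z'x.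
  by have -> : z' = z by apply: inj; rewrite ?inE// z'x.
move=> S0 fS0 hS; apply: sub_finite_set (fS0).
by move=> z zx; apply: (hS S0 fS0 (@subset_refl _ _)).
Qed.

(* x |-> \sum_(s z = x) <u z, v z>, a finite sum *)
Definition fiber_ip (u v : sections L) (x : X) : C :=
  \sum_(z \in s @^-1` [set x]) lb_met (u z) (v z).

(* The sections u in Gamma_0(L) with <u,u> in C_0(X). The last condition (for
   surjective s, <u,u> is continuous anyway) follows from the second one if the
   cardinality of the fibers of s is bounded, e.g. if X is compact or connected;
   in general it is needed for the inner product to be C_0(X)-valued. *)
Definition Gamma0_set : set (sections L) := [set u |
  [/\ continuous (fun z => tpt (u z)),
      vanishes_at_infinity (fun z => lb_met (u z) (u z)) &
      vanishes_at_infinity (fiber_ip u u)]].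

Lemma fiber_ip_ge0 u x : 0 <= fiber_ip u u x.
Proof. by apply: fsumr_ge0 => z _; exact: met_ge0. Qed.

Lemma fiber_ip_le (k : C) (u v w : sections L) x :
  (forall z, lb_met (w z) (w z) <= k * lb_met (u z) (u z)
                                   + k * lb_met (v z) (v z)) ->
  fiber_ip w w x <= k * fiber_ip u u x + k * fiber_ip v v x.
Proof.
move=> H; rewrite /fiber_ip !(fsbig_finite _ _ (tc_s_fiber_finite x))/=.
by rewrite !mulr_sumr -big_split/=; apply: ler_sum => z _; exact: H.
Qed.

Lemma Gamma0_lin (a : B -> C) (M : C) (u v : sections L) :
  continuous a -> 0 <= M -> (forall b, `|a b| <= M) ->
  Gamma0_set u -> Gamma0_set v ->
  Gamma0_set ((fun b => a b *: u b + v b) : sections L).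
Proof.
move=> ca M0 aM [cu vu fu] [cv vv fv].
pose k := 2 * M ^+ 2 + 2.
have k0 : 0 <= k by rewrite addr_ge0// mulr_ge0// exprn_ge0.
have H z : lb_met (a z *: u z + v z) (a z *: u z + v z) <=
    k * lb_met (u z) (u z) + k * lb_met (v z) (v z).
  apply: le_trans (met_add _ _) _; rewrite met_scale; apply: lerD.
    rewrite mulrA; apply: ler_wpM2r; first exact: met_ge0.
    rewrite /k -[X in X <= _]addr0; apply: lerD => //.
    by apply: ler_wpM2l => //; rewrite lerXn2r ?nnegrE// ?normr_ge0.
  apply: ler_wpM2r; first exact: met_ge0.
  by rewrite /k lerDr mulr_ge0// exprn_ge0.
split; first exact: continuous_section_lin.
  apply: (vanish_comb k0 vu vv) => b /=.
  by rewrite !ger0_norm ?met_ge0.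
apply: (vanish_comb k0 fu fv) => x /=.
by rewrite !ger0_norm ?fiber_ip_ge0//; exact: fiber_ip_le.
Qed.

Lemma Gamma0_zero : Gamma0_set 0.
Proof.
split; first exact: continuous_section0.
  move=> e e0; exists set0; first exact: compact0.
  by move=> b _; rewrite met_r0 normr0.
move=> e e0; exists set0; first exact: compact0.
by move=> x _; rewrite /fiber_ip fsbig1 ?normr0// => z _; rewrite met_r0.
Qed.

Definition Gamma0_pred : {pred sections L} := [pred u | `[< Gamma0_set u >]].

Fact Gamma0_submod_closed : submod_closed Gamma0_pred.
Proof.
split; first by rewrite inE; exact: Gamma0_zero.
move=> a u v; rewrite !inE => hu hv.
apply: (@Gamma0_lin (fun=> a) `|a|) => //; exact: cst_continuous.
Qed.

HB.instance Definition _ :=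
  GRing.isSubmodClosed.Build C (sections L) Gamma0_pred Gamma0_submod_closed.

Record Gamma0 : Type :=
  MkGamma0 { G0_sec : sections L; G0_secP : G0_sec \in Gamma0_pred }.

HB.instance Definition _ := [isSub for G0_sec].
HB.instance Definition _ := [Choice of Gamma0 by <:].
HB.instance Definition _ := [SubChoice_isSubLmodule of Gamma0 by <:].

Lemma G0_Gamma0 (u : Gamma0) : Gamma0_set (G0_sec u).
Proof. by have := G0_secP u; rewrite inE. Qed.

Fact G0_mul_subproof (W : topologicalType) (p : B -> W) (f : C0 W) (u : Gamma0) :
  continuous p ->
  ((fun b => f (p b) *: G0_sec u b) : sections L) \in Gamma0_pred.
Proof.
move=> cp; have [M M0 fM] := C0_bounded f.
rewrite inE.
rewrite (_ : (fun b => _) = (fun b => f (p b) *: G0_sec u b + (0 : sections L) b)).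
  apply: (@Gamma0_lin (f \o p) M) => //.
  - by move=> b; apply: continuous_comp; [exact: cp|exact: C0_cont].
  - by move=> b; exact: fM.
  - exact: G0_Gamma0.
  - exact: Gamma0_zero.
by apply: functional_extensionality_dep => b; rewrite addr0.
Qed.

Definition G0_mul (W : topologicalType) (p : B -> W) (cp : continuous p)
  (f : C0 W) (u : Gamma0) : Gamma0 := MkGamma0 (G0_mul_subproof f u cp).

End Gamma0.

(* The data of a C*-correspondence from C_0(Y) to C_0(X); the inner product is
   conjugate-linear in its first variable. The axioms are not recorded: every
   notion below is defined from the data, and is used for Gamma0_corr only. *)
Record corr (Y X : topologicalType) := Corr {
  corr_mod :> lmodType C;
  ip : corr_mod -> corr_mod -> X -> C;
  ract : corr_mod -> C0 X -> corr_mod;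
  lact : C0 Y -> corr_mod -> corr_mod }.

Definition corr_iso (Y X : topologicalType) (E E' : corr Y X) : Prop :=
  exists U : {linear E -> E'},
    [/\ bijective U,
        forall u v x, ip (U u) (U v) x = ip u v x,
        forall u f, U (ract u f) = ract (U u) f &
        forall g u, U (lact g u) = lact g (U u)].

Section GammaCorr.
Variables (Y X : topologicalType) (c : tcorr Y X).

Definition Gamma0_corr : corr Y X :=
  @Corr Y X (Gamma0 c)
    (fun u v => fiber_ip (G0_sec u) (G0_sec v))
    (fun u f => G0_mul (tc_s_lhomeo c).1 f u)
    (fun g u => G0_mul (@tc_r_cont _ _ c) g u).

End GammaCorr.

Definition locally_conjugate (Y X : topologicalType) (c c' : tcorr Y X) : Prop :=
  forall x : X, exists2 U : set X, open_nbhs x U &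
    exists (phi : @tc_s _ _ c @^-1` U -> @tc_s _ _ c' @^-1` U)
           (psi : @tc_s _ _ c' @^-1` U -> @tc_s _ _ c @^-1` U),
      [/\ cancel phi psi, cancel psi phi, continuous phi, continuous psi &
          forall z, tc_s (\val (phi z)) = tc_s (\val z) /\
                    tc_r (\val (phi z)) = tc_r (\val z)].

Section Operators.
Variables (Y X : topologicalType) (E : corr Y X).
Implicit Types (T S : E -> E) (A : set (E -> E)) (u v a b : E) (x : X).

(* Norm of u in the fiber at x, and norm of u in E. *)
Definition fnorm u x : R := Num.sqrt (complex.Re (ip u u x)).
Definition enorm u : R := sup (range (fnorm u)).

Definition is_adjoint T S : Prop :=
  forall u v x, ip (T u) v x = ip u (S v) x.

(* T = theta_{a,b} : u |-> a <b,u>. *)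
Definition is_theta a b T : Prop :=
  forall u, exists2 f : C0 X, (forall x, f x = ip b u x) & T u = ract a f.

Definition norm_closure A : set (E -> E) := [set T |
  forall e : R, 0 < e ->
    exists2 S, A S & forall u, enorm (T u - S u) <= e * enorm u].

Definition compact_ops : set (E -> E) :=
  norm_closure (lspan [set T | exists a b, is_theta a b T]).

Definition cstar_subalgebra A : Prop :=
  [/\ A `<=` compact_ops, submodule A,
      forall T S, A T -> A S -> A (T \o S),
      forall T, A T -> exists2 S, A S & is_adjoint T S &
      norm_closure A `<=` A].

Definition iota_op (f : C0 X) : E -> E := fun u => ract u f.
Definition phi_op (g : C0 Y) : E -> E := lact g.

Definition cstar_iota_phi : set (E -> E) :=
  smallest cstar_subalgebra (range iota_op `|` range phi_op).

Definition commutant A : set (E -> E) :=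
  [set T | compact_ops T /\ forall S, A S -> T \o S = S \o T].

(* E restricted to Q, i.e. modulo the submodule of the u vanishing on Q; for
   Q = [set x] this is the fiber E_x. (The lspan is only there to get a
   submodule by definition.) *)
Definition vanishing_on (Q : set X) : set E :=
  [set u | forall x, Q x -> ip u u x = 0].
Definition restr (Q : set X) : lmodType C := lquot (vanishing_on Q).
Definition restr_op (Q : set X) T : restr Q -> restr Q :=
  fun q => lclass _ (T (lrepr q)).

Definition constant_rank A : Prop :=
  exists n : nat, forall x, has_dim (restr_op (Q := [set x]) @` A) n.

End Operators.

Section Gelfand.
Variables (Y X : topologicalType) (E : corr Y X) (D : set (E -> E)).

(* D carries no algebra structure as a type: the operations are those of
   E -> E. *)
Definition character (chi : D -> C) : Prop :=
  [/\ exists d, chi d != 0,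
      forall d1 d2 d3 : D, \val d3 = \val d1 + \val d2 ->
        chi d3 = chi d1 + chi d2,
      forall (a : C) (d1 d2 : D), \val d2 = a *: \val d1 -> chi d2 = a * chi d1,
      forall d1 d2 d3 : D, \val d3 = \val d1 \o \val d2 ->
        chi d3 = chi d1 * chi d2 &
      forall d1 d2 : D, is_adjoint (\val d1) (\val d2) -> chi d2 = (chi d1)^*].

(* The spectrum of D, with the topology of pointwise convergence. *)
Definition spectrum : topologicalType :=
  set_type (character : set {ptws D -> C}).

Definition ev (z : spectrum) (d : D) : C := (\val z : D -> C) d.

(* The singleton {s_E z}, where s_E is dual to iota: z o iota = ev at s_E z. *)
Definition sdual (z : spectrum) : set X :=
  [set x | forall (f : C0 X) (d : D), \val d = iota_op f -> ev z d = f x].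

(* d lifts p_z: p_z is 1 at z and 0 at the other points of the fiber of s_E. *)
Definition lifts_minproj (z : spectrum) (d : D) : Prop :=
  ev z d = 1 /\ forall w, sdual w = sdual z -> w <> z -> ev w d = 0.

(* p_z E_x with x = s_E z. *)
Definition VD_fib (z : spectrum) : lmodType C :=
  lspan_mod [set v : restr E (sdual z) |
    exists2 d : D, lifts_minproj z d & range (restr_op (\val d)) v].

(* The v in p_z E_x with z in U and || v - p_z u(x) || < e. *)
Definition VD_tube (U : set spectrum) (u : E) (e : R) :
    set {z : spectrum & VD_fib z} :=
  [set t | U (projT1 t) /\ exists d x,
     [/\ lifts_minproj (projT1 t) d, sdual (projT1 t) x &
         fnorm (lrepr (lspan_val (projT2 t)) - \val d u) x < e]].

(* The topology on the total space is the one for which the continuous sections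
   are those of the D-module E. *)
Definition VD : vfamily spectrum :=
  @VFamily spectrum VD_fib (Topological.class (gen_topology
    [set W | exists U u e, [/\ open U, 0 < e & W = VD_tube U u e]])).

End Gelfand.

Section StarIso.
Variables (Y X : topologicalType) (E E' : corr Y X).

Definition star_hom (F F' : corr Y X) (D : set (F -> F)) (D' : set (F' -> F'))
    (Pi : D -> D') : Prop :=
  [/\ forall d1 d2 d3 : D, \val d3 = \val d1 + \val d2 ->
        \val (Pi d3) = \val (Pi d1) + \val (Pi d2),
      forall (a : C) (d1 d2 : D), \val d2 = a *: \val d1 ->
        \val (Pi d2) = a *: \val (Pi d1),
      forall d1 d2 d3 : D, \val d3 = \val d1 \o \val d2 ->
        \val (Pi d3) = \val (Pi d1) \o \val (Pi d2) &
      forall d1 d2 : D, is_adjoint (\val d1) (\val d2) ->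
        is_adjoint (\val (Pi d1)) (\val (Pi d2))].

(* That the inverse is a *-homomorphism is automatic for *-algebras. *)
Record star_iso (F F' : corr Y X) (D : set (F -> F)) (D' : set (F' -> F')) :=
  StarIso {
    si_fun :> D -> D';
    si_inv : D' -> D;
    si_funK : cancel si_fun si_inv;
    si_invK : cancel si_inv si_fun;
    si_fun_hom : star_hom si_fun;
    si_inv_hom : star_hom si_inv }.

Definition star_iso_sym (F F' : corr Y X) (D : set (F -> F))
    (D' : set (F' -> F')) (P : star_iso D D') : star_iso D' D :=
  StarIso (si_invK P) (si_funK P) (si_inv_hom P) (si_fun_hom P).

Variables (D : set (E -> E)) (D' : set (E' -> E')).

Fact gelfand_dual_subproof (P : star_iso D D') (z : spectrum D') :
  character (fun d => ev z (P d)).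
Proof.
have [] : character (ev z) by have := valP z; rewrite inE.
move=> [d hd] hD hZ hM hA; have [pD pZ pM pA] := si_fun_hom P; split.
- by exists (si_inv P d); rewrite si_invK.
- by move=> ? ? ? /pD /hD.
- by move=> ? ? ? /pZ /hZ.
- by move=> ? ? ? /pM /hM.
- by move=> ? ? /pA /hA.
Qed.

Definition gelfand_dual (P : star_iso D D') (z : spectrum D') : spectrum D :=
  exist _ (fun d => ev z (P d)) (mem_set (gelfand_dual_subproof P z)).

(* Pi o iota_E = iota_E' and Pi o phi_E = phi_E' *)
Definition intertwines (P : star_iso D D') : Prop :=
  (forall (f : C0 X) (d : D), \val d = iota_op f -> \val (P d) = iota_op f) /\
  (forall (g : C0 Y) (d : D), \val d = phi_op g -> \val (P d) = phi_op g).

End StarIso.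

End Bundles.

Arguments cstar_iota_phi {R Y X} E.
Arguments compact_ops {R Y X} E.

(* Main.v *)
Require Import Defs.
From HB Require Import structures.
From mathcomp Require Import all_boot all_order all_algebra complex perm.
From mathcomp Require Import all_classical all_reals all_analysis.
From mathcomp Require Import ring lra.

Set Implicit Arguments.
Unset Strict Implicit.
Unset Printing Implicit Defensive.

Import Order.TTheory GRing.Theory Num.Theory numFieldNormedType.Exports.

Local Open Scope classical_set_scope.
Local Open Scope ring_scope.

(* A symbol is a function k on Z, acting on sections by multiplication. Since the compact
   operators on E that commute with multiplication by C_0(Z) are the multiplications by
   functions in C_0(Z), both algebras D consist of such multiplications, by functions that
   do not separate z and w when the germs of r along the sheets of s through z and w agree;
   the double commutant consists of all of these. A character of D is the evaluation of
   symbols at a point z of Z, and p_z is the projection onto the class of z in its fiber.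
   Constant rank gives idempotent symbols that cut out the classes locally, hence the
   topology of the bundle V^D.

   An isomorphism U of correspondences is fiberwise over X, since it commutes with C_0(X),
   and conjugation by U is Pi; U itself is an isomorphism of the bundles V^D. Expanded in
   unit sections supported on single sheets over x, U has an invertible matrix, so some
   permutation matches the sheets of Z and Z' with nonvanishing entries. The entries stay
   nonzero near x, and U intertwines the left actions, so r and r' agree along matching
   sheets.

   Conversely, a local conjugacy identifies germs, which transports symbols and gives Pi.
   An isomorphism of the bundles V^D over Pi is a continuous family W of invertible maps
   between the spaces of sections over the fibers of s and s' that commutes with
   multiplication by functions on X and on Y. The unitary part of the polar decomposition
   of W, obtained as a locally uniform limit of Newton-Schulz iterates, is continuous and
   commutes with them too: it is an isomorphism of correspondences. *)

(** The record [symalg] lists what the symbols of both algebras have in common; afterwards the two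
    cases separate only when elements are carried along a local conjugacy or an isomorphism. As
    several points of [Z] can represent one character, facts about the spectrum and its bundle are
    stated for an arbitrary representative ([at_point]), and elements of the bundle are handled
    through their values along a fiber of [s]. Constant rank enters because dim D_x is the number of
    classes in the fiber over x. If this number does not change, classes neither split nor merge
    near x, so that one element of D lifts p_z for all nearby points of the spectrum. The obstacle
    in the converse is that a bundle isomorphism need not be isometric and has no global bounds. The
    Newton-Schulz step uses only sums, compositions and adjoints, so each iterate remains a [bmap].
    For E = 1 - BA it replaces E by (3/4)E^2 + (1/4)E^3, and the resulting rate of convergence
    depends continuously on x, hence is locally uniform. *)

Definition cont_at (T U : topologicalType) (f : T -> U) (z : T) : Prop :=
  {for z, continuous f}.

Lemma cont_at_near (T U : topologicalType) (f g : T -> U) (z : T) :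
  (\forall t \near z, f t = g t) -> cont_at f z -> cont_at g z.
Proof.
move=> fg; rewrite /cont_at /prop_for/= /continuous_at (nbhs_singleton fg).
by apply: cvg_trans; apply: near_eq_cvg.
Qed.

Lemma cont_at_comp (T U V : topologicalType) (f : T -> U) (g : U -> V) (z : T) :
  cont_at f z -> cont_at g (f z) -> cont_at (fun t => g (f t)) z.
Proof. exact: continuous_comp. Qed.

Lemma cont_at_cst (T U : topologicalType) (a : U) (z : T) : cont_at (fun=> a) z.
Proof. exact: cst_continuous. Qed.

Lemma cont_atW (T U : topologicalType) (f : T -> U) : continuous f ->
  forall z, cont_at f z.
Proof. by []. Qed.

Arguments cont_atW {T U f} _ z.

Lemma cont_atP (T U : topologicalType) (f : T -> U) :
  (forall z, cont_at f z) -> continuous f.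
Proof. by []. Qed.

Lemma cont_at_nbhs (T U : topologicalType) (f : T -> U) (z : T) (A : set U) :
  cont_at f z -> nbhs (f z) A -> \forall t \near z, A (f t).
Proof. by move=> cf fA; exact: (cf A fA). Qed.

(** * Complex scalars and Hermitian forms *)

Section ComplexScalars.
Variable R : realType.
Notation C := (cplx R).
Implicit Types (a b : C) (r : R).

Definition rC (r : R) : C := real_complex R r.
Definition nc (a : C) : R := ComplexField.Normc.normc a.
Definition re (a : C) : R := complex.Re a.

Lemma normC_nc a : `|a| = rC (nc a). Proof. by []. Qed.
Lemma rCD r (t : R) : rC (r + t) = rC r + rC t. Proof. exact: rmorphD. Qed.
Lemma rCB r (t : R) : rC (r - t) = rC r - rC t. Proof. exact: rmorphB. Qed.
Lemma rCM r (t : R) : rC (r * t) = rC r * rC t. Proof. exact: rmorphM. Qed.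
Lemma rCV r : rC r^-1 = (rC r)^-1. Proof. exact: fmorphV. Qed.
Lemma rC_inj : injective rC. Proof. by move=> r t []. Qed.
Lemma rC0 : rC 0 = 0. Proof. by []. Qed.
Lemma rC1 : rC 1 = 1. Proof. by []. Qed.
Lemma rCX r n : rC (r ^+ n) = rC r ^+ n. Proof. exact: rmorphXn. Qed.
Lemma ler_rC r (t : R) : (rC r <= rC t) = (r <= t). Proof. exact: lecR. Qed.
Lemma ltr_rC r (t : R) : (rC r < rC t) = (r < t). Proof. exact: ltcR. Qed.
Lemma rC_ge0 r : (0 <= rC r) = (0 <= r). Proof. exact: ler0c. Qed.
Lemma re_rC r : re (rC r) = r. Proof. by []. Qed.
Lemma reD a b : re (a + b) = re a + re b. Proof. by case: a b => ? ? []. Qed.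
Lemma reB a b : re (a - b) = re a - re b. Proof. by case: a b => ? ? []. Qed.
Lemma reN a : re (- a) = - re a. Proof. by case: a. Qed.
Lemma ge0_re a : 0 <= a -> rC (re a) = a.
Proof. by move=> a0; apply: RRe_real; exact: ger0_real. Qed.
Lemma re_ge0 a : 0 <= a -> 0 <= re a.
Proof. by move=> a0; rewrite -rC_ge0 ge0_re. Qed.
Lemma gt0_rC a : 0 < a -> exists2 r, 0 < r & a = rC r.
Proof.
move=> a0; exists (re a); last by rewrite ge0_re// ltW.
by rewrite -ltr_rC ge0_re ?ltW.
Qed.

Lemma nc_ge0 a : 0 <= nc a. Proof. by rewrite -rC_ge0 -normC_nc. Qed.
Lemma nc0 : nc 0 = 0. Proof. by apply: rC_inj; rewrite -normC_nc normr0. Qed.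
Lemma nc1 : nc 1 = 1. Proof. by apply: rC_inj; rewrite -normC_nc normr1. Qed.
Lemma nc_eq0 a : (nc a == 0) = (a == 0).
Proof. by rewrite -[RHS]normr_eq0 normC_nc -(inj_eq rC_inj). Qed.
Lemma ncM a b : nc (a * b) = nc a * nc b.
Proof. by apply: rC_inj; rewrite rCM -!normC_nc normrM. Qed.
Lemma ncX a n : nc (a ^+ n) = nc a ^+ n.
Proof. by apply: rC_inj; rewrite rCX -!normC_nc normrX. Qed.
Lemma ncN a : nc (- a) = nc a.
Proof. by apply: rC_inj; rewrite -!normC_nc normrN. Qed.
Lemma nc_dist a b : nc (a - b) = nc (b - a).
Proof. by apply: rC_inj; rewrite -!normC_nc distrC. Qed.
Lemma ncV a : nc a^-1 = (nc a)^-1.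
Proof. by apply: rC_inj; rewrite rCV -!normC_nc normfV. Qed.
Lemma ncD a b : nc (a + b) <= nc a + nc b.
Proof. by rewrite -ler_rC rCD -!normC_nc ler_normD. Qed.
Lemma ncB a b : nc a - nc b <= nc (a - b).
Proof. by rewrite -ler_rC rCB -!normC_nc lerB_dist. Qed.
Lemma nc_conj a : nc a^* = nc a.
Proof. by apply: rC_inj; rewrite -!normC_nc norm_conjC. Qed.
Lemma nc_rC r : 0 <= r -> nc (rC r) = r.
Proof. by move=> r0; apply: rC_inj; rewrite -normC_nc ger0_norm// rC_ge0. Qed.
Lemma nc_sqr a : rC (nc a ^+ 2) = a^* * a.
Proof. by rewrite rCX -normC_nc mulrC normCK. Qed.
Lemma re_le_nc a : re a <= nc a.
Proof.
rewrite -ler_rC -normC_nc; apply: le_trans (normc_ge_Re a).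
by rewrite lecR; exact: ler_norm.
Qed.
Lemma rC_conj r : (rC r)^* = rC r.
Proof. by apply/CrealP; apply/complex_realP; exists r. Qed.
Lemma re_addJ a : a + a^* = rC (2 * re a).
Proof.
have e : a = rC (re a) + 'i * rC (complex.Im a) by exact: complexE.
rewrite [in X in _ + X]e rmorphD rmorphM /= conjCi mulNr !rC_conj.
rewrite {1}e rCM; have -> : rC (2 : R) = 2 by exact: rmorph_nat.
by ring.
Qed.

Lemma cont_atC (T : topologicalType) (f : T -> C) (z : T) :
  cont_at f z <->
  forall e : R, 0 < e -> \forall z' \near z, nc (f z - f z') < e.
Proof.
split=> [cf e e0|H].
  have /cvgrPdist_lt/(_ (rC e)) := cf; rewrite -rC0 ltr_rC => /(_ e0).
  by apply: filterS => z'; rewrite normC_nc ltr_rC.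
apply/cvgrPdist_lt => e /gt0_rC[r r0 ->].
by apply: filterS (H _ r0) => z'; rewrite normC_nc ltr_rC.
Qed.

Lemma cont_atM (T : topologicalType) (f g : T -> C) (z : T) :
  cont_at f z -> cont_at g z ->
  cont_at (fun t => f t * g t) z.
Proof. exact: (@continuousM _ _ f g z). Qed.

Lemma cont_atD (T : topologicalType) (f g : T -> C) (z : T) :
  cont_at f z -> cont_at g z ->
  cont_at (fun t => f t + g t) z.
Proof. exact: (@continuousD _ _ _ f g z). Qed.

Lemma cont_atV (T : topologicalType) (f : T -> C) (z : T) :
  cont_at f z -> f z != 0 -> cont_at (fun t => (f t)^-1) z.
Proof. by move=> cf fz; exact: (@continuousV _ _ f z). Qed.

Lemma cont_at_conj (T : topologicalType) (f : T -> C) (z : T) :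
  cont_at f z -> cont_at (fun t => (f t)^*) z.
Proof.
move=> /cont_atC cf; apply/cont_atC => e e0.
by apply: filterS (cf e e0) => z'; rewrite -rmorphB nc_conj.
Qed.

Lemma cont_at_re (T : topologicalType) (f : T -> C) (z : T) :
  cont_at f z -> cont_at (fun t => re (f t)) z.
Proof.
move=> /cont_atC cf; apply/cvgrPdist_lt => e e0.
near=> z'; apply: le_lt_trans (_ : nc (f z - f z') < e); last by near: z'; exact: cf.
rewrite -reB ler_norml re_le_nc andbT lerNl -ncN.
by apply: le_trans (re_le_nc _); rewrite reN.
Unshelve. all: by end_near. Qed.

Lemma cont_at_rC (T : topologicalType) (f : T -> R) (z : T) :
  cont_at f z -> cont_at (fun t => rC (f t)) z.
Proof.
move=> /cvgrPdist_lt cf; apply/cont_atC => e e0.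
apply: filterS (cf e e0) => z'; rewrite -rCB => H; rewrite -ltr_rC -normC_nc.
by rewrite normc_def/= expr0n addr0 sqrtr_sqr ltcR.
Qed.

End ComplexScalars.

Lemma near_neq0 (R : realType) (T : topologicalType) (f : T -> cplx R) (t : T) :
  cont_at f t -> f t <> 0 -> \forall a \near t, f a <> 0.
Proof.
move=> /cont_atC cf /eqP f0; have fp : 0 < nc (f t) by rewrite lt0r nc_eq0 f0 nc_ge0.
by apply: filterS (cf _ fp) => a lt fa; rewrite fa subr0 ltxx in lt.
Qed.

Section SemiInner.
Variables (R : realType) (V : lmodType (cplx R)) (h : V -> V -> cplx R).
Notation C := (cplx R).
Hypothesis linr : forall u (a : C) v w, h u (a *: v + w) = a * h u v + h u w.
Hypothesis conjs : forall u v, h v u = (h u v)^*.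
Hypothesis hge0 : forall u, 0 <= h u u.

Definition hn (v : V) : R := Num.sqrt (re (h v v)).

Lemma hn_ge0 v : 0 <= hn v. Proof. exact: sqrtr_ge0. Qed.
Lemma hn_sqr v : rC (hn v ^+ 2) = h v v.
Proof. by rewrite sqr_sqrtr ?ge0_re// re_ge0. Qed.
Lemma h_r0 u : h u 0 = 0.
Proof. by have := linr u 1 0 0; rewrite scale1r addr0 mul1r -[LHS]addr0 => /addrI. Qed.
Lemma h_l0 u : h 0 u = 0. Proof. by rewrite conjs h_r0 conjC0. Qed.
Lemma h_Dr u v w : h u (v + w) = h u v + h u w.
Proof. by rewrite -[v]scale1r linr mul1r scale1r. Qed.
Lemma h_Zr u a v : h u (a *: v) = a * h u v.
Proof. by rewrite -[a *: v]addr0 linr h_r0 addr0. Qed.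
Lemma h_Dl u v w : h (v + w) u = h v u + h w u.
Proof. by rewrite conjs h_Dr rmorphD /= -!conjs. Qed.
Lemma h_Zl u a v : h (a *: v) u = a^* * h v u.
Proof. by rewrite conjs h_Zr rmorphM /= -conjs. Qed.
Lemma h_Nr u v : h u (- v) = - h u v.
Proof. by rewrite -scaleN1r h_Zr mulN1r. Qed.
Lemma h_Nl u v : h (- v) u = - h v u.
Proof. by rewrite -scaleN1r h_Zl rmorphN /= conjC1 mulN1r. Qed.

Lemma cauchy_schwarz u v : nc (h u v) <= hn u * hn v.
Proof.
have key w z : h w w != 0 -> nc (h w z) <= hn w * hn z.
  move=> w0; have := hge0 (h w w *: z - h w z *: w).
  rewrite h_Dr h_Nr h_Zr h_Zr !h_Dl !h_Nl !h_Zl.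
  have hww : (h w w)^* = h w w by rewrite -conjs.
  rewrite hww (conjs w z) => H.
  have : 0 <= h w w * (h w w * h z z - (h w z)^* * h w z).
    by apply: le_trans H _; rewrite le_eqVlt; apply/orP; left; apply/eqP; ring.
  have wp : 0 < h w w by rewrite lt_def w0 hge0.
  rewrite pmulr_rge0// -nc_sqr -!hn_sqr -rCM -rCB rC_ge0 subr_ge0.
  by rewrite -exprMn ler_pXn2r ?nnegrE ?nc_ge0// mulr_ge0 ?hn_ge0.
have [u0|u0] := eqVneq (h u u) 0; last exact: key.
have [v0|v0] := eqVneq (h v v) 0; last first.
  by rewrite conjs nc_conj mulrC; exact: key.
(* Both vectors are null here, and this combination turns positivity into -2|<u,v>|^2 >= 0. *)
have := hge0 (- h u v *: u + v).
rewrite linr !h_Dl !h_Zl u0 v0 !(mulr0, addr0, add0r) rmorphN /= (conjs u v).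
have -> : - h u v * (h u v)^* + - (h u v)^* * h u v = - (2 * ((h u v)^* * h u v)).
  by ring.
rewrite oppr_ge0 pmulr_rle0// -nc_sqr -rC0 ler_rC => H.
have /eqP : nc (h u v) ^+ 2 = 0 by apply/eqP; rewrite eq_le H sqr_ge0.
by rewrite expf_eq0/= => /eqP ->; rewrite mulr_ge0 ?hn_ge0.
Qed.

Lemma hnD u v : hn (u + v) <= hn u + hn v.
Proof.
rewrite -(@ler_pXn2r _ 2)// ?nnegrE ?addr_ge0 ?hn_ge0//.
rewrite -ler_rC hn_sqr h_Dr !h_Dl sqrrD !rCD !hn_sqr.
have -> : h u u + h v u + (h u v + h v v) = h u u + (h u v + h v u) + h v v by ring.
rewrite lerD2r lerD2l (conjs u v).
have -> : h u v + (h u v)^* = rC (2 * re (h u v)).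
  exact: re_addJ.
rewrite -rCD ler_rC.
rewrite (_ : hn u * hn v + hn u * hn v = 2 * (hn u * hn v)); last by ring.
rewrite ler_pM2l//.
exact: le_trans (re_le_nc _) (cauchy_schwarz _ _).
Qed.

Lemma hnZ a v : hn (a *: v) = nc a * hn v.
Proof.
apply/eqP; rewrite -(@eqrXn2 _ 2)// ?mulr_ge0 ?hn_ge0 ?nc_ge0//.
apply/eqP; apply: rC_inj; rewrite hn_sqr exprMn rCM hn_sqr nc_sqr h_Zr h_Zl; ring.
Qed.

Lemma hn0 : hn 0 = 0. Proof. by rewrite /hn h_r0 sqrtr0. Qed.
Lemma hnN v : hn (- v) = hn v.
Proof. by rewrite -scaleN1r hnZ ncN nc1 mul1r. Qed.
End SemiInner.

(** * Functions vanishing at infinity *)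

(** The supersets of the sets in the ideal [P] generate a filter on sets, and compactness in its
    near-covering form then yields one set of [P] that contains [K]. It serves to build a function
    bounded below on [K] from functions that are positive near single points. *)
Lemma compact_ind (T : topologicalType) (P : set T -> Prop) (K : set T) :
  compact K -> P set0 -> (forall A B, P A -> P B -> P (A `|` B)) ->
  (forall A B, A `<=` B -> P B -> P A) ->
  (forall x, K x -> exists2 U, nbhs x U & P U) -> P K.
Proof.
move=> cK P0 PU PS loc.
pose F : set_system (set T) := [set A | exists2 S0, P S0 &
  forall S, S0 `<=` S -> A S].
have FF : Filter F.
  split; first by exists set0.
  - move=> A B [S PSa hS] [S' PS' hS']; exists (S `|` S'); first exact: PU.
    by move=> S2 sub; split; [apply: hS|apply: hS'] => t St; apply: sub; [left|right].
  - by move=> A B AB [S PSa hS]; exists S => // S2 ?; apply: AB; exact: hS.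
have /compact_near_coveringP/(_ _ F (fun S x => S x) FF) := cK.
case=> [x Kx|S PSa /(_ S (@subset_refl _ _)) KS]; last exact: PS KS PSa.
have [U Ux PUU] := loc x Kx.
exists (U, [set S | U `<=` S]); first by split=> //=; exists U.
by move=> [y S] /= [Uy US]; exact: US.
Qed.

Section Bumps.
Variables (R : realType) (T : topologicalType).
Hypotheses (lcT : locally_compact [set: T]) (T2 : hausdorff_space T).
Notation C := (cplx R).

Lemma compact_nbhs (x : T) : exists2 K : set T, compact K & nbhs x K.
Proof. by have [U] := @lcT x I; rewrite withinET => Ux [cU clU]; exists U. Qed.

Lemma urysohn_bump (x : T) (U : set T) : nbhs x U ->
  exists b : T -> R, exists K : set T,
  [/\ continuous b, forall t, 0 <= b t <= 1, \forall t \near x, b t = 1,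
      compact K /\ K `<=` U & forall t, ~ K t -> b t = 0].
Proof.
move=> Ux; have [K cK Kx] := compact_nbhs x.
have clK : closed K by exact: compact_closed.
have [V oV [Vx VUK]] : exists2 V : set T, open V & V x /\ V `<=` U `&` K.
  have : nbhs x (U `&` K) by exact: filterI.
  by rewrite nbhsE => -[V [oV Vx] VS]; exists V.
have creg := @locally_compact_completely_regular T R lcT T2.
have regT := @completely_regular_regular R T creg.
have [V' V'x clV'] : exists2 V' : set T, nbhs x V' & closure V' `<=` V.
  by have [V' ? ?] := regT x V (open_nbhs_nbhs (conj oV Vx)); exists V'.
have clC : closed (~` (V'°)) by rewrite closedC; exact: open_interior.
have nx : ~ (~` (V'°)) x by apply.
have [f [cf f01 f0 f1]] :
    exists f : T -> R, [/\ continuous f, range f `<=` `[0, 1],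
      f @` [set x] `<=` [set 0] & f @` (~` (V'°)) `<=` [set 1]].
  exact/uniform_separatorP/creg.
have f01' t : 0 <= f t <= 1.
  have := f01 (f t) (ex_intro2 _ _ t I erefl); by rewrite /= in_itv.
have fx : f x = 0 by apply: f0; exists x.
(* [f] is 0 only known at [x] itself; the truncation equals 1 wherever f <= 1/3, hence on a whole
   neighbourhood of [x], and 0 wherever f >= 2/3. *)
pose b t := Num.min 1 (Num.max 0 (2 - 3 * f t)).
exists b, (closure V'); split.
- move=> t; apply: (@continuous_min R T (fun=> 1) (fun t => Num.max 0 (2 - 3 * f t))).
    exact: cst_continuous.
  apply: (@continuous_max R T (fun=> 0) (fun t => 2 - 3 * f t)); first exact: cst_continuous.
  apply: (@continuousB R R^o T (fun=> 2) (fun t => 3 * f t)); first exact: cst_continuous.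
  by apply: (@continuousM _ _ (fun=> 3) f); [exact: cst_continuous|exact: cf].
- by move=> t; rewrite /b ge_min lexx/= le_min ler01 le_max lexx.
- near=> t.
  have ft : f t < 3^-1.
    near: t; have /cvgrPdist_lt/(_ 3^-1) := cf x; rewrite fx invr_gt0 => /(_ (ltr0Sn _ 2)).
    apply: filterS => t; rewrite sub0r normrN; apply: le_lt_trans; exact: ler_norm.
  rewrite /b max_r; first by rewrite min_l//; lra.
  lra.
- split.
    apply: (subclosed_compact _ cK); first exact: closed_closure.
    by move=> t /clV' /VUK [].
  by move=> t /clV' /VUK [].
- move=> t nt; have ft : f t = 1.
    apply: f1; exists t => //= ti; apply: nt; apply: subset_closure.
    exact: interior_subset.
  by rewrite /b ft max_l ?min_r//; lra.
Unshelve. all: by end_near. Qed.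

Definition c0fun (f : T -> C) : Prop := continuous f /\ vanishes_at_infinity f.

Definition mkC0 (f : T -> C) (cf : c0fun f) : C0 R T := MkC0 cf.1 cf.2.

Lemma C0_c0fun (f : C0 R T) : c0fun f.
Proof. by split; [exact: C0_cont|exact: C0_van]. Qed.

Lemma vanishP (f : T -> C) : vanishes_at_infinity f <->
  forall e : R, 0 < e -> exists2 K : set T, compact K & forall x, ~ K x -> nc (f x) < e.
Proof.
split=> H e e0.
  have [|K cK hK] := H (rC e); first by rewrite -rC0 ltr_rC.
  by exists K => // x /hK; rewrite normC_nc ltr_rC.
have [r r0 ->] := gt0_rC e0; have [K cK hK] := H r r0.
by exists K => // x /hK; rewrite normC_nc ltr_rC.
Qed.

Lemma c0fun_bounded (f : T -> C) : c0fun f ->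
  exists2 M : R, 0 < M & forall x, nc (f x) <= M.
Proof.
move=> cf; have [M M0 H] := C0_bounded (mkC0 cf).
exists (re M + 1); first by rewrite ltr_wpDl// re_ge0.
move=> x; rewrite -ler_rC rCD ge0_re//; apply: le_trans (H x) _.
by rewrite lerDl.
Qed.

Lemma c0fun_supp (f : T -> C) (K : set T) : continuous f -> compact K ->
  (forall t, ~ K t -> f t = 0) -> c0fun f.
Proof.
move=> cf cK fK; split=> //; apply/vanishP => e e0; exists K => // x /fK ->.
by rewrite nc0.
Qed.

Lemma c0fun_bump (x : T) (U : set T) : nbhs x U ->
  exists b : T -> R, exists K : set T, [/\ c0fun (fun t => rC (b t) : C),
     compact K /\ K `<=` U,
     forall t, 0 <= b t <= 1, \forall t \near x, b t = 1 & forall t, ~ K t -> b t = 0].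
Proof.
move=> Ux; have [b [K [cb b01 b1 [cK KU] bK]]] := urysohn_bump Ux.
exists b, K; split => //; apply: c0fun_supp cK _ => [t|t /bK ->//].
by apply: cont_at_rC; exact: cb.
Qed.

Lemma c0fun_le (f g e : T -> C) (k : R) : continuous e -> c0fun f -> c0fun g ->
  0 <= k -> (forall t, nc (e t) <= k * nc (f t) + k * nc (g t)) -> c0fun e.
Proof.
move=> ce [_ vf] [_ vg] k0 H; split=> //.
apply: (@vanish_comb R T (rC k) f g) => //; first by rewrite rC_ge0.
by move=> b; rewrite !normC_nc -!rCM -rCD ler_rC.
Qed.

Lemma c0funD (f g : T -> C) : c0fun f -> c0fun g -> c0fun (fun t => f t + g t).
Proof.
move=> cf cg; apply: (c0fun_le _ cf cg ler01).
  by move=> t; apply: continuousD; [exact: cf.1|exact: cg.1].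
by move=> t; rewrite !mul1r; exact: ncD.
Qed.

Lemma c0funMl (a f : T -> C) (M : R) : continuous a -> (forall t, nc (a t) <= M) ->
  c0fun f -> c0fun (fun t => a t * f t).
Proof.
move=> ca aM cf; pose M' := Num.max 0 M.
have M0 : 0 <= M' by rewrite le_max lexx.
apply: (c0fun_le _ cf cf M0) => t.
  by apply: continuousM; [exact: ca|exact: cf.1].
rewrite ncM; apply: le_trans (_ : M' * nc (f t) <= _).
  by apply: ler_wpM2r; [exact: nc_ge0|rewrite le_max aM orbT].
by rewrite lerDl mulr_ge0 ?nc_ge0.
Qed.

Lemma c0funM (f g : T -> C) : c0fun f -> c0fun g -> c0fun (fun t => f t * g t).
Proof. by move=> cf /[dup] cg /c0funMl; have [M _ H] := c0fun_bounded cf; apply; [exact: cf.1|exact: H]. Qed.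

Lemma c0funZ (a : C) (f : T -> C) : c0fun f -> c0fun (fun t => a * f t).
Proof. by apply: (@c0funMl _ _ (nc a)) => // t; exact: cst_continuous. Qed.

Lemma c0fun0 : c0fun (fun _ : T => 0 : C).
Proof. by apply: c0fun_supp (@compact0 T) _ => // t; exact: cst_continuous. Qed.

Lemma c0fun_conj (f : T -> C) : c0fun f -> c0fun (fun t => (f t)^*).
Proof.
move=> cf; apply: (c0fun_le _ cf cf ler01) => t.
  by apply: cont_at_conj; exact: cf.1.
by rewrite nc_conj mul1r lerDl nc_ge0.
Qed.

Lemma c0fun_lim (f : T -> C) :
  (forall e : R, 0 < e -> exists2 g, c0fun g & forall t, nc (f t - g t) <= e) ->
  c0fun f.
Proof.
move=> H; split.
  move=> t0; apply/cont_atC => e e0.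
  have [|g cg fg] := H (e / 4); first by rewrite divr_gt0.
  have /cont_atC/(_ (e / 4)) := cg.1 t0; rewrite divr_gt0// => /(_ isT).
  apply: filterS => t gt.
  have -> : f t0 - f t = (f t0 - g t0) + ((g t0 - g t) - (f t - g t)) by ring.
  apply: le_lt_trans (ncD _ _) _; have := ncD (g t0 - g t) (- (f t - g t)).
  rewrite ncN; have := fg t0; have := fg t; lra.
apply/vanishP => e e0.
have [|g [_ /vanishP vg] fg] := H (e / 4); first by rewrite divr_gt0.
have [|K cK hK] := vg (e / 4); first by rewrite divr_gt0.
exists K => // x /hK gx.
have -> : f x = (f x - g x) + g x by ring.
by apply: le_lt_trans (ncD _ _) _; have := fg x; lra.
Qed.

End Bumps.

Lemma C0_separates (R : realType) (Y : topologicalType) (y y' : Y) :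
  locally_compact [set: Y] -> hausdorff_space Y -> y <> y' ->
  exists g : C0 R Y, g y = 1 /\ g y' = 0.
Proof.
move=> lc T2 ne.
have : nbhs y (~` [set y']).
  apply: open_nbhs_nbhs; split; last exact: ne.
  by apply: closed_openC; exact/accessible_closed_set1/hausdorff_accessible.
move=> /(@c0fun_bump R Y lc T2 y)[b [K [cb [_ KU] _ b1 bK]]].
exists (mkC0 cb) => /=; split; first by rewrite (nbhs_singleton b1).
by rewrite bK// => /KU; apply.
Qed.

(** * Continuous sections of Hermitian line bundles *)

Section LocalFrame.
Variables (R : realType) (B : topologicalType) (L : hline_bundle R B).
Notation C := (cplx R).
Notation h := (lb_met (h := L)).

Definition sec_cont_at (u : sections L) (z : B) : Prop :=
  cont_at (fun b => tpt (u b)) z.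

Definition lnrm (b : B) (v : L b) : R := hn (@lb_met R B L b) v.

Lemma lnrm_sqr b (v : L b) : rC (lnrm v ^+ 2) = h v v.
Proof. by apply: hn_sqr => u; exact: met_ge0. Qed.

Lemma lnrm_eq0 b (v : L b) : lnrm v = 0 -> v = 0.
Proof.
move=> l0; apply/eqP/negP => /negP v0; have [_ _ hp _] := lb_herm L.
by have := hp b v v0; rewrite -lnrm_sqr l0 expr0n ltxx.
Qed.

(** Dividing the trivializing section psi(1) by its length makes the coordinate of a section equal
    to its inner product with the frame. Continuity of sections thereby becomes continuity of scalar
    functions. *)
Lemma local_frame (z0 : B) : exists N : set B, exists e : sections L,
  [/\ open N, N z0, forall z, N z -> h (e z) (e z) = 1,
      forall z (v : L z), N z -> v = h (e z) v *: e z &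
      forall (u : sections L) z, N z ->
        sec_cont_at u z <-> cont_at (fun b => h (e b) (u b)) z].
Proof.
have [cbase triv] := lb_line L.
have [U [psi [psi' [[oU Uz0] plin pK cpsi cpsi']]]] := triv z0.
have oV : open (@tbase R B L @^-1` U) by apply: open_comp.
have oUT := open_setXT oU.
rewrite continuous_open_subspace// in cpsi'.
rewrite continuous_open_subspace// in cpsi.
have coord (w : sections L) z : U z -> sec_cont_at w z ->
    cont_at (fun b => psi' b (w b)) z.
  move=> Uz cw.
  apply: (@continuous_comp _ _ _ (fun b => tpt (w b))
    (fun t : tot L => psi' _ (tvec t))); first exact: cw.
  by apply: cpsi'; rewrite inE.
have psicont (g : B -> C) z : U z -> cont_at g z ->
    sec_cont_at (fun b => psi b (g b)) z.
  move=> Uz cg.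
  apply: (@continuous_comp _ _ _ (fun b => (b, g b))
    (fun p : B * C => tpt (psi p.1 p.2))).
    by apply: (cvg_pair (G := nbhs z) (H := nbhs (g z))).
  by apply: cpsi; rewrite inE.
pose n b := h (psi b 1) (psi b 1).
have psi0 b : U b -> psi b 0 = 0.
  move=> Ub; have := plin b 1 0 0 Ub.
  by rewrite mul1r add0r scale1r -[LHS]addr0 => /addrI.
have psiZ b a : U b -> psi b a = a *: psi b 1.
  by move=> Ub; have := plin b a 1 0 Ub; rewrite mulr1 addr0 psi0// addr0.
have psi1n0 b : U b -> psi b 1 != 0.
  move=> Ub; apply/eqP => p0; have /eqP := (pK b Ub).1 1; rewrite p0 -(psi0 b Ub).
  by rewrite (pK b Ub).1 eq_sym oner_eq0.
have n0 b : U b -> 0 < n b.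
  by move=> Ub; have [_ _ hp _] := lb_herm L; apply: hp; exact: psi1n0.
have nr b : U b -> n b = rC (re (n b)) by move=> Ub; rewrite ge0_re ?ltW ?n0.
have rn0 b : U b -> 0 < re (n b).
  by move=> Ub; rewrite -ltr_rC -nr// n0.
pose q b := Num.sqrt (re (n b)).
have q0 b : U b -> 0 < q b by move=> Ub; rewrite sqrtr_gt0 rn0.
have qq b : U b -> rC (q b) * rC (q b) = n b.
  by move=> Ub; rewrite -rCM -expr2 sqr_sqrtr ?ltW ?rn0// -nr.
have qC0 b : U b -> rC (q b) != 0.
  by move=> Ub; rewrite -rC0 (inj_eq (@rC_inj R)) gt_eqF ?q0.
pose e : sections L := fun b => (rC (q b))^-1 *: psi b 1.
have hZr b (v w : L b) a : h v (a *: w) = a * h v w.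
  by apply: (h_Zr (h := @lb_met R B L b)) => *; exact: met_linr.
have hZl b (v w : L b) a : h (a *: w) v = a^* * h w v.
  by apply: (h_Zl (h := @lb_met R B L b)) => *; [exact: met_linr|exact: metC].
have qcr b : ((rC (q b))^-1)^* = (rC (q b))^-1 by rewrite fmorphV/= rC_conj.
have hev b (v : L b) : U b -> h (e b) v = psi' b v * rC (q b).
  move=> Ub; rewrite -[in LHS]((pK b Ub).2 v) psiZ// hZr /e hZl qcr -/(n b) -qq//.
  by congr (_ * _); rewrite mulKf// qC0.
have cn z : U z -> cont_at n z.
  move=> Uz; have [_ _ _ cm] := lb_herm L.
  apply: (@continuous_comp _ _ _ (fun b => tpt (psi b 1)) (fun t : tot L => h (tvec t) (tvec t))).
    by apply: (@psicont (fun=> 1)) => //; exact: cst_continuous.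
  exact: cm.
have cq z : U z -> cont_at (fun b => rC (q b)) z.
  move=> Uz; apply: cont_at_rC.
  apply: (@continuous_comp _ _ _ (fun b => re (n b)) (@Num.sqrt R)).
    exact: cont_at_re (cn z Uz).
  exact: sqrt_continuous.
exists U, e; split => //.
- move=> z Uz; rewrite hev// /e -[psi' _ _]mulr1 -[_ *: _]psiZ// (pK z Uz).1.
  by rewrite mulr1 mulVf// qC0.
- move=> z v Uz; rewrite hev// /e scalerA -mulrA mulfV ?qC0// mulr1 -psiZ//.
  by rewrite (pK z Uz).2.
- move=> u z Uz; split=> cu.
    apply: (cont_at_near (f := fun b => psi' b (u b) * rC (q b))).
      by near=> b; rewrite hev//; near: b; exact: open_nbhs_nbhs.
    by apply: cont_atM; [exact: coord|exact: cq].
  have cg : cont_at (fun b => h (e b) (u b) * (rC (q b))^-1) z.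
    exact: (cont_atM cu (cont_atV (cq _ Uz) (qC0 _ Uz))).
  have := psicont _ _ Uz cg.
  have E b : U b -> psi b (h (e b) (u b) * (rC (q b))^-1) = u b.
    by move=> Ub; rewrite hev// mulfK ?qC0// (pK b Ub).2.
  apply: cont_at_near.
  by near=> b; rewrite E//; near: b; exact: open_nbhs_nbhs.
Unshelve. all: by end_near. Qed.

End LocalFrame.

Lemma near_all (T : topologicalType) (I : eqType) (l : seq I) (P : I -> T -> Prop) (x : T) :
  (forall i, i \in l -> \forall y \near x, P i y) ->
  \forall y \near x, forall i, i \in l -> P i y.
Proof.
elim: l => [|i l IH] H; first by near=> y.
have H1 : \forall y \near x, P i y by apply: H; rewrite inE eqxx.
have H2 : \forall y \near x, forall j, j \in l -> P j y.
  by apply: IH => j jl; apply: H; rewrite inE jl orbT.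
near=> y => j; rewrite inE => /orP[/eqP->|].
  by near: y.
by move: j; near: y.
Unshelve. all: by end_near. Qed.

Lemma cont_at_sum (R : realType) (T : topologicalType) (I : eqType) (l : seq I)
    (f : I -> T -> cplx R) (x : T) :
  (forall i, i \in l -> cont_at (f i) x) ->
  cont_at (fun y => \sum_(i <- l) f i y) x.
Proof.
elim: l => [|i l IH] H.
  apply: (cont_at_near (f := fun=> 0)); first by near=> y; rewrite big_nil.
  exact: cont_at_cst.
apply: (cont_at_near (f := fun y => f i y + \sum_(j <- l) f j y)).
  by near=> y; rewrite big_cons.
apply: cont_atD; first by apply: H; rewrite inE eqxx.
by apply: IH => j jl; apply: H; rewrite inE jl orbT.
Unshelve. all: by end_near. Qed.

Section FiniteSets.
Import finmap.

Lemma enum_fset_setP (T : choiceType) (A : set T) (t : T) : finite_set A ->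
  t \in enum_fset (fset_set A) <-> A t.
Proof.
move=> fA; have -> : (t \in enum_fset (fset_set A)) = (t \in fset_set A) by [].
by rewrite in_fset_set// in_setE.
Qed.

End FiniteSets.

Section SectionContinuity.
Variables (R : realType) (B : topologicalType) (L : hline_bundle R B).
Notation C := (cplx R).
Notation h := (lb_met (h := L)).
Implicit Types u v : sections L.

Lemma hZr b (v w : L b) a : h v (a *: w) = a * h v w.
Proof. by apply: (h_Zr (h := @lb_met R B L b)) => *; exact: met_linr. Qed.
Lemma hZl b (v w : L b) a : h (a *: w) v = a^* * h w v.
Proof. by apply: (h_Zl (h := @lb_met R B L b)) => *; [exact: met_linr|exact: metC]. Qed.
Lemma hDr b (u v w : L b) : h u (v + w) = h u v + h u w.
Proof. by apply: (h_Dr (h := @lb_met R B L b)) => *; exact: met_linr. Qed.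
Lemma hl0 b (v : L b) : h 0 v = 0.
Proof. by apply: (h_l0 (h := @lb_met R B L b)) => *; [exact: met_linr|exact: metC]. Qed.

Lemma lnrmZ b (v : L b) a : lnrm (a *: v) = nc a * lnrm v.
Proof. by apply: hnZ => *; [exact: met_linr|exact: metC|exact: met_ge0]. Qed.
Lemma lnrmD b (v w : L b) : lnrm (v + w) <= lnrm v + lnrm w.
Proof. by apply: hnD => *; [exact: met_linr|exact: metC|exact: met_ge0]. Qed.
Lemma lnrm0 b : lnrm (0 : L b) = 0.
Proof. by apply: hn0 => *; exact: met_linr. Qed.
Lemma lnrm_ge0 b (v : L b) : 0 <= lnrm v. Proof. exact: hn_ge0. Qed.
Lemma lnrm_cs b (v w : L b) : nc (h v w) <= lnrm v * lnrm w.
Proof. by apply: cauchy_schwarz => *; [exact: met_linr|exact: metC|exact: met_ge0]. Qed.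
Lemma lnrm_unit b (v : L b) : h v v = 1 -> lnrm v = 1.
Proof. by move=> h1; rewrite /lnrm /hn h1 sqrtr1. Qed.

Lemma ip_cont_at u v z : sec_cont_at u z -> sec_cont_at v z ->
  cont_at (fun z => h (u z) (v z)) z.
Proof.
move=> cu cv; have [N [e [oN Nz e1 eE eC]]] := local_frame L z.
apply: (cont_at_near (f := fun b => (h (e b) (u b))^* * h (e b) (v b))).
  near=> b; rewrite [in RHS](eE b (u b)); first by rewrite hZl.
  by near: b; exact: open_nbhs_nbhs.
by apply: cont_atM; [apply: cont_at_conj|]; apply/eC.
Unshelve. all: by end_near. Qed.

Lemma lnrm_cont_at u z : sec_cont_at u z -> cont_at (fun z => lnrm (u z)) z.
Proof.
move=> cu; apply: (@cont_at_comp _ _ _ (fun b => re (h (u b) (u b))) (@Num.sqrt R)).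
  by apply: cont_at_re; exact: ip_cont_at.
exact: sqrt_continuous.
Qed.

Lemma sec_cont_at_lin (a : B -> C) u v z :
  cont_at a z -> sec_cont_at u z -> sec_cont_at v z ->
  sec_cont_at (fun b => a b *: u b + v b) z.
Proof.
move=> ca cu cv; have [N [e [oN Nz e1 eE eC]]] := local_frame L z.
apply/(eC _ z Nz); apply: (cont_at_near (f := fun b => a b * h (e b) (u b) + h (e b) (v b))).
  by near=> b; rewrite hDr hZr.
exact: (cont_atD (cont_atM ca ((eC u z Nz).1 cu)) ((eC v z Nz).1 cv)).
Unshelve. all: by end_near. Qed.

Lemma sec_cont_at_near u v z : (\forall b \near z, u b = v b) ->
  sec_cont_at u z -> sec_cont_at v z.
Proof.
move=> uv; apply: cont_at_near.
by apply: filterS uv => b ->.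
Qed.

Lemma sec_cont_at0 z : sec_cont_at (0 : sections L) z.
Proof. exact: continuous_section0. Qed.

Lemma sec_cont_atZ (a : B -> C) u z :
  cont_at a z -> sec_cont_at u z -> sec_cont_at (fun b => a b *: u b) z.
Proof.
move=> ca cu; apply: (sec_cont_at_near (u := fun b => a b *: u b + (0 : sections L) b)).
  by near=> b; rewrite addr0.
by apply: sec_cont_at_lin => //; exact: sec_cont_at0.
Unshelve. all: by end_near. Qed.

(** The usual three-term estimate, applied to coordinates in a unit frame. Each approximant may be
    close to [u] on its own neighbourhood only, which suits locally uniform limits and tubes. *)
Lemma sec_cont_lim u z :
  (forall e : R, 0 < e -> exists2 v : sections L, sec_cont_at v z &
     \forall b \near z, lnrm (u b - v b) <= e) -> sec_cont_at u z.
Proof.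
move=> H; have [N [f [oN Nz f1 fE fC]]] := local_frame L z.
apply/fC => //; apply/cont_atC => e e0.
have [|v cv uv] := H (e / 4); first by rewrite divr_gt0.
have /cont_atC/(_ (e / 4)) := (fC v z Nz).1 cv; rewrite divr_gt0// => /(_ isT) vv.
have key b : N b -> lnrm (u b - v b) <= e / 4 -> nc (h (f b) (u b) - h (f b) (v b)) <= e / 4.
  move=> Nb ub; have -> : h (f b) (u b) - h (f b) (v b) = h (f b) (u b - v b).
    by rewrite hDr -scaleN1r hZr mulN1r.
  by apply: le_trans (lnrm_cs _ _) _; rewrite lnrm_unit ?f1// mul1r.
have uz := nbhs_singleton uv.
near=> b; have Nb : N b by near: b; exact: open_nbhs_nbhs.
have k1 := key z Nz uz; have k2 : nc (h (f b) (u b) - h (f b) (v b)) <= e / 4.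
  by apply: key => //; near: b.
have k3 : nc (h (f z) (v z) - h (f b) (v b)) < e / 4 by near: b.
have -> : h (f z) (u z) - h (f b) (u b) = (h (f z) (u z) - h (f z) (v z)) +
   ((h (f z) (v z) - h (f b) (v b)) - (h (f b) (u b) - h (f b) (v b))) by ring.
apply: le_lt_trans (ncD _ _) _.
have := ncD (h (f z) (v z) - h (f b) (v b)) (- (h (f b) (u b) - h (f b) (v b))).
by rewrite ncN; lra.
Unshelve. all: by end_near. Qed.

End SectionContinuity.

(** * The covering s and the inner product over its fibers *)

Section Cover.
Variables (R : realType) (X Y : topologicalType) (c : tcorr R Y X).
Hypotheses (lcX : locally_compact [set: X]) (T2X : hausdorff_space X).
Hypothesis s_surj : range (@tc_s R Y X c) = [set: X].
Notation C := (cplx R).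
Notation Z := (tc_Z c).
Notation L := (tc_L c).
Notation s := (@tc_s R Y X c).
Notation h := (lb_met (h := L)).
Implicit Types (u v : sections L) (x : X) (z : Z).

Definition fib x : seq Z := finmap.enum_fset (fset_set (s @^-1` [set x])).

Lemma fib_uniq x : uniq (fib x). Proof. exact: finmap.fset_uniq. Qed.
Lemma mem_fib x z : (z \in fib x) <-> s z = x.
Proof.
by rewrite /fib enum_fset_setP//; exact: tc_s_fiber_finite.
Qed.

Lemma fib_self z : z \in fib (s z). Proof. exact/mem_fib. Qed.

Lemma fiber_ipE u v x : fiber_ip u v x = \sum_(z <- fib x) h (u z) (v z).
Proof. by rewrite /fiber_ip fsbig_finite//; exact: tc_s_fiber_finite. Qed.

Lemma s_cont : continuous s. Proof. by have [] := tc_s_lhomeo c. Qed.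

Lemma s_proper (K : set X) : compact K -> compact (s @^-1` K).
Proof. by move=> cK; apply: tc_s_proper => //; rewrite s_surj. Qed.

Lemma inj_nbhd z : exists2 W, open_nbhs z W & forall a b, W a -> W b -> s a = s b -> a = b.
Proof.
have [_ /(_ z) [W [oW Wz inj _]]] := tc_s_lhomeo c; exists W => // a b Wa Wb sab.
by apply: inj; rewrite ?inE.
Qed.

Lemma s_open z (U : set Z) : nbhs z U -> nbhs (s z) (s @` U).
Proof.
have [_ /(_ z) [W [oW Wz inj opW]]] := tc_s_lhomeo c => Uz.
have : nbhs z (U `&` W) by apply: filterI => //; exact: open_nbhs_nbhs.
rewrite nbhsE => -[V [oV Vz] VUW]; rewrite nbhsE; exists (s @` V).
  by split; [apply: opW => // t /VUW []|exists z].
by move=> _ [t /VUW [Ut _] <-]; exists t.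
Qed.

Lemma fib_surj x : exists z, s z = x.
Proof. by have : [set: X] x by []; rewrite -s_surj => -[z _ <-]; exists z. Qed.

(* Local triviality of the covering s near x0: sg z is the local section through
   z, and lab a is the point over x0 on the sheet of a. *)
Lemma local_sheets x0 : exists V : set X, exists sg : Z -> X -> Z, exists lab : Z -> Z,
  [/\ open V /\ V x0,
      forall z, z \in fib x0 -> sg z x0 = z /\
        forall x, V x -> [/\ s (sg z x) = x, cont_at (sg z) x & lab (sg z x) = z],
      forall a, V (s a) -> lab a \in fib x0 /\ sg (lab a) (s a) = a &
      forall a, V (s a) -> \forall a' \near a, lab a' = lab a].
Proof.
have [W HW] := choice (tc_s_lhomeo c).2.
(* The default [z] is never seen: [sg z] is used only over the image of [W z], where the point is
   unique. *)
pose sg z x := xget z [set a | W z a /\ s a = x].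
have oW z : open (W z) by have [] := HW z.
have Wz z : W z z by have [] := HW z.
have injW z a b : W z a -> W z b -> s a = s b -> a = b.
  by move=> Wa Wb sab; have [_ _ inj _] := HW z; apply: inj; rewrite ?inE.
have osW z : open (s @` W z) by have [_ _ _] := HW z; apply.
have sgP z x : (s @` W z) x -> W z (sg z x) /\ s (sg z x) = x.
  by move=> [a Wa sa]; rewrite /sg; case: xgetP => [b -> //|/(_ a)]; case.
have sgu z a : W z a -> sg z (s a) = a.
  move=> Wa; have [|w1 w2] := sgP z (s a); first by exists a.
  exact: (injW z).
have sgc z x : (s @` W z) x -> cont_at (sg z) x.
  move=> Wx O Ox; have [w1 w2] := sgP z x Wx.
  have OW : nbhs (sg z x) (O `&` W z) by apply: filterI => //; exact: open_nbhs_nbhs.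
  have := s_open OW; rewrite w2; apply: filterS => _ [a [Oa Wa] <-].
  by rewrite /= sgu.
pose P x := [/\ forall z, z \in fib x0 -> (s @` W z) x,
  forall a, s a = x -> exists2 z, z \in fib x0 & W z a &
  forall z, z \in fib x0 -> forall w, w \in fib x0 -> sg z x = sg w x -> z = w].
have nP : \forall x \near x0, P x.
  have sW z : z \in fib x0 -> (s @` W z) x0 by move/mem_fib => <-; exists z.
  have n1 : \forall x \near x0, forall z, z \in fib x0 -> (s @` W z) x.
    by apply: near_all => z zx; apply: open_nbhs_nbhs; split => //; exact: sW.
  (* Properness of [s]: the points over a compact neighbourhood that lie on none of the sheets form
     a compact set, so its image is closed, and it misses [x0]. *)
  have n2 : \forall x \near x0, forall a, s a = x -> exists2 z, z \in fib x0 & W z a.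
    have [K cK Kx] := compact_nbhs lcX x0.
    pose U := \bigcup_(z in [set z | z \in fib x0]) W z.
    have oU : open U by apply: bigcup_open => z _; exact: oW.
    pose D := s @^-1` K `&` ~` U.
    have cD : compact D.
      apply: (subclosed_compact _ (s_proper cK)); last by move=> t [].
      apply: closedI; last exact: open_closedC.
      apply: closed_comp; first by move=> ? _; exact: s_cont.
      exact: compact_closed.
    have clD : closed (s @` D).
      apply: compact_closed => //; apply: continuous_compact => //.
      exact/continuous_subspaceT/s_cont.
    have nD : nbhs x0 (~` (s @` D)).
      apply: open_nbhs_nbhs; split; first exact: closed_openC.
      move=> [a [_ nU] sa]; apply: nU; exists a => //=; exact/mem_fib.
    near=> x => a sa; have Kx' : K x by near: x.
    have nx : (~` (s @` D)) x by near: x.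
    have [[z zf Wza]|nU] := pselect (U a); first by exists z.
    by exfalso; apply: nx; exists a => //; split => //=; rewrite sa.
  (* Distinct sheets stay apart near [x0] because [Z] is Hausdorff and the local sections are
     continuous. *)
  have n3 : \forall x \near x0, forall z, z \in fib x0 -> forall w, w \in fib x0 ->
      sg z x = sg w x -> z = w.
    apply: near_all => z zx; apply: near_all => w wx.
    have [->|zw] := eqVneq z w; first by near=> x.
    have := tc_T2 (t := c); rewrite open_hausdorff => /(_ _ _ zw)[[A B] /=].
    rewrite !inE => -[Az Bw] [oA oB AB].
    have sz0 : sg z x0 = z by have := zx => /mem_fib <-; exact: sgu.
    have sw0 : sg w x0 = w by have := wx => /mem_fib <-; exact: sgu.
    have nA : \forall x \near x0, A (sg z x).
      by apply: cont_at_nbhs; [exact/sgc/sW|rewrite sz0; exact: open_nbhs_nbhs].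
    have nB : \forall x \near x0, B (sg w x).
      by apply: cont_at_nbhs; [exact/sgc/sW|rewrite sw0; exact: open_nbhs_nbhs].
    near=> x => E; exfalso; have : (A `&` B) (sg z x).
      by split; [near: x|rewrite E; near: x].
    by rewrite AB.
  by near=> x; split; near: x.
have : nbhs x0 P by exact: nP.
rewrite nbhsE => -[V [oV Vx0] VP].
pose lab a := xget a [set z | z \in fib x0 /\ sg z (s a) = a].
have labP a : V (s a) -> lab a \in fib x0 /\ sg (lab a) (s a) = a.
  move=> Va; have [_ /(_ a erefl)[z zf Wa] _] := VP _ Va.
  by rewrite /lab; case: xgetP => [b -> //|/(_ z)]; case; split => //; exact: sgu.
have labu z x : z \in fib x0 -> V x -> lab (sg z x) = z.
  move=> zf Vx; have [P1 _ inj] := VP _ Vx.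
  have [w1 w2] := sgP z x (P1 z zf).
  have [|l1 l2] := labP (sg z x); first by rewrite w2.
  by move: l2; rewrite w2 => E; exact: inj E.
exists V, sg, lab; split => //.
  move=> z zf; split; first by have /mem_fib <- := zf; exact: sgu.
  move=> x Vx; have [P1 _ _] := VP _ Vx; have [w1 w2] := sgP z x (P1 z zf).
  by split => //; [exact/sgc/P1|exact: labu].
move=> a Va; have [lf la] := labP a Va.
have Wa : W (lab a) a.
  by have [P1 _ _] := VP _ Va; have [] := sgP _ _ (P1 _ lf); rewrite la.
have nW : nbhs a (W (lab a)) by apply: open_nbhs_nbhs.
have nV : nbhs a (s @^-1` V).
  by apply: open_nbhs_nbhs; split => //; apply: open_comp => // ? _; exact: s_cont.
by near=> a'; rewrite -{1}(sgu (lab a) a') ?labu//; near: a'.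
Unshelve. all: by end_near. Qed.

Lemma fiber_ip_sheets x0 (V : set X) (sg : Z -> X -> Z) (lab : Z -> Z) :
  (forall z, z \in fib x0 -> sg z x0 = z /\
    forall x, V x -> [/\ s (sg z x) = x, cont_at (sg z) x & lab (sg z x) = z]) ->
  (forall a, V (s a) -> lab a \in fib x0 /\ sg (lab a) (s a) = a) ->
  forall x, V x -> perm_eq (fib x) [seq sg z x | z <- fib x0].
Proof.
move=> H1 H2 x Vx; apply: uniq_perm; first exact: fib_uniq.
  rewrite map_inj_in_uniq ?fib_uniq// => z w zf wf E.
  by have [_ /(_ x Vx)[_ _ <-]] := H1 z zf; have [_ /(_ x Vx)[_ _ <-]] := H1 w wf; rewrite E.
move=> a; apply/idP/mapP => [/mem_fib sa|[z zf ->]].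
  by exists (lab a); have [|l1 l2] := H2 a; rewrite ?sa// -{1}l2 sa.
by apply/mem_fib; have [_ /(_ x Vx)[]] := H1 z zf.
Qed.

Lemma fiber_ip_cont_at u v x : (forall z, s z = x -> sec_cont_at u z /\ sec_cont_at v z) ->
  cont_at (fiber_ip u v) x.
Proof.
move=> cuv; have [V [sg [lab [[oV Vx] H1 H2 _]]]] := local_sheets x.
apply: (cont_at_near (f := fun y => \sum_(z <- fib x) h (u (sg z y)) (v (sg z y)))).
  near=> y; have Vy : V y by near: y; exact: open_nbhs_nbhs.
  by rewrite fiber_ipE [RHS](perm_big _ (fiber_ip_sheets H1 H2 Vy)) big_map.
apply: cont_at_sum => z zf; have [z0 /(_ x Vx)[_ cs _]] := H1 z zf.
apply: (@cont_at_comp _ _ _ (sg z) (fun a => h (u a) (v a))) => //.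
rewrite z0; have [] := cuv z; first exact/mem_fib.
exact: ip_cont_at.
Unshelve. all: by end_near. Qed.

Lemma tc_Z_lc : locally_compact [set: Z]. Proof. exact: tc_lc. Qed.
Lemma tc_Z_T2 : hausdorff_space Z. Proof. exact: tc_T2. Qed.

(** On elements of E this is [fnorm] by conversion; it is defined for all sections because bundle
    maps act on sections that need not belong to E. *)
Definition nx u x : R := hn (fun u v => fiber_ip u v x) u.

Lemma fip_linr x u a v w : fiber_ip u (a *: v + w) x = a * fiber_ip u v x + fiber_ip u w x.
Proof.
rewrite !fiber_ipE mulr_sumr -big_split/=; apply: eq_bigr => z _.
exact: met_linr.
Qed.
Lemma fip_conj x u v : fiber_ip v u x = (fiber_ip u v x)^*.
Proof. by rewrite !fiber_ipE rmorph_sum/=; apply: eq_bigr => z _; exact: metC. Qed.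
Lemma fip_ge0 x u : 0 <= fiber_ip u u x. Proof. exact: fiber_ip_ge0. Qed.

Lemma nx_sqr u x : rC (nx u x ^+ 2) = fiber_ip u u x.
Proof. by apply: hn_sqr => v; exact: fip_ge0. Qed.
Lemma nx_ge0 u x : 0 <= nx u x. Proof. exact: hn_ge0. Qed.
Lemma nxD u v x : nx (u + v) x <= nx u x + nx v x.
Proof. by apply: hnD => *; [exact: fip_linr|exact: fip_conj|exact: fip_ge0]. Qed.
Lemma nxZ (a : C) u x : nx (a *: u) x = nc a * nx u x.
Proof. by apply: hnZ => *; [exact: fip_linr|exact: fip_conj|exact: fip_ge0]. Qed.
Lemma nxN u x : nx (- u) x = nx u x.
Proof. by apply: hnN => *; [exact: fip_linr|exact: fip_conj|exact: fip_ge0]. Qed.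
Lemma nx_cs u v x : nc (fiber_ip u v x) <= nx u x * nx v x.
Proof. by apply: (cauchy_schwarz (h := fun u v => fiber_ip u v x)) => *; [exact: fip_linr|exact: fip_conj|exact: fip_ge0]. Qed.

Lemma nx_sum u x : nx u x ^+ 2 = \sum_(z <- fib x) lnrm (u z) ^+ 2.
Proof.
apply: rC_inj; rewrite nx_sqr fiber_ipE /rC raddf_sum/=; apply: eq_bigr => z _.
by rewrite -lnrm_sqr.
Qed.

Lemma nx_eq u v x : (forall z, s z = x -> u z = v z) -> nx u x = nx v x.
Proof.
move=> uv; apply/eqP; rewrite -(@eqrXn2 _ 2)// ?nx_ge0// !nx_sum.
by apply/eqP; apply: eq_big_seq => z /mem_fib/uv ->.
Qed.

Lemma fip_eq u u' v v' x : (forall z, s z = x -> u z = u' z) ->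
  (forall z, s z = x -> v z = v' z) -> fiber_ip u v x = fiber_ip u' v' x.
Proof.
move=> uu' vv'; rewrite !fiber_ipE; apply: eq_big_seq => z /mem_fib zx.
by rewrite uu'// vv'.
Qed.

Lemma lnrm_le_nx u z : lnrm (u z) <= nx u (s z).
Proof.
rewrite -(@ler_pXn2r _ 2)// ?nnegrE ?lnrm_ge0 ?nx_ge0// nx_sum (big_rem z)/=; last exact: fib_self.
by rewrite lerDl sumr_ge0// => w _; rewrite exprn_ge0 ?lnrm_ge0.
Qed.

Lemma nx_eq0 u x : nx u x = 0 <-> forall z, s z = x -> u z = 0.
Proof.
split=> [n0 z zx|u0].
  apply: lnrm_eq0; apply/eqP; rewrite eq_le lnrm_ge0 andbT -n0 -zx.
  exact: lnrm_le_nx.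
have : nx u x ^+ 2 == 0.
  by rewrite nx_sum big_seq big1// => z /mem_fib/u0 ->; rewrite lnrm0 expr0n.
by rewrite expf_eq0/= => /eqP.
Qed.

Lemma nx_le_single u x (M : R) : 0 <= M -> (forall z, s z = x -> lnrm (u z) <= M) ->
  (forall a b, s a = x -> s b = x -> u a <> 0 -> u b <> 0 -> a = b) -> nx u x <= M.
Proof.
move=> M0 uM u1; have [[z [zx uz]]|nz] := pselect (exists z, s z = x /\ u z <> 0).
  rewrite -(@ler_pXn2r _ 2)// ?nnegrE ?nx_ge0// nx_sum (big_rem z)/=; last exact/mem_fib.
  rewrite big_seq big1 ?addr0 => [|w].
    by rewrite ler_pXn2r ?nnegrE ?lnrm_ge0// uM.
  rewrite mem_rem_uniq ?fib_uniq// inE => /andP[/eqP wz /mem_fib wx].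
  have [->|uw] := pselect (u w = 0); first by rewrite lnrm0 expr0n.
  by exfalso; apply: wz; exact: u1.
rewrite (_ : nx u x = 0)//; apply/nx_eq0 => z zx.
by apply: contrapT => uz; apply: nz; exists z.
Qed.

Lemma fip_single u v x z : s z = x ->
  (forall w, s w = x -> w <> z -> u w = 0 \/ v w = 0) ->
  fiber_ip u v x = h (u z) (v z).
Proof.
move=> zx uw; rewrite fiber_ipE (big_rem z)/=; last exact/mem_fib.
rewrite big_seq big1 ?addr0// => w.
rewrite mem_rem_uniq ?fib_uniq// inE => /andP[/eqP wz /mem_fib wx].
have [->|->] := uw w wx wz; first exact: hl0.
exact: met_r0.
Qed.

Definition sec_cont u := forall z, sec_cont_at u z.

Lemma nx_cont_at u x : sec_cont u -> cont_at (nx u) x.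
Proof.
move=> cu; apply: (@cont_at_comp _ _ _ (fun x => re (fiber_ip u u x)) (@Num.sqrt R)).
  by apply: cont_at_re; apply: fiber_ip_cont_at => z _; split; exact: cu.
exact: sqrt_continuous.
Qed.

Lemma Gamma0_supp u (K : set Z) : sec_cont u -> compact K ->
  (forall z, ~ K z -> u z = 0) -> Gamma0_set u.
Proof.
move=> cu cK uK; split; first by move=> z; exact: cu.
  by move=> e e0; exists K => // z /uK ->; rewrite met_r0 normr0.
move=> e e0; exists (s @` K).
  by apply: continuous_compact => //; exact/continuous_subspaceT/s_cont.
move=> x nx; rewrite (_ : fiber_ip u u x = 0) ?normr0//.
rewrite fiber_ipE big_seq big1// => z /mem_fib zx.
by rewrite uK ?met_r0// => Kz; apply: nx; exists z.
Qed.

Definition G0_mk u (gu : Gamma0_set u) : Gamma0 c :=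
  MkGamma0 (G0_sec := u) (asboolT gu).

Lemma G0_cont (p : Gamma0 c) : sec_cont (G0_sec p).
Proof. by have [cp _ _] := G0_Gamma0 p => z; exact: cp. Qed.

Lemma secD (p q : Gamma0 c) z : G0_sec (p + q) z = G0_sec p z + G0_sec q z.
Proof. by []. Qed.
Lemma secB (p q : Gamma0 c) z : G0_sec (p - q) z = G0_sec p z - G0_sec q z.
Proof. by []. Qed.
Lemma secZ a (p : Gamma0 c) z : G0_sec (a *: p) z = a *: G0_sec p z.
Proof. by []. Qed.
Lemma sec0 z : G0_sec (0 : Gamma0 c) z = 0.
Proof. by []. Qed.

Lemma G0_inj (p q : Gamma0 c) : (forall z, G0_sec p z = G0_sec q z) -> p = q.
Proof. by move=> pq; apply: val_inj => /=; apply: functional_extensionality_dep. Qed.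

Lemma bump_section (z0 : Z) (W : set Z) : nbhs z0 W -> exists p : Gamma0 c,
  [/\ \forall z \near z0, h (G0_sec p z) (G0_sec p z) = 1 /\
         forall v : L z, v = h (G0_sec p z) v *: G0_sec p z,
      forall z, lnrm (G0_sec p z) <= 1 & forall z, ~ W z -> G0_sec p z = 0].
Proof.
move=> Wz0; have [N [e [oN Nz0 e1 eE eC]]] := local_frame L z0.
have nW : nbhs z0 (W `&` N) by apply: filterI => //; exact: open_nbhs_nbhs.
have [b [K [cb b01 b1 [cK KW] bK]]] := urysohn_bump R tc_Z_lc tc_Z_T2 nW.
pose u : sections L := fun z => rC (b z) *: e z.
have ce z : N z -> sec_cont_at e z.
  move=> Nz; apply/(eC _ _ Nz); apply: (cont_at_near (f := fun=> 1 : C)); last exact: cont_at_cst.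
  by near=> a; rewrite e1//; near: a; exact: open_nbhs_nbhs.
have cu : sec_cont u.
  move=> z; have [Kz|nKz] := pselect (K z).
    apply: sec_cont_atZ; first by apply: cont_at_rC; exact: cb.
    by apply: ce; have [] := KW z Kz.
  apply: (sec_cont_at_near (u := 0)); last exact: sec_cont_at0.
  have : nbhs z (~` K).
    by apply: open_nbhs_nbhs; split=> //; apply: closed_openC; exact: compact_closed tc_Z_T2 _.
  by apply: filterS => a /bK; rewrite /u => ->; rewrite rC0 scale0r.
have gu : Gamma0_set u.
  by apply: (Gamma0_supp cu cK) => z /bK; rewrite /u => ->; rewrite rC0 scale0r.
exists (G0_mk gu); split => /=.
- have nN : nbhs z0 N by exact: open_nbhs_nbhs.
  near=> z; have bz : b z = 1 by near: z.
  have Nz : N z by near: z.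
  by rewrite /u bz rC1 scale1r; split; [exact: e1|move=> v; exact: eE].
- move=> z; rewrite /u lnrmZ nc_rC; last by have /andP[] := b01 z.
  have [Nz|nNz] := pselect (N z).
    by rewrite (lnrm_unit (e1 z Nz)) mulr1; have /andP[] := b01 z.
  by rewrite bK ?mul0r// => /KW [].
- by move=> z nWz; rewrite /u bK ?rC0 ?scale0r// => /KW [].
Unshelve. all: by end_near. Qed.

Lemma section_at (z : Z) (v : L z) (W : set Z) : nbhs z W ->
  exists p : Gamma0 c, G0_sec p z = v /\ forall a, ~ W a -> G0_sec p a = 0.
Proof.
move=> /bump_section[p [/nbhs_singleton[_ pv] _ pW]].
exists (h (G0_sec p z) v *: p); split; first by rewrite [RHS]pv.
by move=> a /pW pa; rewrite /= -[RHS](scaler0 _ (h (G0_sec p z) v)) -pa.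
Qed.

Lemma fiber_nbhd (z : Z) : exists2 W, nbhs z W & forall a, W a -> s a = s z -> a = z.
Proof.
have [W oW inj] := inj_nbhd z; exists W; first exact: open_nbhs_nbhs.
by move=> a Wa sa; apply: inj => //; exact: nbhs_singleton (open_nbhs_nbhs oW).
Qed.

(** The fiber over [x] is finite, so no continuity of [u] is required: one adds sections supported
    near single points of the fiber and zero at the others. *)
Lemma section_ext (x : X) u : exists p : Gamma0 c,
  forall z, s z = x -> G0_sec p z = u z.
Proof.
have H (l : seq Z) : uniq l -> {subset l <= fib x} -> exists p : Gamma0 c,
    forall z, s z = x -> G0_sec p z = if z \in l then u z else 0.
  elim: l => [|z l IH] /=; first by exists 0.
  move=> /andP[zl ul] sub; have [|w wl|p pP] := IH; first by [].
    by apply: sub; rewrite inE wl orbT.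
  have zx : s z = x by apply/mem_fib/sub; rewrite inE eqxx.
  have [W Wz inj] := fiber_nbhd z; have [q [qz qW]] := section_at (u z) Wz.
  exists (p + q) => a ax; have -> : G0_sec (p + q) a = G0_sec p a + G0_sec q a by [].
  rewrite pP// inE; have [->|az] := eqVneq a z; first by rewrite (negbTE zl) qz add0r.
  have -> : G0_sec q a = 0.
    apply: qW => Wa; move/eqP: az; apply; apply: inj => //.
    by rewrite zx.
  by rewrite addr0.
have [||p pP] := H (fib x); [exact: fib_uniq|by []|].
by exists p => z zx; rewrite pP// (mem_fib x z).2.
Qed.

Definition ext x u : Gamma0 c := projT1 (cid (section_ext x u)).
Lemma extP x u z : s z = x -> G0_sec (ext x u) z = u z.
Proof. by rewrite /ext; case: cid => p /= H /H. Qed.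

Notation E := (Gamma0_corr c).

Lemma fip_c0fun (p : E) : c0fun (fiber_ip (G0_sec p) (G0_sec p)).
Proof.
split; last by have [] := G0_Gamma0 p.
by move=> x; apply: fiber_ip_cont_at => z _; split; exact: G0_cont.
Qed.

Lemma fnorm_le_enorm (p : E) x : nx (G0_sec p) x <= enorm p.
Proof.
have [M M0 pM] := c0fun_bounded (fip_c0fun p).
apply: sup_upper_bound; last by exists x.
split; first by exists (fnorm p x), x.
exists (Num.sqrt M) => _ [y _ <-]; rewrite ler_wsqrtr//.
by apply: le_trans (pM y); exact: re_le_nc.
Qed.

Lemma enorm_le (p : E) (M : R) : 0 <= M -> (forall x, nx (G0_sec p) x <= M) -> enorm p <= M.
Proof.
move=> M0 pM; rewrite /enorm; have [->|/set0P ne] := eqVneq (range (fnorm p)) set0.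
  by rewrite sup0.
by apply: ge_sup => // _ [x _ <-]; exact: pM.
Qed.

Lemma enorm_ge0 (p : E) : 0 <= enorm p.
Proof.
have [e|/set0P[_ [x _ _]]] := eqVneq (range (fnorm p)) set0.
  by rewrite /enorm e sup0.
exact: le_trans (nx_ge0 _ x) (fnorm_le_enorm p x).
Qed.

Lemma enormD (p q : E) : enorm (p + q) <= enorm p + enorm q.
Proof.
apply: enorm_le => [|x]; first by rewrite addr_ge0 ?enorm_ge0.
apply: le_trans (nxD _ _ _) _.
by apply: lerD; exact: fnorm_le_enorm.
Qed.

Lemma enormZ_le (a : C) (p : E) : enorm (a *: p) <= nc a * enorm p.
Proof.
apply: enorm_le => [|x]; first by rewrite mulr_ge0 ?nc_ge0 ?enorm_ge0.
rewrite [X in X <= _](nxZ a (G0_sec p)).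
by apply: ler_wpM2l; [exact: nc_ge0|exact: fnorm_le_enorm].
Qed.

Lemma enormN (p : E) : enorm (- p) <= enorm p.
Proof. by rewrite -scaleN1r; apply: le_trans (enormZ_le _ _) _; rewrite ncN nc1 mul1r. Qed.

Lemma enorm_eq0 (p : E) : enorm p <= 0 -> p = 0.
Proof.
move=> p0; apply: G0_inj => z; apply: (nx_eq0 (G0_sec p) (s z)).1 => //.
apply/eqP; rewrite eq_le nx_ge0 andbT; apply: le_trans p0.
exact: fnorm_le_enorm.
Qed.

End Cover.

Arguments G0_cont {R X Y c} p z.

(* The maps r along the sheets through z and z' have the same germ at the common
   image of z and z'. *)
Definition germ_eq (R : realType) (X Y : topologicalType) (c c' : tcorr R Y X)
    (z : tc_Z c) (z' : tc_Z c') : Prop :=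
  tc_s z = tc_s z' /\ exists W W', [/\ nbhs z W, nbhs z' W' &
    forall a a', W a -> W' a' -> tc_s a = tc_s a' -> tc_r a = tc_r a'].

Lemma germ_eq_r (R : realType) (X Y : topologicalType) (c c' : tcorr R Y X) z z' :
  @germ_eq _ _ _ c c' z z' -> tc_r z = tc_r z'.
Proof. by move=> [szw [W [W' [Wz Ww]]]]; apply => //; exact: nbhs_singleton. Qed.

Lemma smallest_min (T : Type) (P : set T -> Prop) (G A : set T) :
  P A -> G `<=` A -> smallest P G `<=` A.
Proof. by move=> PA GA t; apply. Qed.

Lemma eq_vanish (R : realType) (T : topologicalType) (f g : T -> cplx R) : f =1 g ->
  vanishes_at_infinity f -> vanishes_at_infinity g.
Proof. by move=> /funext ->. Qed.

Lemma eq_c0fun (R : realType) (T : topologicalType) (f g : T -> cplx R) : f =1 g ->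
  c0fun f -> c0fun g.
Proof. by move=> /funext ->. Qed.

(** * Compact operators and multiplication operators *)

Section NormClosure.
Variables (R : realType) (X Y : topologicalType) (E : corr R Y X).

Lemma norm_closureS (A B : set (E -> E)) : A `<=` B -> norm_closure A `<=` norm_closure B.
Proof. by move=> AB T AT e e0; have [S AS H] := AT e e0; exists S => //; exact: AB. Qed.

Lemma sub_norm_closure (A : set (E -> E)) : (forall u : E, 0 <= enorm u) ->
  enorm (0 : E) = 0 -> A `<=` norm_closure A.
Proof. by move=> en0 e0 T AT e ep; exists T => // u; rewrite subrr e0 mulr_ge0// ltW. Qed.

End NormClosure.

Section Ops.
Variables (R : realType) (X Y : topologicalType) (c : tcorr R Y X).
Hypotheses (lcX : locally_compact [set: X]) (T2X : hausdorff_space X).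
Hypothesis s_surj : range (@tc_s R Y X c) = [set: X].
Notation C := (cplx R).
Notation Z := (tc_Z c).
Notation L := (tc_L c).
Notation s := (@tc_s R Y X c).
Notation r := (@tc_r R Y X c).
Notation h := (lb_met (h := L)).
Notation E := (Gamma0_corr c).
Implicit Types (T S : E -> E) (u v p q : E) (x : X) (z w : Z) (k l : Z -> C).

(** True because the fiber is one-dimensional. It is what turns theta_{p,p} into multiplication by
    |p|^2 when [p] lives on a single sheet. *)
Lemma line_swap z (v w : L z) : h v w *: v = h v v *: w.
Proof.
have [N [e [_ Nz _ eE _]]] := local_frame L z.
set a := h (e z) v; set b := h (e z) w.
rewrite (eE z v Nz) (eE z w Nz) -/a -/b !hZl !hZr !scalerA.
by congr (_ *: _); ring.
Qed.

Lemma unit_section z (W : set Z) : nbhs z W -> exists p : E,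
  [/\ \forall a \near z, h (G0_sec p a) (G0_sec p a) = 1 /\
         forall v : L a, v = h (G0_sec p a) v *: G0_sec p a,
      enorm p <= 1, forall a, ~ W a -> G0_sec p a = 0 &
      forall a b, s a = s b -> G0_sec p a <> 0 -> G0_sec p b <> 0 -> a = b].
Proof.
move=> Wz; have [V Vz inj] := inj_nbhd z.
have VWz : nbhs z (W `&` V) by apply: filterI => //; exact: open_nbhs_nbhs.
have [p [p1 ple pW]] := bump_section VWz.
have pV a : G0_sec p a <> 0 -> V a.
  by move=> pa; apply: contrapT => nV; apply: pa; apply: pW => -[].
exists p; split => //.
- apply: enorm_le => // x; apply: nx_le_single => // a b ax bx /pV Va /pV Vb.
  by apply: inj => //; rewrite ax.
- by move=> a nWa; apply: pW => -[].
- by move=> a b ab /pV Va /pV Vb; exact: inj.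
Qed.

Definition mult T k : Prop := forall u z, G0_sec (T u) z = k z *: G0_sec u z.

Lemma mult_inj T S k : mult T k -> mult S k -> T = S.
Proof. by move=> mT mS; apply/funext => u; apply: G0_inj => z; rewrite mT mS. Qed.

Lemma mult_uniq T k l : mult T k -> mult T l -> forall z, k z = l z.
Proof.
move=> mk ml z; have [p [/nbhs_singleton[p1 _] _ _ _]] := unit_section (@filterT _ (nbhs z) _).
have : h (G0_sec p z) (G0_sec (T p) z) = h (G0_sec p z) (G0_sec (T p) z) by [].
by rewrite {1}mk ml !hZr p1 !mulr1.
Qed.

Lemma id_cont : continuous (@id Z). Proof. by move=> z. Qed.

Definition Mop k (ck : c0fun k) : E -> E := G0_mul id_cont (mkC0 ck).

Lemma mult_Mop k (ck : c0fun k) : mult (Mop ck) k. Proof. by []. Qed.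
Lemma mult_iota (f : C0 R X) : mult (iota_op (E := E) f) (fun z => f (s z)). Proof. by []. Qed.
Lemma mult_phi (g : C0 R Y) : mult (phi_op (E := E) g) (fun z => g (r z)). Proof. by []. Qed.

Lemma c0fun_s (f : X -> C) : c0fun f -> c0fun (fun z => f (s z)).
Proof.
move=> [cf vf]; split=> [z|e e0].
  by apply: continuous_comp; [exact: s_cont|exact: cf].
have [K cK hK] := vf e e0; exists (s @^-1` K); first exact: s_proper.
by move=> z nK; exact: hK.
Qed.

Lemma c0fun_r (g : Y -> C) : c0fun g -> c0fun (fun z => g (r z)).
Proof.
move=> [cg vg]; split=> [z|e e0].
  by apply: continuous_comp; [exact: tc_r_cont|exact: cg].
have [K cK hK] := vg e e0; exists (r @^-1` K); first exact: tc_r_proper.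
by move=> z nK; exact: hK.
Qed.

Lemma mult_lin a T S k l : mult T k -> mult S l ->
  mult (a *: T + S) (fun z => a * k z + l z).
Proof.
move=> mT mS u z.
have -> : G0_sec ((a *: T + S) u) z = a *: G0_sec (T u) z + G0_sec (S u) z by [].
by rewrite mT mS scalerDl scalerA.
Qed.

Lemma mult_comp T S k l : mult T k -> mult S l -> mult (T \o S) (fun z => k z * l z).
Proof. by move=> mT mS u z; rewrite /= mT mS scalerA. Qed.

Lemma mult_sub T S k l u z : mult T k -> mult S l ->
  G0_sec (T u - S u) z = (k z - l z) *: G0_sec u z.
Proof.
move=> mT mS; have -> : G0_sec (T u - S u) z = G0_sec (T u) z - G0_sec (S u) z by [].
by rewrite mT mS scalerBl.
Qed.

Lemma nx_scale_le (u v : sections L) k (e : R) x : 0 <= e ->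
  (forall z, s z = x -> v z = k z *: u z) -> (forall z, s z = x -> nc (k z) <= e) ->
  nx v x <= e * nx u x.
Proof.
move=> e0 vk ke; rewrite -(@ler_pXn2r _ 2)// ?nnegrE ?nx_ge0 ?mulr_ge0 ?nx_ge0//.
rewrite exprMn !nx_sum mulr_sumr !big_seq; apply: ler_sum => z /mem_fib zx.
rewrite vk// lnrmZ exprMn; apply: ler_wpM2r; first by rewrite exprn_ge0 ?lnrm_ge0.
by rewrite ler_pXn2r ?nnegrE ?nc_ge0// ke.
Qed.

Lemma mult_enorm_le u v k (e : R) : 0 <= e -> (forall z, G0_sec v z = k z *: G0_sec u z) ->
  (forall z, nc (k z) <= e) -> enorm v <= e * enorm u.
Proof.
move=> e0 vk ke; apply: enorm_le => [|x]; first by rewrite mulr_ge0// enorm_ge0.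
apply: le_trans (nx_scale_le (u := G0_sec u) (k := k) e0 _ _) _ => //.
by apply: ler_wpM2l => //; exact: fnorm_le_enorm.
Qed.

Lemma mult_norm_bound T S k l (e : R) : 0 <= e -> mult T k -> mult S l ->
  (forall u, enorm (T u - S u) <= e * enorm u) -> forall z, nc (k z - l z) <= e.
Proof.
move=> e0 mT mS TS z.
have [p [/nbhs_singleton[p1 _] ple _ _]] := unit_section (@filterT _ (nbhs z) _).
have : lnrm (G0_sec (T p - S p) z) <= e.
  apply: le_trans (lnrm_le_nx _ _) _; apply: le_trans (fnorm_le_enorm _ _ _ _ _) _ => //.
  apply: le_trans (TS p) _; rewrite -[X in _ <= X]mulr1.
  exact: ler_wpM2l.
by rewrite (mult_sub _ _ mT mS) lnrmZ (lnrm_unit p1) mulr1.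
Qed.

Lemma mult_adjoint T S k : mult T k -> mult S (fun z => (k z)^*) -> is_adjoint T S.
Proof.
move=> mT mS u v x; rewrite /ip/= !fiber_ipE; apply: eq_bigr => z _.
by rewrite mT mS hZl hZr.
Qed.

Lemma adjoint_uniq T S S' : is_adjoint T S -> is_adjoint T S' -> S = S'.
Proof.
move=> TS TS'; apply/funext => v; apply: G0_inj => z.
have key x : fiber_ip (G0_sec (S v - S' v)) (G0_sec (S v - S' v)) x = 0.
  have E1 : fiber_ip (G0_sec (S v - S' v)) (G0_sec (S v - S' v)) x =
     (-1) * fiber_ip (G0_sec (S v - S' v)) (G0_sec (S' v)) x +
     fiber_ip (G0_sec (S v - S' v)) (G0_sec (S v)) x.
    rewrite -fip_linr; congr (fiber_ip _ _ x).
    by rewrite scaleN1r addrC.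
  have e1 := TS (S v - S' v) v x; have e2 := TS' (S v - S' v) v x.
  rewrite /= in e1 e2; rewrite E1 -e1 -e2; ring.
have /eqP : G0_sec (S v - S' v) z = 0.
  apply: (nx_eq0 (G0_sec (S v - S' v)) (s z)).1 => //.
  by have := nx_sqr (G0_sec (S v - S' v)) (s z); rewrite key -rC0 => /rC_inj/eqP; rewrite expf_eq0/= => /eqP.
by rewrite subr_eq0 => /eqP.
Qed.

Lemma fip_c0fun2 u v : c0fun (fiber_ip (G0_sec u) (G0_sec v)).
Proof.
apply: (c0fun_le _ (fip_c0fun lcX T2X s_surj u) (fip_c0fun lcX T2X s_surj v) (k := 1)) => // x.
  by apply: fiber_ip_cont_at => // z _; split; exact: G0_cont.
rewrite !mul1r -!nx_sqr !nc_rC ?exprn_ge0 ?nx_ge0//.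
apply: le_trans (nx_cs _ _ _) _.
have := nx_ge0 (G0_sec u) x; have := nx_ge0 (G0_sec v) x.
set a := nx _ _; set b := nx _ _ => a0 b0.
have := sqr_ge0 (a - b); nra.
Qed.

Definition theta p q : E -> E :=
  fun u => ract p (mkC0 (fip_c0fun2 q u)).

Lemma theta_sec p q u z : G0_sec (theta p q u) z = fiber_ip (G0_sec q) (G0_sec u) (s z) *: G0_sec p z.
Proof. by []. Qed.

Lemma theta_is_theta p q : is_theta p q (theta p q).
Proof. by move=> u; exists (mkC0 (fip_c0fun2 q u)). Qed.

Definition thetas : set (E -> E) := [set T | exists a b, is_theta a b T].

Lemma is_theta_eq p q T : is_theta p q T -> T = theta p q.
Proof.
move=> tT; apply/funext => u; have [f fE ->] := tT u.
by apply: G0_inj => z; rewrite theta_sec /= fE.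
Qed.

Lemma enorm0 : enorm (0 : E) = 0.
Proof.
apply/eqP; rewrite eq_le enorm_ge0// andbT; apply: enorm_le => // x.
by rewrite le_eqVlt; apply/orP; left; apply/eqP/nx_eq0.
Qed.

Lemma sub_compact_ops : lspan thetas `<=` compact_ops E.
Proof. by apply: sub_norm_closure; [move=> u; exact: enorm_ge0|exact: enorm0]. Qed.

Lemma norm_closure_idem (A : set (E -> E)) : norm_closure (norm_closure A) `<=` norm_closure A.
Proof.
move=> T AT e e0; have e2 : 0 < e / 2 by rewrite divr_gt0.
have [S AS TS] := AT _ e2; have [Q AQ SQ] := AS _ e2; exists Q => // u.
have -> : T u - Q u = (T u - S u) + (S u - Q u) by rewrite addrA subrK.
apply: le_trans (enormD _ _ _ _ _) _ => //.
by have := TS u; have := SQ u; lra.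
Qed.

(** Three consequences of compactness that hold for each theta_{p,q} and survive linear combinations
    and norm limits. The last one, uniform decay at infinity in [Z], later makes symbols vanish at
    infinity. *)
Record good T : Prop := Good {
  good_lin : forall a u v, T (a *: u + v) = a *: T u + T v;
  good_bd : exists2 M : R, 0 < M & forall u, enorm (T u) <= M * enorm u;
  good_van : forall e : R, 0 < e -> exists2 K : set Z, compact K &
    forall z u, ~ K z -> lnrm (G0_sec (T u) z) <= e * enorm u }.

Lemma good_theta p q : good (theta p q).
Proof.
split.
- move=> a u v; apply: G0_inj => z.
  have -> : G0_sec (a *: theta p q u + theta p q v) z =
     a *: G0_sec (theta p q u) z + G0_sec (theta p q v) z by [].
  rewrite !theta_sec.
  have -> : G0_sec (a *: u + v) = a *: G0_sec u + G0_sec v by [].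
  by rewrite fip_linr scalerDl scalerA.
- exists (enorm p * enorm q + 1); first by rewrite ltr_wpDl// mulr_ge0 ?enorm_ge0.
  move=> u; apply: enorm_le => [|x].
    by rewrite mulr_ge0 ?enorm_ge0// addr_ge0// mulr_ge0 ?enorm_ge0.
  have -> : nx (G0_sec (theta p q u)) x = nx (fiber_ip (G0_sec q) (G0_sec u) x *: G0_sec p) x.
    by apply: nx_eq => z <-; rewrite theta_sec.
  rewrite nxZ; apply: le_trans (_ : enorm q * enorm u * enorm p <= _).
    apply: ler_pM; rewrite ?nc_ge0 ?nx_ge0//; last exact: fnorm_le_enorm.
    apply: le_trans (nx_cs _ _ _) _; apply: ler_pM; rewrite ?nx_ge0//; exact: fnorm_le_enorm.
  rewrite (_ : enorm q * enorm u * enorm p = enorm p * enorm q * enorm u); last by ring.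
  by apply: ler_wpM2r; rewrite ?enorm_ge0// lerDl.
- move=> e e0; have [_ vp _] := G0_Gamma0 p.
  pose d := e / (enorm q + 1); have q0 : 0 <= enorm q by exact: enorm_ge0.
  have q1 : 0 < enorm q + 1 by rewrite ltr_wpDl.
  have d0 : 0 < d by rewrite divr_gt0.
  have d20 : 0 < d ^+ 2 by rewrite exprn_gt0.
  have [K cK pK] := (vanishP _).1 vp _ d20; exists K => // z u /pK.
  rewrite -lnrm_sqr nc_rC ?exprn_ge0 ?lnrm_ge0// => pz.
  have {}pz : lnrm (G0_sec p z) <= d.
    by apply: ltW; move: pz; rewrite ltr_pXn2r// ?nnegrE ?lnrm_ge0// ltW.
  rewrite theta_sec lnrmZ; apply: le_trans (_ : enorm q * enorm u * d <= _).
    apply: ler_pM; rewrite ?nc_ge0 ?lnrm_ge0//.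
    apply: le_trans (nx_cs _ _ _) _; apply: ler_pM; rewrite ?nx_ge0//; exact: fnorm_le_enorm.
  have -> : e = (enorm q + 1) * d by rewrite /d mulrC divfK// gt_eqF.
  rewrite (_ : enorm q * enorm u * d = enorm q * d * enorm u); last by ring.
  apply: ler_wpM2r; first exact: enorm_ge0.
  by apply: ler_wpM2r; [exact: ltW|rewrite lerDl].
Qed.

Lemma good_submodule : submodule [set T | good T].
Proof.
split.
  split.
  - by move=> a u v; rewrite scaler0 addr0.
  - by exists 1 => // u; rewrite mul1r [X in X <= _]enorm0 enorm_ge0.
  - move=> e e0; exists set0; first exact: compact0.
    move=> z u _; rewrite (_ : G0_sec _ z = 0); last by [].
    by rewrite lnrm0 mulr_ge0 ?enorm_ge0// ltW.
move=> a T S [lT [M M0 bT] vT] [lS [N N0 bS] vS].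
have D u : (a *: T + S) u = a *: T u + S u by [].
have a1 : 0 < nc a + 1 by rewrite ltr_wpDl// nc_ge0.
split.
- by move=> b u v; rewrite !D lT lS !scalerDr !scalerA (mulrC a b) addrACA.
- exists (nc a * M + N); first by rewrite ltr_wpDl// mulr_ge0 ?nc_ge0// ltW.
  move=> u; rewrite D; apply: le_trans (enormD _ _ _ _ _) _ => //.
  rewrite mulrDl -mulrA; apply: lerD => //; apply: le_trans (enormZ_le _ _ _ _ _) _ => //.
  by apply: ler_wpM2l; [exact: nc_ge0|exact: bT].
- move=> e e0; pose d := e / (2 * (nc a + 1)).
  have d0 : 0 < d by rewrite divr_gt0// mulr_gt0.
  have [K cK TK] := vT _ d0; have e2 : 0 < e / 2 by rewrite divr_gt0.
  have [K' cK' SK] := vS _ e2; exists (K `|` K'); first exact: compactU.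
  move=> z u nK; have := TK z u (fun Kz => nK (or_introl Kz)).
  have := SK z u (fun Kz => nK (or_intror Kz)); rewrite D => Sz Tz.
  have -> : G0_sec (a *: T u + S u) z = a *: G0_sec (T u) z + G0_sec (S u) z by [].
  apply: le_trans (lnrmD _ _) _; rewrite lnrmZ.
  have u0 : 0 <= enorm u by exact: enorm_ge0.
  have A : nc a * lnrm (G0_sec (T u) z) <= nc a * (d * enorm u).
    by apply: ler_wpM2l => //; exact: nc_ge0.
  have B : nc a * (d * enorm u) <= e / 2 * enorm u.
    rewrite mulrA; apply: ler_wpM2r => //.
    have -> : e / 2 = (nc a + 1) * d.
      by rewrite /d; field; rewrite gt_eqF.
    by apply: ler_wpM2r; [exact: ltW|rewrite lerDl].
  by have := Sz; lra.
Qed.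

Lemma small_eq0 u (M : R) : (forall e : R, 0 < e -> enorm u <= e * M) -> u = 0.
Proof.
move=> H; apply: enorm_eq0 => //.
have M0 : 0 <= M by have := H 1 ltr01; rewrite mul1r; apply: le_trans; exact: enorm_ge0.
rewrite leNgt; apply/negP => u0; have M1 : 0 < M + 1 by rewrite ltr_wpDl.
have := H (enorm u / (2 * (M + 1))); rewrite divr_gt0 ?mulr_gt0// => /(_ isT).
rewrite leNgt => /negP; apply.
have -> : enorm u = enorm u / (2 * (M + 1)) * (2 * (M + 1)) by rewrite divfK// gt_eqF ?mulr_gt0.
by rewrite mulfK ?gt_eqF ?mulr_gt0// ltr_pM2l ?divr_gt0 ?mulr_gt0//; lra.
Qed.

Lemma good_closure : norm_closure [set T | good T] `<=` [set T | good T].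
Proof.
move=> T cT; split.
- move=> a u v; apply/eqP; rewrite -subr_eq0; apply/eqP.
  apply: (@small_eq0 _ (enorm (a *: u + v) + nc a * enorm u + enorm v)) => e e0.
  have [S [lS _ _] TS] := cT e e0.
  have -> : T (a *: u + v) - (a *: T u + T v) =
    (T (a *: u + v) - S (a *: u + v)) - (a *: (T u - S u) + (T v - S v)).
    have -> : a *: (T u - S u) + (T v - S v) = (a *: T u + T v) - S (a *: u + v).
      by rewrite lS scalerBr opprD addrACA.
    by rewrite opprB addrA subrK.
  apply: le_trans (enormD _ _ _ _ _) _ => //; rewrite mulrDr mulrDr -addrA; apply: lerD => //.
  apply: le_trans (enormN _ _ _ _) _ => //; apply: le_trans (enormD _ _ _ _ _) _ => //.
  apply: lerD => //; apply: le_trans (enormZ_le _ _ _ _ _) _ => //.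
  by rewrite mulrCA; apply: ler_wpM2l; [exact: nc_ge0|exact: TS].
- have [S [_ [M M0 bS] _] TS] := cT 1 ltr01.
  exists (1 + M); first by rewrite addr_gt0.
  move=> u; have -> : T u = (T u - S u) + S u by rewrite subrK.
  apply: le_trans (enormD _ _ _ _ _) _ => //; rewrite mulrDl.
  exact: lerD.
- move=> e e0; have e2 : 0 < e / 2 by rewrite divr_gt0.
  have [S [_ _ vS] TS] := cT _ e2; have [K cK SK] := vS _ e2.
  exists K => // z u nK; have -> : G0_sec (T u) z = G0_sec (T u - S u) z + G0_sec (S u) z.
    by rewrite [X in X + _]/(G0_sec (T u) z - G0_sec (S u) z) subrK.
  apply: le_trans (lnrmD _ _) _; have := SK z u nK; have := TS u.
  have := le_trans (lnrm_le_nx (G0_sec (T u - S u)) z) (fnorm_le_enorm lcX T2X s_surj _ _).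
  lra.
Qed.

Lemma compact_ops_good T : compact_ops E T -> good T.
Proof.
move=> cT; apply: good_closure; apply: norm_closureS cT; apply: smallest_min.
  exact: good_submodule.
by move=> {}T [p [q /is_theta_eq ->]]; exact: good_theta.
Qed.

Lemma compact_ops_closed : norm_closure (compact_ops E) `<=` compact_ops E.
Proof. exact: norm_closure_idem. Qed.

Lemma theta_compact p q : compact_ops E (theta p q).
Proof.
by apply: sub_compact_ops => W [_]; apply; exists p, q; exact: theta_is_theta.
Qed.

Lemma scale_subproof (a : Z -> C) (M : R) u : continuous a -> 0 <= M -> (forall z, nc (a z) <= M) ->
  Gamma0_set ((fun z => a z *: G0_sec u z) : sections L).
Proof.
move=> ca M0 aM; rewrite (_ : (fun z => _) = (fun z => a z *: G0_sec u z + (0 : sections L) z)).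
  apply: (@Gamma0_lin _ _ _ _ a (rC M)) => //; first by rewrite rC_ge0.
  - by move=> b; rewrite normC_nc ler_rC.
  - exact: G0_Gamma0.
  - exact: Gamma0_zero.
by apply: functional_extensionality_dep => b; rewrite addr0.
Qed.

(** Multiplying theta_{p,q} by [a] on the left gives theta_{ap,q}, and a bounded continuous [a]
    keeps [p] in E. *)
Lemma lspan_thetas_scale (a : Z -> C) (M : R) T S : continuous a -> 0 <= M ->
  (forall z, nc (a z) <= M) -> lspan thetas T ->
  (forall u z, G0_sec (S u) z = a z *: G0_sec (T u) z) -> lspan thetas S.
Proof.
move=> ca M0 aM.
pose sc T : E -> E := fun u => G0_mk (scale_subproof (T u) ca M0 aM).
suff H : lspan thetas `<=` [set T | lspan thetas (sc T)].
  move=> /H/= scT ST; rewrite (_ : S = sc T)//.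
  by apply/funext => u; apply: G0_inj => z; rewrite ST.
have [l0 ll] := lspan_submodule thetas.
apply: smallest_min.
  split=> /=.
    rewrite (_ : sc _ = 0)//; apply/funext => u; apply: G0_inj => z.
    by rewrite /sc /= scaler0.
  move=> b {}T {}S hT hS; rewrite (_ : sc _ = b *: sc T + sc S); first exact: ll.
  apply/funext => u; apply: G0_inj => z.
  have D (w1 w2 : L z) : a z *: (b *: w1 + w2) = b *: (a z *: w1) + a z *: w2.
    by rewrite scalerDr !scalerA mulrC.
  exact: D.
move=> {S}T [p [q /is_theta_eq ->]] W [_]; apply.
exists (G0_mk (scale_subproof p ca M0 aM)), q.
rewrite (_ : sc _ = theta (G0_mk (scale_subproof p ca M0 aM)) q); first exact: theta_is_theta.
apply/funext => u; apply: G0_inj => z; rewrite theta_sec /sc /=.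
by rewrite !scalerA mulrC.
Qed.

(** A section [p] meeting each fiber of [s] in at most one point leaves only the diagonal term in
    <p,u>p, which is |p|^2 u since fibers are lines. *)
Lemma mult_theta_diag z (W : set Z) : nbhs z W -> exists T, exists g : Z -> R,
  [/\ lspan thetas T, mult T (fun z => rC (g z)), c0fun (fun z => rC (g z) : C),
    forall z, 0 <= g z & g z = 1].
Proof.
move=> Wz; have [p [/nbhs_singleton[p1 _] _ _ pinj]] := unit_section Wz.
exists (theta p p), (fun z => lnrm (G0_sec p z) ^+ 2); split.
- by move=> V [_]; apply; exists p, p; exact: theta_is_theta.
- move=> u a; rewrite theta_sec lnrm_sqr.
  have [p0|pa] := pselect (G0_sec p a = 0); first by rewrite p0 scaler0 hl0 scale0r.
  rewrite (fip_single (z := a))// ?line_swap// => b ba nba.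
  by left; apply: contrapT => pb; apply: nba; exact: pinj.
- split; last by have [_ vp _] := G0_Gamma0 p; apply: eq_vanish vp => a; rewrite lnrm_sqr.
  move=> a; apply: (cont_at_near (f := fun a => h (G0_sec p a) (G0_sec p a))).
    by near=> b; rewrite lnrm_sqr.
  by apply: ip_cont_at; exact: G0_cont.
- by move=> a; rewrite exprn_ge0 ?lnrm_ge0.
- by rewrite (lnrm_unit p1) expr1n.
Unshelve. all: by end_near. Qed.

(* On compact K, a sum g of the preceding operators is bounded below, and h
   is uniformly approximated by h t g / (1 + t g) for large t. *)
Lemma mult_compact T k : c0fun k -> mult T k -> compact_ops E T.
Proof.
move=> ck mT e e0; have [M M0 kM] := c0fun_bounded ck.
have [_ /vanishP/(_ e e0)[K cK kK]] := ck.
pose P (A : set Z) := exists S, exists g : Z -> R, exists2 d : R, 0 < d &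
  [/\ lspan thetas S, mult S (fun z => rC (g z)), c0fun (fun z => rC (g z) : C),
    forall z, 0 <= g z & forall z, A z -> d <= g z].
have [l0 ll] := lspan_submodule thetas.
have [S [g [d d0 [lS mS cg g0 gd]]]] : P K.
  apply: compact_ind cK _ _ _ _.
  - exists 0, (fun=> 0), 1 => //; split=> //.
    + by move=> u z; rewrite rC0 scale0r.
    + exact: c0fun0.
  - move=> A B [S [g [d d0 [lS mS cg g0 gd]]]] [S' [g' [d' d'0 [lS' mS' cg' g'0 gd']]]].
    exists (1 *: S + S'), (fun z => g z + g' z), (Num.min d d'); first by rewrite lt_min d0.
    split.
    + exact: ll.
    + move=> u z; have := mult_lin 1 mS mS' u z; rewrite mul1r => ->.
      by rewrite rCD.
    + by apply: eq_c0fun (c0funD cg cg') => z; rewrite rCD.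
    + by move=> z; rewrite addr_ge0.
    + move=> z [/gd|/gd'] H; rewrite ge_min.
        by rewrite (le_trans H)// lerDl.
      by rewrite (le_trans H) ?orbT// lerDr.
  - move=> A B AB [S [g [d d0 [lS mS cg g0 gd]]]]; exists S, g, d => //; split=> // z /AB.
    exact: gd.
  - move=> z Kz; have [S [g [lS mS cg g0 g1]]] := mult_theta_diag (@filterT _ (nbhs z) _).
    exists [set a | 2^-1 < g a]; last first.
      by exists S, g, 2^-1 => //; split=> // a /ltW.
    have /cont_at_re := cont_atW cg.1 z.
    rewrite /cont_at /= => /cvgrPdist_lt/(_ 2^-1); rewrite invr_gt0 => /(_ (ltr0Sn _ 1)).
    apply: filterS => a /=; rewrite g1 => H.
    by have := le_lt_trans (ler_norm _) H; lra.
(* The error has symbol k/(1 + tg). On [K] it is at most M/(td) = e by the choice of [t]; off [K] it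
   is at most |k| < e since g >= 0. *)
pose t := M / (e * d); have t0 : 0 < t by rewrite divr_gt0// mulr_gt0.
have tg z : 0 < 1 + t * g z by rewrite ltr_wpDr// mulr_ge0// ltW.
pose a z : C := k z * (rC t * (rC (1 + t * g z))^-1).
have ca : continuous a.
  move=> z; apply: (cont_atM (cont_atW ck.1 z)); apply: cont_atM; first exact: cont_at_cst.
  apply: cont_atV; last by rewrite -rC0 (inj_eq (@rC_inj R)) gt_eqF.
  apply: (cont_at_near (f := fun z => rC 1 + rC t * rC (g z))).
    by near=> b; rewrite rCD rCM.
  apply: cont_atD; first exact: cont_at_cst.
  by apply: cont_atM; [exact: cont_at_cst|exact: cg.1].
have aM z : nc (a z) <= M * t.
  have tv : 0 <= t / (1 + t * g z) := divr_ge0 (ltW t0) (ltW (tg z)).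
  have tv1 : t / (1 + t * g z) <= t.
    rewrite ler_pdivrMr//; apply: ler_peMr; first exact: ltW.
    by rewrite lerDl mulr_ge0// ltW.
  by rewrite /a ncM -rCV -rCM nc_rC//; exact: ler_pM (nc_ge0 _) tv (kM z) tv1.
have Mt0 : 0 <= M * t by rewrite mulr_ge0// ltW.
pose Q : E -> E := fun u => G0_mk (scale_subproof (S u) ca Mt0 aM).
exists Q; first exact: (lspan_thetas_scale ca Mt0 aM lS).
move=> u; apply: (mult_enorm_le (k := fun z => k z * rC ((1 + t * g z)^-1))) => //.
- by rewrite ltW.
- move=> z; have -> : G0_sec (T u - Q u) z = G0_sec (T u) z - a z *: G0_sec (S u) z by [].
  rewrite mT mS scalerA -scalerBl /a -mulrA; congr (_ *: _).
  rewrite rCV -{1}[k z]mulr1 -mulrBr; congr (_ * _).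
  rewrite -rCV -!rCM -rC1 -rCB; congr rC.
  by field; rewrite gt_eqF.
- move=> z; rewrite ncM nc_rC; last by rewrite invr_ge0 ltW.
  have [Kz|/kK/ltW kz] := pselect (K z); last first.
    apply: le_trans kz; rewrite -[X in _ <= X]mulr1; apply: ler_wpM2l; first exact: nc_ge0.
    by rewrite invf_le1// lerDl mulr_ge0// ltW.
  rewrite ler_pdivrMr//; apply: le_trans (kM z) _.
  have : e * (t * d) <= e * (1 + t * g z).
    apply: ler_wpM2l; first exact: ltW.
    apply: le_trans (_ : t * g z <= _); last by rewrite lerDr.
    by apply: ler_wpM2l; [exact: ltW|exact: gd].
  apply: le_trans; rewrite /t le_eqVlt; apply/orP; left; apply/eqP; field.
  by rewrite !gt_eqF.
Unshelve. all: by end_near. Qed.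

Lemma good0 T : good T -> T 0 = 0.
Proof.
by case=> lT _ _; have := lT 1 0 0; rewrite !scale1r addr0 -[LHS]addr0 => /addrI.
Qed.

Lemma goodD T u v : good T -> T (u + v) = T u + T v.
Proof. by case=> lT _ _; have := lT 1 u v; rewrite !scale1r. Qed.

Lemma goodZ T a u : good T -> T (a *: u) = a *: T u.
Proof. by move=> gT; have := good_lin gT a u 0; rewrite (good0 gT) !addr0. Qed.

Lemma goodB T u v : good T -> T (u - v) = T u - T v.
Proof. by case=> lT _ _; have := lT (-1) v u; rewrite !scaleN1r addrC => ->; rewrite addrC. Qed.

Definition Mset : set (E -> E) := [set T | exists2 k, c0fun k & mult T k].

(** Cutting [u] off near [z] by a function on [Z] does not change T u at [z], because [T] commutes
    with the cut-off. As [u] vanishes at [z], the section that remains has arbitrarily small norm,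
    and [T] is bounded. *)
Lemma diag_local T : good T -> (forall S, Mset S -> T \o S = S \o T) ->
  forall u z, G0_sec u z = 0 -> G0_sec (T u) z = 0.
Proof.
move=> gT cT u z uz; have [lT [M M0 bT] _] := gT.
apply: lnrm_eq0; apply/eqP; rewrite eq_le lnrm_ge0 andbT.
apply/ler_addgt0Pr => e e0; rewrite add0r.
have [W [oW Wz] inj] := inj_nbhd z.
have nU : nbhs z (W `&` [set a | lnrm (G0_sec u a) < e / M]).
  apply: filterI; first exact: open_nbhs_nbhs.
  have /cvgrPdist_lt/(_ (e / M)) := lnrm_cont_at (G0_cont u z).
  rewrite divr_gt0// => /(_ isT); apply: filterS => a /=.
  by rewrite uz lnrm0 sub0r normrN ger0_norm// lnrm_ge0.
have [b [K [cb [_ KU] b01 b1 bK]]] := c0fun_bump R (@tc_Z_lc _ _ _ c) (@tc_Z_T2 _ _ _ c) nU.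
have E1 : G0_sec (T (Mop cb u)) z = G0_sec (T u) z.
  have := cT (Mop cb); move=> /(_ (ex_intro2 _ _ _ cb (mult_Mop cb))).
  move=> /(congr1 (fun f => f u)) /= ->; rewrite mult_Mop (nbhs_singleton b1) rC1.
  by rewrite scale1r.
rewrite -E1; apply: le_trans (lnrm_le_nx _ _) _.
apply: le_trans (fnorm_le_enorm lcX T2X s_surj _ _) _; apply: le_trans (bT _) _.
rewrite mulrC -ler_pdivlMr//; apply: enorm_le => // [|x]; first by rewrite divr_ge0 ?ltW.
have bz a : b a != 0 -> K a by move=> ba; apply: contrapT => /bK b0; move: ba; rewrite b0 eqxx.
apply: nx_le_single => [|a ax|a a' ax a'x]; first by rewrite divr_ge0 ?ltW.
  rewrite mult_Mop lnrmZ nc_rC; last by have /andP[] := b01 a.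
  have [->|/bz/KU[_ /= ua]] := eqVneq (b a) 0; first by rewrite mul0r divr_ge0 ?ltW.
  rewrite -[X in _ <= X]mul1r; apply: ler_pM; rewrite ?lnrm_ge0 ?(ltW ua)//; by have /andP[] := b01 a.
have supp d : G0_sec (Mop cb u) d <> 0 -> W d.
  rewrite mult_Mop => nd; have [b0|/bz/KU[]//] := eqVneq (b d) 0.
  by exfalso; apply: nd; rewrite b0 rC0 scale0r.
by move=> /supp Wa /supp Wa'; apply: inj => //; rewrite ax.
Qed.

(** By [diag_local], the value of T u at [z] depends only on u z, hence is a multiple of it. The
    factor is read off a unit section at [z]; near [z] the same section shows its continuity, and
    [good_van] its decay. *)
Lemma commutes_Mset T : compact_ops E T -> (forall S, Mset S -> T \o S = S \o T) -> Mset T.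
Proof.
move=> /compact_ops_good gT cT; have loc := diag_local gT cT.
have [lT _ vT] := gT.
have /choice[p pP] : forall z, exists p : E,
    [/\ h (G0_sec p z) (G0_sec p z) = 1, enorm p <= 1 &
        forall v : L z, v = h (G0_sec p z) v *: G0_sec p z].
  by move=> z; have [p [/nbhs_singleton[p1 pv] pe _ _]] := unit_section (@filterT _ (nbhs z) _); exists p.
pose t z := h (G0_sec (p z) z) (G0_sec (T (p z)) z).
have mT : mult T t.
  move=> u z; have [p1 _ pv] := pP z.
  have /loc : G0_sec (u - h (G0_sec (p z) z) (G0_sec u z) *: p z) z = 0.
    by rewrite secB secZ -(pv (G0_sec u z)) subrr.
  rewrite goodB//; have -> : T (h (G0_sec (p z) z) (G0_sec u z) *: p z) = h (G0_sec (p z) z) (G0_sec u z) *: T (p z).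
    exact: goodZ.
  move=> /eqP; rewrite secB secZ subr_eq0 => /eqP ->; rewrite /t [in RHS](pv (G0_sec u z)) scalerA mulrC -scalerA.
  by congr (_ *: _); exact: pv.
exists t => //; split.
  move=> z; have [q [q1 _ _ _]] := unit_section (@filterT _ (nbhs z) _).
  apply: (cont_at_near (f := fun a => h (G0_sec q a) (G0_sec (T q) a))).
    by apply: filterS q1 => a [qa _]; rewrite mT hZr qa mulr1.
  by apply: ip_cont_at; exact: G0_cont.
apply/vanishP => e e0; have e2 : 0 < e / 2 by rewrite divr_gt0.
have [K cK KT] := vT _ e2; exists K => // z nK.
have [p1 pe _] := pP z; apply: le_lt_trans (_ : e / 2 < e); last by lra.
have := KT z (p z) nK; rewrite mT lnrmZ (lnrm_unit p1) mulr1 => /le_trans; apply.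
by rewrite -[X in _ <= X]mulr1; apply: ler_wpM2l => //; exact: ltW.
Qed.

(** With [P] equality of germs this is the double commutant, and an upper bound for
    [cstar_iota_phi]. *)
Definition Arel (P : Z -> Z -> Prop) : set (E -> E) := [set T | exists k,
  [/\ c0fun k, mult T k & forall a b, P a b -> k a = k b]].

Lemma Mset_compact : Mset `<=` compact_ops E.
Proof. by move=> T [k ck mT]; exact: mult_compact ck mT. Qed.

(** A norm limit of multiplications is compact and still commutes with all of them, hence is a
    multiplication by [commutes_Mset]. No limit of symbols has to be constructed. *)
Lemma Mset_closed : norm_closure Mset `<=` Mset.
Proof.
move=> T cT; have kT : compact_ops E T.
  by apply: compact_ops_closed; apply: norm_closureS cT; exact: Mset_compact.
apply: commutes_Mset => // S MS; apply/funext => u /=.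
have gT := compact_ops_good kT; have gS := compact_ops_good (Mset_compact MS).
have [lS [M M0 bS] _] := gS.
apply/eqP; rewrite -subr_eq0; apply/eqP.
apply: (@small_eq0 _ (enorm (S u) + M * enorm u)) => e e0.
have [Q [k ck mQ] TQ] := cT e e0.
have QS : Q (S u) = S (Q u).
  have [l cl mS] := MS; apply: G0_inj => z.
  by rewrite mQ !mS mQ !scalerA mulrC.
have -> : T (S u) - S (T u) = (T (S u) - Q (S u)) - S (T u - Q u).
  by rewrite goodB// -QS opprB addrA subrK.
apply: le_trans (enormD lcX T2X s_surj _ _) _; rewrite mulrDr; apply: lerD => //.
apply: le_trans (enormN lcX T2X s_surj _) _; apply: le_trans (bS _) _.
by rewrite mulrCA ler_wpM2l// ltW.
Qed.

Lemma Arel_cstar (P : Z -> Z -> Prop) : cstar_subalgebra (Arel P).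
Proof.
split.
- by move=> T [k [ck mT _]]; exact: mult_compact ck mT.
- split; first by exists (fun=> 0); split => //; [exact: c0fun0|move=> u z; rewrite scale0r].
  move=> a T S [k [ck mT kP]] [l [cl mS lP]]; exists (fun z => a * k z + l z); split.
  + by apply: c0funD => //; exact: c0funZ.
  + exact: mult_lin.
  + by move=> z w zw; rewrite (kP z w)// (lP z w).
- move=> T S [k [ck mT kP]] [l [cl mS lP]]; exists (fun z => k z * l z); split.
  + exact: c0funM.
  + exact: mult_comp.
  + by move=> z w zw; rewrite (kP z w)// (lP z w).
- move=> T [k [ck mT kP]]; have ck' := c0fun_conj ck; exists (Mop ck').
    by exists (fun z => (k z)^*); split => // z w zw; rewrite (kP z w).
  exact: (mult_adjoint mT (mult_Mop ck')).
- move=> T cT; have [|k ck mT] := @Mset_closed T.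
    by apply: norm_closureS cT => S [l [cl mS _]]; exists l.
  exists k; split => // z w zw; apply/eqP; rewrite -subr_eq0 -nc_eq0 eq_le nc_ge0 andbT.
  apply/ler_addgt0Pr => e e0; rewrite add0r; have e2 : 0 < e / 2 by rewrite divr_gt0.
  have [S [l [cl mS lP]] TS] := cT _ e2.
  have B := mult_norm_bound (ltW e2) mT mS TS.
  have -> : k z - k w = (k z - l z) - (k w - l w) by rewrite (lP z w zw); ring.
  apply: le_trans (ncD _ _) _; rewrite ncN; have := B z; have := B w; lra.
Qed.

(** The common interface of both choices of D, on the level of symbols. Constants are absent, since
    D has no unit in general; bumps pulled back from [X] stand in for them. *)
Record symalg (H : set (Z -> C)) : Prop := Symalg {
  sa_c0 : forall k, H k -> c0fun k;
  sa_lin : forall a k l, H k -> H l -> H (fun z => a * k z + l z);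
  sa_mul : forall k l, H k -> H l -> H (fun z => k z * l z);
  sa_conj : forall k, H k -> H (fun z => (k z)^*);
  sa_s : forall f : X -> C, c0fun f -> H (fun z => f (s z));
  sa_r : forall g : Y -> C, c0fun g -> H (fun z => g (r z));
  sa_closed : forall k, (forall e : R, 0 < e -> exists2 l, H l &
    forall z, nc (k z - l z) <= e) -> H k;
  sa_germ : forall k z w, H k -> germ_eq z w -> k z = k w }.

Definition symbols (D : set (E -> E)) : set (Z -> C) :=
  [set k | exists2 T, D T & mult T k].

Lemma iota_Arel (P : Z -> Z -> Prop) (f : C0 R X) : (forall z w, P z w -> germ_eq z w) ->
  Arel P (iota_op (E := E) f).
Proof.
move=> Pg; exists (fun z => f (s z)); split.
- by apply: c0fun_s; exact: C0_c0fun.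
- exact: mult_iota.
- by move=> z w /Pg[-> _].
Qed.

Lemma phi_Arel (P : Z -> Z -> Prop) (g : C0 R Y) : (forall z w, P z w -> germ_eq z w) ->
  Arel P (phi_op (E := E) g).
Proof.
move=> Pg; exists (fun z => g (r z)); split.
- by apply: c0fun_r; exact: C0_c0fun.
- exact: mult_phi.
- by move=> z w /Pg/germ_eq_r ->.
Qed.

Lemma cstar_iota_phi_Arel : cstar_iota_phi E `<=` Arel (@germ_eq _ _ _ c c).
Proof.
apply: smallest_min; first exact: Arel_cstar.
by move=> T [[f _ <-]|[g _ <-]]; [exact: iota_Arel|exact: phi_Arel].
Qed.

(** An intersection of C*-subalgebras needs a single adjoint lying in all of them. It is the
    multiplication by the conjugate symbol, and adjoints are unique. Compactness of the elements
    comes from [Arel], one of the algebras intersected. *)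
Lemma cstar_iota_phi_cstar : cstar_subalgebra (cstar_iota_phi E).
Proof.
have A0 := cstar_iota_phi_Arel.
have sm : forall A, cstar_subalgebra A -> range (iota_op (E := E)) `|` range (phi_op (E := E)) `<=` A ->
  cstar_iota_phi E `<=` A by move=> A; exact: smallest_min.
split.
- by move=> T /A0; have [H _ _ _ _] := Arel_cstar (@germ_eq _ _ _ c c); exact: H.
- split; first by move=> W [[_ [W0 _] _ _ _] _].
  by move=> a T S hT hS W WP; have [[_ [_ Wl] _ _ _] _] := WP; apply: Wl; [exact: hT|exact: hS].
- by move=> T S hT hS W WP; have [[_ _ Wc _ _] _] := WP; apply: Wc; [exact: hT|exact: hS].
- move=> T hT; have [k [ck mT _]] := A0 T hT; have ck' := c0fun_conj ck.
  have adj := mult_adjoint mT (mult_Mop ck').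
  exists (Mop ck') => // W WP; have [[_ _ _ Wa _] _] := WP.
  by have [S WS TS] := Wa T (hT W WP); rewrite (adjoint_uniq adj TS).
- move=> T cT W WP; have [[_ _ _ _ Wc] _] := WP; apply: Wc.
  by apply: norm_closureS cT => S; apply.
Qed.

(* Two bumps p, q near z and w give the operator theta_{p,q} in the commutant,
   whose (z,w) entry is nonzero. *)
Lemma bicommutant_Arel : commutant (commutant (cstar_iota_phi E)) `<=` Arel (@germ_eq _ _ _ c c).
Proof.
move=> T [kT cT].
have MT : Mset T.
  apply: commutes_Mset => // S MS; apply: cT; split; first exact: Mset_compact.
  move=> Q /cstar_iota_phi_Arel[k [ck mQ _]]; have [l cl mS] := MS.
  apply/funext => u; apply: G0_inj => z /=.
  by rewrite mS !mQ mS !scalerA mulrC.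
have [k ck mT] := MT; exists k; split => // z w [szw [U [U' [Uz Uw UU]]]].
have [W oW WU] : exists2 W, open_nbhs z W & W `<=` U by move: Uz; rewrite nbhsE.
have [W' oW' WU'] : exists2 W', open_nbhs w W' & W' `<=` U' by move: Uw; rewrite nbhsE.
have Wz := open_nbhs_nbhs oW; have Ww := open_nbhs_nbhs oW'.
have [p [/nbhs_singleton[p1 _] _ pW _]] := unit_section Wz.
have [q [/nbhs_singleton[q1 _] _ qW qinj]] := unit_section Ww.
have com : commutant (cstar_iota_phi E) (theta p q).
  split; first exact: theta_compact.
  move=> S /cstar_iota_phi_Arel[l [cl mS lg]]; apply/funext => u; apply: G0_inj => a /=.
  (* theta_{p,q} links [b] to [a] only where q b and p a are nonzero. Such points have equal germs,
     so a symbol [l] from the algebra takes the same value at both and can be moved through the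
     sum. *)
  rewrite mS !theta_sec; have [pa|pa] := pselect (G0_sec p a = 0).
    by rewrite pa !scaler0.
  rewrite scalerA; congr (_ *: _); rewrite !fiber_ipE mulr_sumr.
  apply: eq_big_seq => b /mem_fib sb; rewrite mS hZr.
  have [qb|qb] := pselect (G0_sec q b = 0); first by rewrite qb !hl0 !mulr0.
  congr (_ * _); apply/esym/lg; split=> //; exists W, W'; split.
  - apply: open_nbhs_nbhs; split; first exact: oW.1.
    by apply: contrapT => /pW.
  - apply: open_nbhs_nbhs; split; first exact: oW'.1.
    by apply: contrapT => /qW.
  - by move=> d d' /WU Ud /WU' Ud'; exact: UU.
(* Commutation applied to [q] and read at [z] has k z on one side and k w on the other. *)
have /(congr1 (fun f => G0_sec (f q) z)) /= := cT _ com.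
rewrite mT !theta_sec szw.
have fw : fiber_ip (G0_sec q) (G0_sec q) (s w) = 1.
  rewrite (fip_single (z := w))// => b bw nb; left; apply: contrapT => qb; apply: nb.
  by apply: qinj => // qw0; move: q1; rewrite qw0 hl0 => /eqP; rewrite eq_sym oner_eq0.
have -> : fiber_ip (G0_sec q) (G0_sec (T q)) (s w) = k w * fiber_ip (G0_sec q) (G0_sec q) (s w).
  rewrite (fip_single (z := w)) ?mT ?hZr//; last first.
    move=> b bw nb; left; apply: contrapT => qb; apply: nb.
    by apply: qinj => // qw0; move: q1; rewrite qw0 hl0 => /eqP; rewrite eq_sym oner_eq0.
  by rewrite q1 fw.
rewrite fw !mulr1 scale1r => /(congr1 (h (G0_sec p z))).
by rewrite !hZr p1 !mulr1.
Qed.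

Lemma sec_ne0 (u : sections L) z : sec_cont_at u z -> u z <> 0 -> \forall a \near z, u a <> 0.
Proof.
move=> cu uz; have u0 : 0 < lnrm (u z).
  by rewrite lt_def lnrm_ge0 andbT; apply/eqP => /lnrm_eq0.
have /cvgrPdist_lt/(_ _ u0) := lnrm_cont_at cu; apply: filterS => a H ua.
by move: H; rewrite ua lnrm0 subr0 gtr0_norm ?ltxx.
Qed.

(** The argument of [diag_local] with cut-offs from [X] in place of [Z]: an operator commuting with
    C_0(X) acts on each fiber of E separately. *)
Lemma bicommutant_local T : good T -> (forall f, T \o iota_op f = iota_op f \o T) ->
  forall u x, (forall z, s z = x -> G0_sec u z = 0) -> forall z, s z = x -> G0_sec (T u) z = 0.
Proof.
move=> gT cT u x ux; have [lT [M M0 bT] _] := gT.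
apply/(nx_eq0 (G0_sec (T u)) x); apply/eqP; rewrite eq_le nx_ge0 andbT.
apply/ler_addgt0Pr => e e0; rewrite add0r.
have nU : nbhs x [set y | nx (G0_sec u) y < e / M].
  have /cvgrPdist_lt/(_ (e / M)) := nx_cont_at lcX T2X s_surj (x := x) (G0_cont u).
  rewrite divr_gt0// => /(_ isT); apply: filterS => a /=.
  have -> : nx (G0_sec u) x = 0 by apply/nx_eq0.
  by rewrite sub0r normrN ger0_norm// nx_ge0.
have [b [K [cb [_ KU] b01 b1 bK]]] := c0fun_bump R lcX T2X nU.
have -> : nx (G0_sec (T u)) x = nx (G0_sec (T (iota_op (mkC0 cb) u))) x.
  apply: nx_eq => z zx; have /(congr1 (fun f => G0_sec (f u) z)) /= -> := cT (mkC0 cb).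
  by rewrite /= zx (nbhs_singleton b1) rC1 scale1r.
apply: le_trans (fnorm_le_enorm lcX T2X s_surj _ _) _; apply: le_trans (bT _) _.
rewrite mulrC -ler_pdivlMr//; apply: enorm_le => // [|y]; first by rewrite divr_ge0 ?ltW.
have [Ky|/bK by0] := pselect (K y).
  apply: le_trans (_ : 1 * nx (G0_sec u) y <= _); last by rewrite mul1r ltW//; exact: KU.
  apply: (@nx_scale_le _ _ (fun z => rC (b (s z)))) => // z _.
  by have /andP[? ?] := b01 (s z); rewrite nc_rC.
rewrite (_ : nx _ y = 0) ?divr_ge0 ?ltW//; apply/nx_eq0 => z zy.
by rewrite mult_iota /= zy by0 rC0 scale0r.
Qed.

(** An operator [T] commuting with C_0(X) and C_0(Y) has zero entries between points with different
    germs. Since Q u - k(z)u vanishes at all points with the germ of [z], its image under [T]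
    vanishes at [z]. *)
Lemma Arel_bicommutant (lcY : locally_compact [set: Y]) (T2Y : hausdorff_space Y) :
  Arel (@germ_eq _ _ _ c c) `<=` commutant (commutant (cstar_iota_phi E)).
Proof.
move=> Q [k [ck mQ kg]]; split; first exact: mult_compact ck mQ.
move=> T [kT cT]; have gT := compact_ops_good kT.
have cI f : T \o iota_op f = iota_op f \o T.
  by apply: cT => W [_]; apply; left; exists f.
have cP g : T \o phi_op g = phi_op g \o T.
  by apply: cT => W [_]; apply; right; exists g.
have loc := bicommutant_local gT cI.
(* If T p were nonzero at [z], it would be so near [z]. A function [g] on [Y] equal to 1 at r a and
   0 at r b would then kill [p] over s a but keep T p at [a]; so [r] agrees along both sheets. *)
have single p w z : s w = s z -> ~ germ_eq z w ->
    (exists2 W, nbhs w W & (forall a, ~ W a -> G0_sec p a = 0) /\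
      forall a b, W a -> W b -> s a = s b -> a = b) -> G0_sec (T p) z = 0.
  move=> wz ng [W Ww [pW inj]]; apply: contrapT => Tpz; apply: ng; split => //.
  exists [set a | G0_sec (T p) a <> 0], W; split => //.
    by apply: sec_ne0 => //; exact: G0_cont.
  move=> a b /= Tpa Wb ab; apply: contrapT => nr; apply: Tpa.
  have [g [g1 g0]] := C0_separates R lcY T2Y nr.
  have : G0_sec (T (phi_op g p)) a = 0.
    apply: (loc _ (s a)) => // d da; rewrite mult_phi.
    have [Wd|/pW ->] := pselect (W d); last by rewrite scaler0.
    by rewrite (inj d b) ?g0 ?scale0r// da.
  have /(congr1 (fun f => G0_sec (f p) a)) /= -> := cP g.
  by rewrite /= -/(G0_sec (T p) a) g1 scale1r.
apply/funext => u; apply: G0_inj => z /=; rewrite mQ.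
apply/eqP; rewrite eq_sym -subr_eq0 -secZ -(goodZ _ _ gT) -secB -goodB//; apply/eqP.
set v := Q u - k z *: u.
have vz w : germ_eq z w -> G0_sec v w = 0.
  by move=> zw; rewrite secB secZ mQ (kg z w zw) subrr.
(* The points of the fiber where [v] may be nonzero are listed in [l] and removed one by one, each
   by subtracting a section on its own sheet, which [single] shows to be harmless. *)
have H (l : seq Z) : forall v, (forall w, germ_eq z w -> G0_sec v w = 0) ->
    (forall w, s w = s z -> w \notin l -> G0_sec v w = 0) -> G0_sec (T v) z = 0.
  elim: l => [|w l IH] {vz}v vz vl; first by apply: (loc v (s z)) => // w wz; exact: vl.
  have [[wz ng]|gw] := pselect (s w = s z /\ ~ germ_eq z w); last first.
    apply: IH => // b bz bl; have [bw|bw] := eqVneq b w; last first.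
      by apply: vl => //; rewrite inE negb_or bw.
    by apply: vz; apply: contrapT => ng; apply: gw; rewrite -bw.
  have [W oW inj] := inj_nbhd w; have Ww := open_nbhs_nbhs oW.
  have [p [pw pW]] := section_at (G0_sec v w) Ww.
  have Tp : G0_sec (T p) z = 0 by apply: single wz ng _; exists W.
  have -> : T v = T (v - p) + T p by rewrite -goodD// subrK.
  rewrite secD Tp addr0; apply: IH => [b zb|b bz bl]; rewrite secB.
    rewrite vz// pW ?subrr// => Wb; apply: ng; rewrite (inj w b)//.
      exact: oW.2.
    by rewrite wz; have [] := zb.
  have [->|bw] := eqVneq b w; first by rewrite pw subrr.
  rewrite vl ?inE ?negb_or ?bw// pW ?subrr// => Wb; move/eqP: bw; apply.
  by apply: inj => //; [exact: oW.2|rewrite bz].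
have := H (fib c (s z)) v vz; apply => w wz.
by move=> /negP; case; apply/mem_fib.
Qed.

Lemma symbols_symalg (D : set (E -> E)) : cstar_subalgebra D ->
  D `<=` Arel (@germ_eq _ _ _ c c) -> range (iota_op (E := E)) `|` range (phi_op (E := E)) `<=` D ->
  symalg (symbols D).
Proof.
move=> [Dc [D0 Dl] DM Da Dcl] DA DI; split.
- by move=> k [T /DA[l [cl mT' _]] mT]; apply: eq_c0fun cl => z; rewrite (mult_uniq mT mT').
- move=> a k l [T DT mT] [S DS mS]; exists (a *: T + S); first exact: Dl.
  exact: mult_lin.
- by move=> k l [T DT mT] [S DS mS]; exists (T \o S); [exact: DM|exact: mult_comp].
- move=> k [T DT mT]; have [S DS TS] := Da T DT; exists S => //.
  have [l [cl mT' _]] := DA T DT; have ck : c0fun k by apply: eq_c0fun cl => z; rewrite (mult_uniq mT mT').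
  rewrite (adjoint_uniq TS (mult_adjoint mT (mult_Mop (c0fun_conj ck)))).
  exact: mult_Mop.
- move=> f cf; exists (iota_op (mkC0 cf)); last exact: mult_iota.
  by apply: DI; left; exists (mkC0 cf).
- move=> g cg; exists (phi_op (mkC0 cg)); last exact: mult_phi.
  by apply: DI; right; exists (mkC0 cg).
- move=> k H; have ck : c0fun k.
    apply: c0fun_lim => e e0; have [l [T /DA[l' [cl mT' _]] mT] kl] := H e e0.
    by exists l => //; apply: eq_c0fun cl => z; rewrite (mult_uniq mT mT').
  exists (Mop ck); last exact: mult_Mop.
  apply: Dcl => e e0; have [l [T DT mT] kl] := H e e0; exists T => // u.
  apply: (mult_enorm_le (k := fun z => k z - l z)) => //; first exact: ltW.
  by move=> z; exact: mult_sub.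
- move=> k z w [T /DA[l [_ mT' lg]] mT] zw.
  by rewrite !(mult_uniq mT mT') (lg z w zw).
Qed.

End Ops.

(** * Characters of the algebra of symbols *)

Lemma geom_small (R : realType) (q e : R) : 0 <= q -> q < 1 -> 0 < e ->
  exists N, q ^+ N < e.
Proof.
move=> q0 q1 e0; have : (GRing.exp q) @ \oo --> (0 : R) by apply: cvg_expr; rewrite ger0_norm.
move=> /cvgrPdist_lt/(_ e e0)[N _ HN]; exists N; have := HN N (leqnn N).
by rewrite /= sub0r normrN ger0_norm// exprn_ge0.
Qed.

Section Characters.
Variables (R : realType) (X Y : topologicalType) (c : tcorr R Y X).
Hypotheses (lcX : locally_compact [set: X]) (T2X : hausdorff_space X).
Notation C := (cplx R).
Notation Z := (tc_Z c).
Notation s := (@tc_s R Y X c).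
Variable H : set (Z -> C).
Hypothesis sH : symalg H.
Implicit Types (k l : Z -> C) (z w : Z).

Lemma sa_D k l : H k -> H l -> H (fun z => k z + l z).
Proof.
move=> Hk Hl; have := sa_lin sH 1 Hk Hl.
by rewrite (_ : (fun z => 1 * k z + l z) = fun z => k z + l z)//; apply/funext => z; rewrite mul1r.
Qed.

Lemma sa_bump z : exists2 k, H k & k z = 1.
Proof.
have [b [K [cb _ _ b1 _]]] := c0fun_bump R lcX T2X (@filterT _ (nbhs (s z)) _).
exists (fun w => rC (b (s w))); first exact: (sa_s sH cb).
by rewrite (nbhs_singleton b1).
Qed.

Lemma sa_0 : H (fun=> 0).
Proof. by have := sa_s sH (c0fun0 R X). Qed.

Lemma sa_Z a k : H k -> H (fun z => a * k z).
Proof.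
move=> Hk; have := sa_lin sH a Hk sa_0.
by rewrite (_ : (fun z => a * k z + 0) = fun z => a * k z)//; apply/funext => z; rewrite addr0.
Qed.

Section Character.
Variable chi : (Z -> C) -> C.
Hypothesis chi_lin : forall a k l, H k -> H l -> chi (fun z => a * k z + l z) = a * chi k + chi l.
Hypothesis chi_mul : forall k l, H k -> H l -> chi (fun z => k z * l z) = chi k * chi l.
Hypothesis chi_n0 : exists2 k, H k & chi k != 0.

Lemma chi0 : chi (fun=> 0) = 0.
Proof.
have := chi_lin (-1) sa_0 sa_0; rewrite (_ : (fun z => -1 * 0 + 0) = fun=> 0).
  by move=> ->; ring.
by apply/funext => z; rewrite mulr0 addr0.
Qed.

Lemma chiD k l : H k -> H l -> chi (fun z => k z + l z) = chi k + chi l.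
Proof.
move=> Hk Hl; have := chi_lin 1 Hk Hl; rewrite mul1r => <-; congr chi.
by apply/funext => z; rewrite mul1r.
Qed.

Lemma chiZ a k : H k -> chi (fun z => a * k z) = a * chi k.
Proof.
move=> Hk; have := chi_lin a Hk sa_0; rewrite chi0 addr0 => <-; congr chi.
by apply/funext => z; rewrite addr0.
Qed.

(* k / (1 - k) is the sum of the geometric series, which lies in H. *)
Lemma chi_contract k (q : R) : H k -> 0 <= q -> q < 1 -> (forall z, nc (k z) <= q) -> chi k != 1.
Proof.
move=> Hk q0 q1 kq; pose K z := k z / (1 - k z).
have d0 z : 1 - q <= nc (1 - k z).
  by have := ncB 1 (k z); rewrite nc1; have := kq z; lra.
have n0 z : 1 - k z != 0.
  by rewrite -nc_eq0 gt_eqF//; have := d0 z; lra.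
have KE z : K z = k z + k z * K z by rewrite /K; field.
have HK : H K.
  apply: (sa_closed sH) => e e0.
  have [|N Nq] := geom_small q0 q1 (e := e * (1 - q)); first by rewrite mulr_gt0// subr_gt0.
  suff H1 M : exists2 l, H l & forall z, nc (K z - l z) <= q ^+ M / (1 - q).
    have [l Hl lN] := H1 N; exists l => // z; apply: le_trans (lN z) _.
    by rewrite ler_pdivrMr ?subr_gt0// ltW.
  elim: M => [|M [l Hl lM]].
    exists k => // z; rewrite expr0 mul1r.
    have -> : K z - k z = k z * (k z / (1 - k z)) by rewrite /K; field.
    rewrite !ncM ncV; apply: le_trans (_ : 1 * (1 * (1 - q)^-1) <= _); last by rewrite !mul1r.
    have k1 : nc (k z) <= 1 by have := kq z; lra.
    apply: ler_pM; rewrite ?nc_ge0 ?mulr_ge0 ?invr_ge0 ?nc_ge0//.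
    apply: ler_pM; rewrite ?invr_ge0 ?nc_ge0//.
    by rewrite lef_pV2// posrE ?subr_gt0//; have := d0 z; lra.
  exists (fun z => k z + k z * l z); first by apply: sa_D => //; exact: (sa_mul sH).
  move=> z; have -> : K z - (k z + k z * l z) = k z * (K z - l z) by rewrite {1}KE; ring.
  by rewrite ncM exprS -mulrA; apply: ler_pM; rewrite ?nc_ge0.
apply/eqP => k1; have HkK := sa_mul sH Hk HK.
have : chi K = chi k + chi k * chi K.
  by rewrite -chi_mul// -chiD//; congr chi; apply/funext.
rewrite k1 mul1r => /eqP; rewrite -subr_eq0 opprD addrCA subrr addr0 oppr_eq0.
by rewrite oner_eq0.
Qed.

Lemma chi_unit : exists2 e, H e & chi e = 1.
Proof.
have [k Hk k0] := chi_n0; exists (fun z => (chi k)^-1 * k z); first exact: sa_Z.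
by rewrite chiZ// mulVf.
Qed.

(** Otherwise the kernel of [chi] lies in that of evaluation at [z], so evaluation is a multiple of
    [chi]. Multiplicativity on a symbol equal to 1 at [z] forces the factor to be 1. *)
Lemma chi_ker_point z : (exists2 k, H k & chi k != k z) ->
  exists k, [/\ H k, chi k = 0 & k z != 0].
Proof.
move=> [k Hk kz]; apply: contrapT => nk.
have van l : H l -> chi l = 0 -> l z = 0.
  by move=> Hl l0; apply: contrapT => /eqP lz; apply: nk; exists l.
have [e He e1] := chi_unit.
have dE l : H l -> l z = chi l * e z.
  move=> Hl; have := van (fun z => (- chi l) * e z + l z).
  rewrite (chi_lin _ He Hl) e1 mulr1 addNr => /(_ (sa_lin sH _ He Hl) erefl)/eqP.
  by rewrite mulNr addrC subr_eq0 => /eqP.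
have [f Hf f1] := sa_bump z.
have a1 := dE f Hf; have a2 := dE _ (sa_mul sH Hf Hf).
rewrite chi_mul// f1 mulr1 in a2; rewrite f1 in a1.
have f0 : chi f = 1.
  by move: a2; rewrite -mulrA -a1 mulr1.
by move: kz; rewrite (dE k Hk) -[e z]mul1r -f0 -a1 mulr1 eqxx.
Qed.

(** If [chi] were no evaluation, compactness would yield g >= 0 in its kernel bounded below on [K],
    where the symbol [e] with chi e = 1 may be large. Multiplying [e] by powers of 1 - tg keeps the
    value of [chi] but pushes the sup norm down to 1/2, against [chi_contract]. *)
Lemma chi_ev : exists z, forall k, H k -> chi k = k z.
Proof.
apply: contrapT => nz.
have kp z : exists k, [/\ H k, chi k = 0 & k z != 0].
  apply: chi_ker_point; apply: contrapT => nk; apply: nz; exists z => k Hk.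
  by apply: contrapT => /eqP kz; apply: nk; exists k.
have [e He e1] := chi_unit; have ce := sa_c0 sH He.
have [Me Me0 eM] := c0fun_bounded ce.
have [_ /vanishP/(_ 2^-1)] := ce; rewrite invr_gt0 => /(_ (ltr0Sn _ 1))[K cK eK].
pose P (A : set Z) := exists g : Z -> R, exists2 d : R, 0 < d &
  [/\ H (fun z => rC (g z)), chi (fun z => rC (g z)) = 0, forall z, 0 <= g z &
      forall z, A z -> d <= g z].
have [g [d d0 [Hg chig g0 gd]]] : P K.
  apply: compact_ind cK _ _ _ _.
  - by exists (fun=> 0), 1 => //; split => //; [exact: sa_0|exact: chi0].
  - move=> A B [g [d d0 [Hg chig g0 gd]]] [g' [d' d'0 [Hg' chig' g'0 gd']]].
    exists (fun z => g z + g' z), (Num.min d d'); first by rewrite lt_min d0.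
    have E : (fun z => rC (g z + g' z)) = (fun z => rC (g z) + rC (g' z)) :> (Z -> C).
      by apply/funext => z; rewrite rCD.
    split.
    + by rewrite E; exact: sa_D.
    + by rewrite E chiD// chig chig' addr0.
    + by move=> z; rewrite addr_ge0.
    + move=> z [/gd|/gd'] gz; rewrite ge_min.
        by rewrite (le_trans gz)// lerDl.
      by rewrite (le_trans gz) ?orbT// lerDr.
  - by move=> A B AB [g [d d0 [Hg chig g0 gd]]]; exists g, d => //; split => // z /AB; exact: gd.
  - move=> z Kz; have [k [Hk k0 kz]] := kp z.
    pose g a := nc (k a) ^+ 2; have gz : 0 < g z.
      by rewrite exprn_gt0// lt_def nc_eq0 kz nc_ge0.
    have E : (fun z => rC (g z)) = (fun z => (k z)^* * k z).
      by apply/funext => a; rewrite nc_sqr.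
    exists [set a | g z / 2 < g a]; last first.
      exists g, (g z / 2); first by rewrite divr_gt0.
      split.
      + by rewrite E; apply: (sa_mul sH) => //; exact: (sa_conj sH).
      + by rewrite E chi_mul//; [rewrite k0 mulr0|exact: (sa_conj sH)].
      + by move=> a; rewrite exprn_ge0 ?nc_ge0.
      + by move=> a /ltW.
    have ck : cont_at (fun a => re (rC (g a) : C)) z.
      apply: cont_at_re; rewrite E; apply: cont_atM; last exact: (sa_c0 sH Hk).1.
      by apply: cont_at_conj; exact: (sa_c0 sH Hk).1.
    have /cvgrPdist_lt/(_ (g z / 2)) := ck; rewrite divr_gt0// => /(_ isT).
    apply: filterS => a /= ga; have := le_lt_trans (ler_norm _) ga; lra.
have [M M0 gM] := c0fun_bounded (sa_c0 sH Hg).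
have {}gM z : g z <= M by have := gM z; rewrite nc_rC.
(* Adding [d] to the bound of [g] ensures both 0 <= 1 - tg <= 1 everywhere and 0 <= 1 - td < 1, even
   when [K] is empty. *)
pose M' := M + d; have M'0 : 0 < M' by rewrite addr_gt0.
pose t := M'^-1; have t0 : 0 < t by rewrite invr_gt0.
have tg z : 0 <= 1 - t * g z <= 1.
  rewrite gerBl subr_ge0 mulr_ge0 ?(ltW t0)// andbT mulrC ler_pdivrMr// mul1r.
  by have := gM z; rewrite /M'; lra.
have td : 0 <= 1 - t * d < 1.
  rewrite ltrBlDr ltrDl mulr_gt0// andbT subr_ge0 mulrC ler_pdivrMr// mul1r /M'.
  by rewrite lerDr ltW.
(* The factor [e] keeps this in H, which need not contain 1: each step only subtracts t g times the
   previous term, an element of the kernel of [chi]. *)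
pose en N z : C := e z * rC (1 - t * g z) ^+ N.
have en1 N : H (en N) /\ chi (en N) = 1.
  elim: N => [|N [Hn n1]].
    by rewrite (_ : en 0%N = e)//; apply/funext => z; rewrite /en expr0 mulr1.
  have E : en N.+1 = (fun z => - rC t * (rC (g z) * en N z) + en N z).
    apply/funext => z; rewrite /en exprS rCB rCM rC1; ring.
  rewrite E; have HgN := sa_mul sH Hg Hn; split; first exact: (sa_lin sH).
  by rewrite chi_lin// chi_mul// chig n1 mul0r mulr0 add0r.
have [td0 td1] := andP td.
have Me2 : 0 < 2^-1 / Me by rewrite divr_gt0// invr_gt0.
have [N Nq] := geom_small td0 td1 Me2.
have [HN chiN] := en1 N.
suff : chi (en N) != 1 by rewrite chiN eqxx.
apply: (@chi_contract _ 2^-1) => //.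
- lra.
- move=> z; have /andP[tg0 tg1] := tg z; rewrite /en ncM ncX nc_rC//.
  have [Kz|/eK/ltW ez] := pselect (K z); last first.
    apply: le_trans ez; rewrite -[X in _ <= X]mulr1; apply: ler_wpM2l; first exact: nc_ge0.
    by rewrite exprn_ile1.
  have -> : 2^-1 = Me * (2^-1 / Me) by rewrite mulrC divfK// gt_eqF.
  apply: ler_pM; rewrite ?nc_ge0 ?exprn_ge0//; apply: le_trans (ltW Nq).
  apply: lerXn2r; rewrite ?nnegrE//.
  by rewrite lerD2l lerN2 ler_pM2l// gd.
Qed.

End Character.

(** The classes of this relation are the points of the spectrum of D, by [at_point_eqv]. *)
Definition eqv z w : Prop := s z = s w /\ forall k, H k -> k z = k w.

Lemma eqv_refl z : eqv z z. Proof. by []. Qed.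
Lemma eqv_sym z w : eqv z w -> eqv w z.
Proof. by move=> [sw zw]; split => // k Hk; rewrite zw. Qed.
Lemma eqv_trans w z v : eqv z w -> eqv w v -> eqv z v.
Proof. by move=> [s1 k1] [s2 k2]; split; [rewrite s1|move=> k Hk; rewrite k1// k2]. Qed.

(** Lagrange interpolation over the finite fiber: one factor (m - m(w)f)/(m(z) - m(w)) for each
    inequivalent [w], where the bump [f] from [X] replaces the constant 1. The result is a symbol
    lifting p_z. *)
Lemma interpolation z : exists k, [/\ H k, k z = 1 &
  forall w, s w = s z -> ~ eqv z w -> k w = 0].
Proof.
suff Hl (l : seq Z) : exists k, [/\ H k, k z = 1 &
    forall w, w \in l -> s w = s z -> ~ eqv z w -> k w = 0].
  have [k [Hk k1 k0]] := Hl (fib c (s z)); exists k; split => // w wz.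
  by apply: k0 => //; exact/mem_fib.
elim: l => [|w l [k [Hk k1 k0]]]; first by have [k Hk k1] := sa_bump z; exists k.
have [sep|nsep] := pselect (s w = s z /\ ~ eqv z w); last first.
  exists k; split => // v; rewrite inE => /orP[/eqP -> wz nvw|]; last exact: k0.
  by exfalso; apply: nsep.
have [sw nzw] := sep.
have [m Hm mzw] : exists2 m, H m & m z != m w.
  apply: contrapT => nm; apply: nzw; split => // m Hm; apply: contrapT => /eqP zw.
  by apply: nm; exists m.
have [b [K [cb _ _ b1 _]]] := c0fun_bump R lcX T2X (@filterT _ (nbhs (s z)) _).
pose f v := rC (b (s v)) : C.
have Hf : H f by exact: (sa_s sH cb).
have fz : f z = 1 by rewrite /f (nbhs_singleton b1).
have fw : f w = 1 by rewrite /f sw (nbhs_singleton b1).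
exists (fun v => k v * ((m z - m w)^-1 * (- m w * f v + m v))); split.
- by apply: (sa_mul sH) => //; apply: sa_Z; exact: (sa_lin sH).
- by rewrite k1 fz mul1r mulr1 (addrC (- m w)) mulVf// subr_eq0.
- move=> v; rewrite inE => /orP[/eqP -> _ _|vl vz nzv]; last by rewrite k0// mul0r.
  by rewrite fw mulr1 addNr !mulr0.
Qed.

End Characters.

(** * Fibers of E as restrictions of sections *)

Section Fibers.
Variables (R : realType) (X Y : topologicalType) (c : tcorr R Y X).
Notation C := (cplx R).
Notation Z := (tc_Z c).
Notation s := (@tc_s R Y X c).
Notation E := (Gamma0_corr c).
Variable Q : set X.
Implicit Types (q : restr E Q) (u v : E) (z : Z).

Lemma lspan_vanishing u : lspan (vanishing_on (E := E) Q) u <->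
  forall z, Q (s z) -> G0_sec u z = 0.
Proof.
split=> [|u0 W [_]]; last first.
  by apply => x Qx; rewrite -[ip u u x]/(fiber_ip (G0_sec u) (G0_sec u) x) -nx_sqr (_ : nx _ x = 0) ?expr0n// nx_eq0 => z zx; apply: u0; rewrite zx.
apply: (@smallest_min _ _ _ [set u : E | forall z, Q (s z) -> G0_sec u z = 0]).
  split=> [z _|a {}u v u0 v0 z Qz]; first by [].
  by rewrite secD secZ u0// v0// scaler0 addr0.
move=> {}u u0 z Qz; apply: (nx_eq0 (G0_sec u) (s z)).1 => //.
have := u0 _ Qz; rewrite -[ip u u (s z)]/(fiber_ip _ _ _) -nx_sqr -rC0 => /rC_inj/eqP.
by rewrite expf_eq0/= => /eqP.
Qed.

Lemma lclass_eq u v : lclass (vanishing_on (E := E) Q) u = lclass _ v <->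
  forall z, Q (s z) -> G0_sec u z = G0_sec v z.
Proof.
rewrite lclassP lspan_vanishing; split=> uv z Qz.
  by apply/eqP; rewrite -subr_eq0 -secB uv.
by rewrite secB uv// subrr.
Qed.

(** The representative is an arbitrary choice, so the value has a meaning for [z] over [Q] only. *)
Definition rsec q z := G0_sec (lrepr q) z.

Lemma rsec_class u z : Q (s z) -> rsec (lclass (vanishing_on (E := E) Q) u) z = G0_sec u z.
Proof. by move: z; apply/lclass_eq; exact: lreprK. Qed.

Lemma rsecD q q' z : Q (s z) -> rsec (q + q') z = rsec q z + rsec q' z.
Proof.
move=> Qz; rewrite -[in LHS](lreprK q) -[in LHS](lreprK q') -lclassD rsec_class//.
Qed.

Lemma rsecZ (a : C) q z : Q (s z) -> rsec (a *: q) z = a *: rsec q z.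
Proof. by move=> Qz; rewrite -[in LHS](lreprK q) [X in rsec X](lclassZ (vanishing_on (E := E) Q) a (lrepr q)) rsec_class. Qed.

Lemma rsec0 z : Q (s z) -> rsec 0 z = 0.
Proof. by move=> Qz; have := rsecZ 0 0 Qz; rewrite !scale0r. Qed.

Lemma rsec_eq q q' : q = q' <-> forall z, Q (s z) -> rsec q z = rsec q' z.
Proof.
split=> [->//|qq]; rewrite -(lreprK q) -(lreprK q'); apply/lclass_eq => z Qz.
exact: qq.
Qed.

Lemma rsec_op (T : E -> E) k q z : mult T k -> Q (s z) -> rsec (restr_op (Q := Q) T q) z = k z *: rsec q z.
Proof. by move=> mT Qz; rewrite /restr_op rsec_class// mT. Qed.

Lemma rsec_sum (I : Type) (l : seq I) (f : I -> restr E Q) z : Q (s z) ->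
  rsec (\sum_(i <- l) f i) z = \sum_(i <- l) rsec (f i) z.
Proof.
move=> Qz; elim: l => [|i l IH]; first by rewrite !big_nil rsec0.
by rewrite !big_cons rsecD// IH.
Qed.

End Fibers.

Lemma ker_vector (K : fieldType) m n (M : 'M[K]_(m, n)) : (n < m)%N ->
  exists2 v : 'rV[K]_m, v != 0 & v *m M = 0.
Proof.
move=> nm; have : kermx M != 0.
  rewrite kermx_eq0 /row_free neq_ltn; apply/orP; left.
  exact: leq_ltn_trans (rank_leq_col M) nm.
by move=> /rowV0Pn[v /sub_kermxP vM v0]; exists v.
Qed.

(** * A cubic iteration that produces idempotents *)

Section Cubic.
Variable R : realType.
Notation C := (cplx R).

(* 0 and 1 are superattracting fixed points. *)
Definition cub (t : C) : C := 3 * (t * t) + - 2 * (t * (t * t)).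

Lemma cub1B t : cub (1 - t) = 1 - cub t. Proof. rewrite /cub; ring. Qed.

(** 3M^2 + 2M^3 <= (3/6 + 2/36)M, and the factor is 5/9. *)
Lemma cub_small t (M : R) : nc t <= M -> M <= 6^-1 -> nc (cub t) <= 5 / 9 * M.
Proof.
move=> tM M6; have t0 := nc_ge0 t.
have nat_nc (n : nat) : nc (n%:R : C) = n%:R.
  by rewrite -[n%:R](rmorph_nat (real_complex R)) nc_rC.
apply: le_trans (ncD _ _) _; rewrite !ncM ncN !nat_nc.
have M0 : 0 <= M by lra.
have A : nc t * nc t <= M * M by apply: ler_pM.
have B : nc t * (nc t * nc t) <= M * (M * M) by apply: ler_pM => //; rewrite mulr_ge0.
have A1 : M * M <= 6^-1 * M by apply: ler_wpM2r.
have A2 : M * (M * M) <= 6^-1 * (6^-1 * M).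
  by rewrite mulrA [X in _ <= X](_ : _ = 6^-1 * M * 6^-1); [apply: ler_pM => //; rewrite mulr_ge0|ring].
lra.
Qed.

(** The symmetry [cub1B] reduces convergence to 1 to convergence to 0. *)
Lemma iter_cub (t : C) (b : bool) N : nc (t - b%:R) <= 6^-1 ->
  nc (iter N cub t - b%:R) <= (5 / 9) ^+ N * 6^-1.
Proof.
case: b => /= H.
  have {}H : nc (1 - t) <= 6^-1 by rewrite nc_dist.
  suff [H1 _] : nc (1 - iter N cub t) <= (5 / 9) ^+ N * 6^-1 /\ (5 / 9 : R) ^+ N * 6^-1 <= 6^-1.
    by rewrite nc_dist.
  elim: N => [|N [IH1 IH2]] /=; first by rewrite expr0 mul1r.
  rewrite -cub1B exprS -mulrA; split; first exact: cub_small.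
  have : 0 <= (5 / 9 : R) ^+ N * 6^-1 by rewrite mulr_ge0 ?exprn_ge0 ?invr_ge0 ?divr_ge0.
  lra.
rewrite subr0 in H; rewrite subr0.
suff [] : nc (iter N cub t) <= (5 / 9) ^+ N * 6^-1 /\ (5 / 9 : R) ^+ N * 6^-1 <= 6^-1 by [].
elim: N => [|N [IH1 IH2]] /=; first by rewrite expr0 mul1r.
rewrite exprS -mulrA; split; first exact: cub_small.
have : 0 <= (5 / 9 : R) ^+ N * 6^-1 by rewrite mulr_ge0 ?exprn_ge0 ?invr_ge0 ?divr_ge0.
lra.
Qed.

End Cubic.

(** * Constant rank *)

Section Rank.
Variables (R : realType) (X Y : topologicalType) (c : tcorr R Y X).
Hypotheses (lcX : locally_compact [set: X]) (T2X : hausdorff_space X).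
Hypothesis s_surj : range (@tc_s R Y X c) = [set: X].
Notation C := (cplx R).
Notation Z := (tc_Z c).
Notation s := (@tc_s R Y X c).
Notation E := (Gamma0_corr c).
Variable D : set (E -> E).
Notation H := (symbols D).
Hypothesis sH : symalg H.
Hypothesis DM : forall T, D T -> exists k, mult T k.
Implicit Types (k l : Z -> C) (z w : Z).

Definition independent x m (w : 'I_m -> Z) : Prop :=
  (forall i, s (w i) = x) /\ forall i j, eqv H (w i) (w j) -> i = j.

Lemma symbolsW T k : D T -> mult T k -> H k. Proof. by exists T. Qed.

Lemma independent_dual x m (w : 'I_m -> Z) : independent x w ->
  exists k : 'I_m -> Z -> C, (forall i, H (k i)) /\ forall i z, s z = x ->
    (eqv H (w i) z -> k i z = 1) /\ (~ eqv H (w i) z -> k i z = 0).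
Proof.
move=> [wx wi]; have /choice[k kP] := fun i => interpolation lcX T2X sH (w i).
exists k; split=> [i|i z zx]; first by have [] := kP i.
have [Hk k1 k0] := kP i; split=> [[_ <-//]|nw]; apply: k0 => //.
by rewrite wx.
Qed.

Section HasDim.
Variables (x : X) (n : nat).
Hypothesis dimn : has_dim (restr_op (E := E) (Q := [set x]) @` D) n.

(** The symbols dual to the points give linearly independent operators in D_x: a relation between
    them, tested on a unit section at w i, loses every term but the i-th. *)
Lemma independent_le m (w : 'I_m -> Z) : independent x w -> (m <= n)%N.
Proof.
move=> iw; have [wx wi] := iw; have [k [Hk kP]] := independent_dual iw.
rewrite leqNgt; apply/negP => nm.
have [_ [b _ bP]] := dimn.
have /choice[T TP] : forall i, exists T, D T /\ mult T (k i).
  by move=> i; have [T DT mT] := Hk i; exists T.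
have /choice[M MP] : forall i, exists M : 'rV[C]_n,
    restr_op (Q := [set x]) (T i) = \sum_j M 0 j *: b j.
  move=> i; have [|M [ME _]] := bP (restr_op (Q := [set x]) (T i)); last by exists M.
  by exists (T i) => //; have [] := TP i.
have [v v0 vM] := ker_vector (\matrix_(i, j) M i 0 j) nm.
have S0 : \sum_i v 0 i *: restr_op (E := E) (Q := [set x]) (T i) = 0.
  under eq_bigr => i _ do rewrite MP scaler_sumr.
  rewrite exchange_big big1// => j _.
  under eq_bigr => i _ do rewrite scalerA.
  rewrite -scaler_suml; have /matrixP/(_ 0 j) := vM; rewrite !mxE.
  by under eq_bigr => i _ do rewrite mxE; move=> ->; rewrite scale0r.
move/eqP: v0; apply; apply/rowP => i; rewrite mxE.
have [p [/nbhs_singleton[p1 _] _ _ _]] := unit_section (@filterT _ (nbhs (w i)) _).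
have := congr1 (fun f => rsec (f (lclass _ p)) (w i)) S0.
rewrite fct_sumE [RHS]rsec0// rsec_sum//.
rewrite (bigD1 i)//= big1 ?addr0 => [|j ji].
  rewrite rsecZ// (rsec_op _ (TP i).2)// rsec_class// scalerA.
  rewrite (kP i (w i) (wx i)).1; last exact: eqv_refl.
  rewrite mulr1 => /(congr1 (lb_met (G0_sec p (w i)))).
  by rewrite hZr p1 mulr1 met_r0.
rewrite rsecZ// (rsec_op _ (TP j).2)// (kP j (w i) (wx i)).2 ?scale0r ?scaler0//.
by move=> /wi ij; move: ji; rewrite ij eqxx.
Qed.

(** A maximal independent family meets every class. If it had m < n members, the symbols of a basis
    of D_x would be determined on the fiber by m values each, hence would be dependent. So dim D_x
    counts the classes. *)
Lemma independent_complete : exists2 w : 'I_n -> Z, independent x w &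
  forall z, s z = x -> exists i, eqv H (w i) z.
Proof.
pose P m := `[< exists w : 'I_m -> Z, independent x w >].
have P0 : exists m, P m.
  exists 0%N; apply/asboolP; have w0 : 'I_0 -> Z by case.
  by exists w0; split; case.
have Pn m : P m -> (m <= n)%N by move=> /asboolP[w]; exact: independent_le.
have [m /asboolP[w iw] mmax] := ex_maxnP P0 Pn.
have cw z : s z = x -> exists i, eqv H (w i) z.
  move=> zx; apply: contrapT => nz; have : (m.+1 <= m)%N; last by rewrite ltnn.
  apply: mmax; apply/asboolP.
  have [wx wi] := iw.
  exists (fun i => if unlift ord_max i is Some j then w j else z); split=> [i|i j].
    by case: unliftP => [j _|_].
  case: unliftP => [i' ->|->]; case: unliftP => [j' ->|->] // e.
  - by rewrite (wi _ _ e).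
  - by exfalso; apply: nz; exists i'.
  - by exfalso; apply: nz; exists j'; exact: eqv_sym.
suff mn : m = n by subst m; exists w.
apply/eqP; rewrite eqn_leq Pn//=; last by apply/asboolP; exists w.
rewrite leqNgt; apply/negP => nm.
have [k [Hk kP]] := independent_dual iw.
have [_ [b bD bP]] := dimn.
have /choice[T TP] : forall i, exists T, D T /\ restr_op (Q := [set x]) T = b i.
  by move=> i; have [T DT <-] := bD i; exists T.
have /choice[t tP] : forall i, exists t, mult (T i) t by move=> i; apply: DM; have [] := TP i.
have [v v0 vM] := ker_vector (\matrix_(i, j) t i (w j)) nm.
have S0 : \sum_i v 0 i *: b i = 0.
  apply/funext => q; rewrite fct_sumE; apply/rsec_eq => z zx; rewrite rsec_sum// rsec0//.
  have [j wz] := cw z zx.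
  transitivity ((\sum_i v 0 i * t i (w j)) *: rsec q z).
    rewrite scaler_suml; apply: eq_bigr => i _.
    have [DT <-] := TP i.
    rewrite rsecZ// (rsec_op _ (tP i))// scalerA.
    by have [_ <-//] := wz; exact: symbolsW DT (tP i).
  have /matrixP/(_ 0 j) := vM; rewrite !mxE.
  by under eq_bigr => i _ do rewrite mxE; move=> ->; rewrite scale0r.
have [|c0 [_ c0u]] := bP 0; first by have [[]] := dimn.
move/eqP: v0; apply; rewrite -(c0u v) ?S0// ; apply: c0u.
by rewrite big1// => i _; rewrite mxE scale0r.
Qed.

End HasDim.

Lemma sa_cub k : H k -> H (fun z => cub (k z)).
Proof.
move=> Hk; apply: (sa_lin sH); first exact: (sa_mul sH).
by apply: sa_Z => //; do 2! apply: (sa_mul sH) => //.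
Qed.

Lemma sa_iter_cub k N : H k -> H (fun z => iter N (@cub R) (k z)).
Proof. by move=> Hk; elim: N => [//|N IH]; exact: sa_cub. Qed.

(* By constant rank, the classes of eqv near x0 are exactly those of the sheets
   through representatives over x0. *)
Lemma local_idempotent (rk : constant_rank D) z0 : exists q, exists V, [/\ H q, open_nbhs (s z0) V, q z0 = 1,
  forall a, V (s a) -> q a <> 0 -> q a = 1 &
  forall a b, V (s a) -> s a = s b -> q a <> 0 -> q b <> 0 -> eqv H a b].
Proof.
have [n dimn] := rk; pose x0 := s z0.
have [z iz cz] := independent_complete (dimn x0); have [zx zi] := iz.
have [hh [Hh hP]] := independent_dual iz.
have [i0 zi0] := cz z0 erefl.
have [V0 [sg [lab [[oV0 V0x] H1 H2 _]]]] := local_sheets lcX T2X s_surj x0.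
have zf i : z i \in fib c x0 by exact/mem_fib.
have n1 : \forall x \near x0, forall i, i \in enum 'I_n -> forall j, j \in enum 'I_n ->
    nc (hh i (sg (z j) x) - (i == j)%:R) < 6^-1.
  apply: near_all => i _; apply: near_all => j _.
  have [sz /(_ _ V0x)[_ cs _]] := H1 _ (zf j).
  have ch : cont_at (fun x => hh i (sg (z j) x)) x0.
    by apply: cont_at_comp => //; exact: (sa_c0 sH (Hh i)).1.
  have /cont_atC/(_ 6^-1) := ch; rewrite invr_gt0 => /(_ (ltr0Sn _ 5)).
  apply: filterS => x; rewrite nc_dist sz.
  suff -> : hh i (z j) = (i == j)%:R by [].
  have [ij|ij] := eqVneq i j; first by rewrite ij (hP j (z j) (zx j)).1//; exact: eqv_refl.
  by rewrite (hP i (z j) (zx j)).2// => /zi ij'; rewrite ij' eqxx in ij.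
have nV : nbhs x0 (V0 `&` [set x | forall i j, nc (hh i (sg (z j) x) - (i == j)%:R) < 6^-1]).
  apply: filterI; first exact: open_nbhs_nbhs.
  by apply: filterS n1 => x nx i j; apply: nx; rewrite mem_enum.
pose V := V0 `&` [set x | forall i j, nc (hh i (sg (z j) x) - (i == j)%:R) < 6^-1].
(* Otherwise the n sheets together with [a] would give n + 1 independent points over s a. The sheets
   themselves remain inequivalent, as hh i is within 1/6 of 1 on sheet i and of 0 on the others. *)
have near_class a : V (s a) -> exists2 j, eqv H (sg (z j) (s a)) a & hh i0 a = hh i0 (sg (z j) (s a)).
  move=> [V0a na]; have [w _ _] := independent_complete (dimn (s a)).
  apply: contrapT => nj.
  have : (n.+1 <= n)%N; last by rewrite ltnn.
  have sgs j : s (sg (z j) (s a)) = s a.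
    by have [_ /(_ _ V0a)[]] := H1 _ (zf j).
  have nj' j : ~ eqv H (sg (z j) (s a)) a.
    by move=> ja; apply: nj; exists j => //; have [_ ->] := ja.
  apply: (independent_le (dimn (s a)) (w := fun i => if unlift ord_max i is Some j then sg (z j) (s a) else a)).
  split=> [i|i j]; first by case: unliftP => [j _|_].
  case: unliftP => [i' ->|->]; case: unliftP => [j' ->|->] // e.
  - congr lift; have [_ /(_ _ (Hh i'))] := e => eij; apply/eqP/negP => /negP ij.
    have := na i' i'; have := na i' j'; rewrite eqxx (negbTE ij) -eij subr0 => h0 h1.
    have := ncB 1 (hh i' (sg (z i') (s a))); rewrite nc1 nc_dist; lra.
  - by exfalso; apply: nj' e.
  - by exfalso; apply: nj'; exact: eqv_sym e.
pose k := hh i0.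
have k01 a : V (s a) -> exists b : bool, nc (k a - b%:R) < 6^-1.
  move=> Va; have [j ja e] := near_class a Va; exists (i0 == j).
  by rewrite /k e; have [_ ->] := Va.
have kclass a : V (s a) -> nc (k a - 1) < 6^-1 -> eqv H (sg (z i0) (s a)) a.
  move=> Va ka; have [j ja e] := near_class a Va.
  have [-> //|ij] := eqVneq i0 j; exfalso.
  have [_ /(_ i0 j)] := Va; rewrite (negbTE ij) subr0 -e -/k => h0.
  by have := ncB 1 (k a); rewrite nc1 nc_dist; lra.
have [b [K [cb [_ KV] b01 b1 bK]]] := c0fun_bump R lcX T2X nV.
(* A bump from [X] times the indicator of [k] being close to 1. Over the support of the bump, [k] is
   within 1/6 of 0 or 1, so the iterates of [cub] on [k] converge uniformly to this indicator and
   [q] belongs to H. *)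
pose q a : C := if `[< nc (k a - 1) < 6^-1 >] then rC (b (s a)) else 0.
have Hq : H q.
  apply: (sa_closed sH) => e e0.
  have [|||N Nq] := @geom_small R (5 / 9) e; [lra|lra|by []|].
  exists (fun a => rC (b (s a)) * iter N (@cub R) (k a)).
    apply: (sa_mul sH); first exact: (sa_s sH cb).
    exact/sa_iter_cub/Hh.
  move=> a; have [Ka|nKa] := pselect (K (s a)); last first.
    by rewrite /q bK// rC0 mul0r if_same subr0 nc0 ltW.
  have [b0 bb] := andP (b01 (s a)).
  have [e1 eb] := k01 a (KV _ Ka).
  have E : q a = rC (b (s a)) * e1%:R.
    rewrite /q; case: e1 eb => /= eb.
      by rewrite mulr1; case: asboolP.
    rewrite mulr0; case: asboolP => // h1; rewrite subr0 in eb; exfalso.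
    by have := ncB 1 (k a); rewrite nc1 nc_dist; lra.
  rewrite E -mulrBr ncM nc_rC// nc_dist; have := iter_cub N (ltW eb).
  have p0 : 0 <= (5 / 9 : R) ^+ N by rewrite exprn_ge0// divr_ge0.
  move=> it; apply: le_trans (_ : 1 * ((5 / 9) ^+ N * 6^-1) <= _); last by lra.
  by apply: ler_pM; rewrite ?nc_ge0.
have [V1 [oV1 V1x] V1b] : exists2 V1, open_nbhs x0 V1 & V1 `<=` V `&` [set x | b x = 1].
  have : nbhs x0 (V `&` [set x | b x = 1]) by apply: filterI.
  by rewrite nbhsE.
exists q, V1; split => //.
- have k1 : k z0 = 1 by rewrite /k (hP i0 z0 erefl).1.
  by rewrite /q k1 subrr nc0 invr_gt0 ltr0Sn asboolT// (nbhs_singleton b1).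
- by move=> a /V1b[_ /= ba]; rewrite /q ba rC1; case: ifP.
- move=> a a' /V1b[Va /= ba] aa; rewrite /q; case: asboolP => // ka _; case: asboolP => // ka' _.
  apply: eqv_trans (eqv_sym (kclass a Va ka)) _; rewrite aa; apply: kclass => //.
  by rewrite -aa.
Qed.

End Rank.

(** * The spectrum and the bundle *)

Section Topologies.
Import finmap.

Lemma gen_topology_open (T : choiceType) (S : set (set T)) (A : set T) :
  S A -> open (A : set (gen_topology S)).
Proof.
move=> SA; exists [set A]; last by rewrite bigcup_set1.
by move=> _ ->; exists (fset1 A) => [B|]; [rewrite !inE => /eqP ->; exact/mem_set|rewrite set_fset1 bigcap_set1].
Qed.

Lemma gen_topology_continuous (T : choiceType) (S : set (set T)) (V : topologicalType)
    (f : V -> gen_topology S) :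
  (forall A, S A -> open (f @^-1` A)) -> continuous f.
Proof.
move=> fS; apply/continuousP => A [D' D'S <-]; rewrite preimage_bigcup.
apply: bigcup_open => B /D'S [F FS <-]; rewrite preimage_bigcap.
have -> : \bigcap_(i in [set` F]) f @^-1` i = \big[setI/setT]_(i <- enum_fset F) f @^-1` i.
  by rewrite -bigcap_fset.
rewrite big_seq; elim/big_ind : _ => [||i iF]; [exact: openT|exact: openI|].
by apply: fS; apply: set_mem; exact: FS.
Qed.

End Topologies.

Lemma initial_open (S : choiceType) (T : topologicalType) (f : S -> T) (A : set T) :
  open A -> open (f @^-1` A : set (initial_topology f)).
Proof. by move=> oA; exists A. Qed.

Section Spectrum.
Variables (R : realType) (X Y : topologicalType) (c : tcorr R Y X).
Hypotheses (lcX : locally_compact [set: X]) (T2X : hausdorff_space X).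
Notation C := (cplx R).
Notation Z := (tc_Z c).
Notation s := (@tc_s R Y X c).
Notation E := (Gamma0_corr c).
Variable D : set (E -> E).
Notation H := (symbols D).
Hypothesis sH : symalg H.
Hypothesis DM : forall T, D T -> exists k, mult T k.
Implicit Types (k l : Z -> C) (z w : Z) (chi : spectrum D) (d : D).

Lemma dval d : D (\val d). Proof. exact: set_mem (valP d). Qed.

Definition mkd (T : E -> E) (DT : D T) : D := exist _ T (mem_set DT).

(** The symbol as a total function of the operator; the default concerns only operators that are not
    multiplications. *)
Definition sy (T : E -> E) : Z -> C := xget (fun=> 0) [set k | mult T k].

Lemma syE (T : E -> E) k : mult T k -> sy T = k.
Proof.
move=> mT; rewrite /sy; case: xgetP => [l -> ml|/(_ k)//].
by apply/funext => z; exact: mult_uniq ml mT z.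
Qed.

Lemma syP T : D T -> mult T (sy T).
Proof. by move=> /DM[k mk]; rewrite (syE mk). Qed.

Lemma syH T : D T -> H (sy T). Proof. by move=> DT; exists T => //; exact: syP. Qed.

Lemma sy_mkd k : H k -> exists d, mult (\val d) k.
Proof. by move=> [T DT mT]; exists (mkd DT). Qed.

Lemma charP chi : character (ev chi).
Proof. exact: set_mem (valP chi). Qed.

Definition at_point chi z : Prop := forall d k, mult (\val d) k -> ev chi d = k z.

Lemma spectrum_point chi : exists z, at_point chi z.
Proof.
have [[d0 d00] hD hZ hM hA] := charP chi.
(* [chi] transported to functions on [Z], where the operations of D become pointwise and [chi_ev]
   applies; it is set to 0 off the symbols of D. *)
pose Xf k : C := if pselect (exists d, mult (\val d) k) is left e
  then ev chi (projT1 (cid e)) else 0.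
have XE d k : mult (\val d) k -> Xf k = ev chi d.
  move=> mk; rewrite /Xf; case: pselect => [e|[]]; last by exists d.
  by case: (cid e) => d' /= mk'; congr ev; apply: val_inj; exact: mult_inj mk' mk.
have lin a k l : H k -> H l -> Xf (fun z => a * k z + l z) = a * Xf k + Xf l.
  move=> [T DT mT] [S DS mS]; have DaT : H (fun z => a * k z + 0).
    apply: (sa_lin sH); [by exists T|exact: sa_0].
  have [d1 md1] : exists d1 : D, mult (\val d1) (fun z => a * k z).
    have [d1 md1] := sy_mkd DaT; exists d1 => u z.
    by rewrite md1 addr0.
  have [d2 md2] := sy_mkd (sa_lin sH a (ex_intro2 _ _ T DT mT) (ex_intro2 _ _ S DS mS)).
  rewrite (XE _ _ md2) (XE (mkd DT) k mT) (XE (mkd DS) l mS).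
  rewrite -(hZ a (mkd DT) d1); last first.
    apply: mult_inj md1 _ => u z.
    by have -> : G0_sec ((a *: (T : E -> E)) u) z = a *: G0_sec (T u) z by []; rewrite mT scalerA.
  rewrite -(hD d1 (mkd DS) d2)//; apply: mult_inj md2 _ => u z.
  have -> : G0_sec ((\val d1 + S) u) z = G0_sec (\val d1 u) z + G0_sec (S u) z by [].
  by rewrite md1 mS scalerDl.
have mul k l : H k -> H l -> Xf (fun z => k z * l z) = Xf k * Xf l.
  move=> [T DT mT] [S DS mS].
  have [d2 md2] := sy_mkd (sa_mul sH (ex_intro2 _ _ T DT mT) (ex_intro2 _ _ S DS mS)).
  rewrite (XE _ _ md2) (XE (mkd DT) k mT) (XE (mkd DS) l mS).
  by apply: hM; apply: mult_inj md2 _; exact: mult_comp.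
have conj k : H k -> Xf (fun z => (k z)^*) = (Xf k)^*.
  move=> [T DT mT]; have [d2 md2] := sy_mkd (sa_conj sH (ex_intro2 _ _ T DT mT)).
  rewrite (XE _ _ md2) (XE (mkd DT) k mT); apply: hA.
  exact: mult_adjoint mT md2.
have n0 : exists2 k, H k & Xf k != 0.
  exists (sy (\val d0)); first exact/syH/dval.
  by rewrite (XE d0)//; exact/syP/dval.
have [z Xz] := chi_ev lcX T2X sH lin mul n0.
exists z => d k mk; rewrite -(XE d k mk); apply: Xz.
by exists (\val d) => //; exact: dval.
Qed.

Lemma at_point_character z : character (fun d : D => sy (\val d) z).
Proof.
split.
- have [k Hk kz] := sa_bump lcX T2X sH z; have [d md] := sy_mkd Hk.
  by exists d; rewrite (syE md) kz oner_neq0.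
- move=> d1 d2 d3 e.
  have m1 := syP (dval d1); have m2 := syP (dval d2).
  rewrite (syE (k := fun z => sy (\val d1) z + sy (\val d2) z))//.
  move=> u w; rewrite e.
  have -> : G0_sec ((\val d1 + \val d2) u) w = G0_sec (\val d1 u) w + G0_sec (\val d2 u) w by [].
  by rewrite m1 m2 scalerDl.
- move=> a d1 d2 e; have m1 := syP (dval d1).
  rewrite (syE (T := \val d2) (k := fun z => a * sy (\val d1) z))//.
  move=> u w; rewrite e.
  have -> : G0_sec ((a *: \val d1) u) w = a *: G0_sec (\val d1 u) w by [].
  by rewrite m1 scalerA.
- move=> d1 d2 d3 e; have m1 := syP (dval d1); have m2 := syP (dval d2).
  rewrite (syE (T := \val d3) (k := fun z => sy (\val d1) z * sy (\val d2) z))//.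
  by rewrite e; exact: mult_comp.
- move=> d1 d2 adj; have m1 := syP (dval d1); have c1 := sa_c0 sH (syH (dval d1)).
  rewrite (syE (T := \val d2) (k := fun z => (sy (\val d1) z)^*))//.
  rewrite (adjoint_uniq adj (mult_adjoint m1 (mult_Mop (c0fun_conj c1)))).
  exact: mult_Mop.
Qed.

Definition evz z : spectrum D :=
  exist _ (fun d : D => sy (\val d) z) (mem_set (at_point_character z)).

Lemma evz_at z : at_point (evz z) z.
Proof. by move=> d k mk; rewrite /ev/= (syE mk). Qed.

Lemma spectrum_ext chi chi' : (forall d, ev chi d = ev chi' d) -> chi = chi'.
Proof. by move=> e; apply: val_inj => /=; apply/funext => d; exact: e. Qed.

Lemma at_point_uniq chi chi' z : at_point chi z -> at_point chi' z -> chi = chi'.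
Proof.
move=> cz c'z; apply: spectrum_ext => d; have m := syP (dval d).
by rewrite (cz _ _ m) (c'z _ _ m).
Qed.

Lemma H_separates z w : (forall k, H k -> k z = k w) -> s z = s w.
Proof.
move=> zw; apply: contrapT => ne; have [f [f1 f0]] := C0_separates R lcX T2X ne.
have := zw _ (sa_s sH (C0_c0fun f)); rewrite f1 f0 => /eqP.
by rewrite oner_eq0.
Qed.

Lemma at_point_eqv chi z w : at_point chi z -> at_point chi w <-> eqv H z w.
Proof.
move=> cz; split=> [cw|[_ zw] d k mk]; last first.
  by rewrite (cz d k mk) zw//; exists (\val d) => //; exact: dval.
have zw k : H k -> k z = k w.
  by move=> Hk; have [d mk] := sy_mkd Hk; rewrite -(cz d k mk) -(cw d k mk).
by split => //; exact: H_separates.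
Qed.

Lemma sdualE chi z : at_point chi z -> sdual chi = [set s z].
Proof.
move=> cz; apply/seteqP; split=> [x /= cx|x -> f d df]; last first.
  by rewrite (cz d (fun z => f (s z)))// df; exact: mult_iota.
apply: contrapT => ne; have [f [f1 f0]] := C0_separates R lcX T2X ne.
have [d md] := sy_mkd (sa_s sH (C0_c0fun f)).
have df : \val d = iota_op f by apply: mult_inj md _; exact: mult_iota.
have := cx f d df; rewrite (cz d _ md) f1 f0 => /eqP.
by rewrite eq_sym oner_eq0.
Qed.

Lemma lifts_minprojE chi z d k : at_point chi z -> mult (\val d) k ->
  lifts_minproj chi d <-> k z = 1 /\ forall w, s w = s z -> ~ eqv H z w -> k w = 0.
Proof.
move=> cz mk; split=> [[c1 c0]|[k1 k0]].
  split=> [|w wz nzw]; first by rewrite -(cz d k mk).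
  rewrite -(evz_at w mk); apply: c0.
    by rewrite (sdualE (evz_at w)) (sdualE cz) wz.
  by move=> e; apply: nzw; apply/(at_point_eqv w cz); rewrite -e; exact: evz_at.
split=> [|chi' sd ne]; first by rewrite (cz d k mk).
have [w cw] := spectrum_point chi'; rewrite (cw d k mk); apply: k0.
  by move: sd; rewrite (sdualE cz) (sdualE cw) => /seteqP[+ _] => /(_ (s w) erefl).
by move=> zw; apply: ne; apply: (at_point_uniq cw); apply/(at_point_eqv w cz).
Qed.

Lemma lifts_exists chi : exists d, lifts_minproj chi d.
Proof.
have [z cz] := spectrum_point chi; have [k [Hk k1 k0]] := interpolation lcX T2X sH z.
by have [d md] := sy_mkd Hk; exists d; apply/(lifts_minprojE cz md).
Qed.

(** A representative in E of an element of p_z E_x. Only its values over x are determined by [t],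
    and they vanish off the class of z. *)
Definition vf chi (t : VD_fib chi) : E := lrepr (lspan_val t).

Lemma vf_inj chi z (t t' : VD_fib chi) : at_point chi z ->
  (forall w, s w = s z -> G0_sec (vf t) w = G0_sec (vf t') w) -> t = t'.
Proof.
move=> cz tt; have Qz w : sdual chi (s w) -> s w = s z by rewrite (sdualE cz).
by apply: val_inj => /=; apply/rsec_eq => w /Qz; exact: tt.
Qed.

Lemma vf_supp chi z (t : VD_fib chi) w : at_point chi z -> s w = s z -> ~ eqv H z w ->
  G0_sec (vf t) w = 0.
Proof.
move=> cz wz nzw; have := lspan_valP t; rewrite inE => tP.
have Qw : sdual chi (s w) by rewrite (sdualE cz).
suff : lspan [set v : restr E (sdual chi) | exists2 d : D, lifts_minproj chi d &
   range (restr_op (\val d)) v] `<=` [set v | rsec v w = 0] by move=> /(_ _ tP).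
apply: smallest_min.
  by split=> /= [|a u v u0 v0]; [rewrite rsec0|rewrite rsecD// rsecZ// u0 v0 scaler0 addr0].
move=> v [d ld [q _ <-]] /=; have md := syP (dval d).
rewrite (rsec_op _ md Qw); have [_ k0] := (lifts_minprojE cz md).1 ld.
by rewrite k0// scale0r.
Qed.

Lemma vf_lin chi z (a : C) (t t' : VD_fib chi) w : at_point chi z -> s w = s z ->
  G0_sec (vf (a *: t + t')) w = a *: G0_sec (vf t) w + G0_sec (vf t') w.
Proof.
move=> cz wz; have Qw : sdual chi (s w) by rewrite (sdualE cz).
by rewrite -(rsecZ a (lspan_val t) Qw) -(rsecD _ _ Qw).
Qed.

Fact pr_subproof chi (d : D) (u : E) : lifts_minproj chi d ->
  restr_op (\val d) (lclass _ u) \in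
  lspan_pred [set v : restr E (sdual chi) | exists2 d : D, lifts_minproj chi d &
   range (restr_op (\val d)) v].
Proof. by move=> ld; rewrite inE => W [_]; apply; exists d => //; exists (lclass _ u). Qed.

Definition lift chi : D := projT1 (cid (lifts_exists chi)).
Lemma liftP chi : lifts_minproj chi (lift chi). Proof. by rewrite /lift; case: cid. Qed.

(** The element p_z u(x). It is computed with a chosen lift of p_z, but [vf_pr] and [vf_supp]
    describe its values without reference to that choice. *)
Definition pr chi (u : E) : VD_fib chi := LspanMod (pr_subproof u (liftP chi)).

Lemma vf_pr chi z u w : at_point chi z -> eqv H z w -> G0_sec (vf (pr chi u)) w = G0_sec u w.
Proof.
move=> cz zw; have Qw : sdual chi (s w) by rewrite (sdualE cz) /=; have [] := zw.
have md := syP (dval (lift chi)).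
rewrite [LHS](rsec_op _ md Qw) rsec_class//.
have [k1 _] := (lifts_minprojE cz md).1 (liftP chi); have [_ <-] := zw.
  by rewrite k1 scale1r.
exact/syH/dval.
Qed.

Lemma vf_pr_eq chi z u (t : VD_fib chi) : at_point chi z ->
  (forall w, eqv H z w -> G0_sec (vf t) w = G0_sec u w) -> t = pr chi u.
Proof.
move=> cz tu; apply: (vf_inj cz) => w wz.
have [zw|nzw] := pselect (eqv H z w); first by rewrite (vf_pr _ cz)// tu.
by rewrite !(vf_supp _ cz).
Qed.

Definition class_cut z (u : sections (tc_L c)) : sections (tc_L c) :=
  fun w => if `[< eqv H z w >] then u w else 0.

(** All lifts of p_z act on the fiber over s z by the indicator of the class of [z], so the
    existential quantifiers over lifts and base points disappear. *)
Lemma VD_tubeE (U : set (spectrum D)) u (e : R) chi z (t : VD_fib chi) : at_point chi z ->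
  VD_tube U u e (existT _ chi t) <->
  U chi /\ nx (class_cut z (fun w => G0_sec (vf t) w - G0_sec u w)) (s z) < e.
Proof.
move=> cz; have key d : lifts_minproj chi d ->
    fnorm (vf t - \val d u) (s z) = nx (class_cut z (fun w => G0_sec (vf t) w - G0_sec u w)) (s z).
  move=> ld; have md := syP (dval d); have [k1 k0] := (lifts_minprojE cz md).1 ld.
  apply: nx_eq => w wz; rewrite secB md /class_cut; case: asboolP => zw.
    by have [_ <-] := zw; [rewrite k1 scale1r|exact/syH/dval].
  by rewrite k0// scale0r subr0 (vf_supp _ cz).
split=> [[Uc [d [x [ld sx]]]]|[Uc lt]].
  rewrite (sdualE cz) in sx; rewrite sx => lt; split=> //.
  by rewrite -(key d ld).
split=> //; have [d ld] := lifts_exists chi; exists d, (s z); split=> //.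
  by rewrite (sdualE cz).
by rewrite -/(vf t) key.
Qed.

Lemma VD_tube_open (U : set (spectrum D)) u (e : R) : open U -> 0 < e ->
  open (VD_tube U u e : set (tot (VD D))).
Proof. by move=> oU e0; apply: gen_topology_open; exists U, u, e. Qed.

Lemma VD_continuous (V : topologicalType) (f : V -> tot (VD D)) :
  (forall U u (e : R), open U -> 0 < e -> open (f @^-1` (VD_tube U u e))) -> continuous f.
Proof.
move=> fU; apply: gen_topology_continuous => A [U [u [e [oU e0 ->]]]].
exact: fU.
Qed.

Lemma ev_continuous d : continuous (fun chi => ev chi d).
Proof.
move=> chi; apply: (@continuous_comp _ _ _ (fun chi => (\val chi : {ptws D -> C})) (fun g => g d)).
  exact: initial_continuous.
exact: proj_continuous.
Qed.

Lemma spectrum_continuous (V : topologicalType) (f : V -> spectrum D) :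
  (forall d, continuous (fun v => ev (f v) d)) -> continuous f.
Proof.
move=> fd; apply: continuous_comp_initial => v.
apply/cvg_sup => d U [V' [[W oW <-] Wf]] WU; apply: filterS WU _.
by apply: (fd d v); exact: open_nbhs_nbhs.
Qed.

Lemma evz_continuous : continuous evz.
Proof.
apply: spectrum_continuous => d; rewrite (_ : (fun z => _) = sy (\val d))//.
exact: (sa_c0 sH (syH (dval d))).1.
Qed.

End Spectrum.

(** * Isomorphisms of correspondences *)

Lemma pair_continuous (T U V : topologicalType) (f : T -> U) (g : T -> V) :
  continuous f -> continuous g -> continuous (fun t => (f t, g t)).
Proof. by move=> cf cg t; apply: (cvg_pair (G := nbhs (f t)) (H := nbhs (g t))); [exact: cf|exact: cg]. Qed.

Section IsoTransport.
Variables (R : realType) (X Y : topologicalType).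
Notation C := (cplx R).

(** An isomorphism with its inverse made explicit, so that [iso_sym] gives each statement in both
    directions. *)
Record iso_data (E E' : corr R Y X) (U : E -> E') (V : E' -> E) : Prop := IsoData {
  iso_lin : forall (a : C) u v, U (a *: u + v) = a *: U u + U v;
  iso_linV : forall (a : C) u v, V (a *: u + v) = a *: V u + V v;
  iso_K : cancel U V;
  iso_VK : cancel V U;
  iso_ip : forall u v x, ip (U u) (U v) x = ip u v x;
  iso_ract : forall u f, U (ract u f) = ract (U u) f;
  iso_lact : forall g u, U (lact g u) = lact g (U u) }.

Lemma iso_sym (E E' : corr R Y X) (U : E -> E') (V : E' -> E) : iso_data U V -> iso_data V U.
Proof.
case=> l lV K VK ipU rU lU; split => //.
- by move=> u v x; rewrite -ipU !VK.
- by move=> u f; rewrite -[in LHS](VK u) -rU K.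
- by move=> g u; rewrite -[in LHS](VK u) -lU K.
Qed.

Definition conjop (E E' : corr R Y X) (U : E -> E') (V : E' -> E) (T : E -> E) : E' -> E' :=
  fun u => U (T (V u)).

Section Conj.
Variables (E E' : corr R Y X) (U : E -> E') (V : E' -> E).
Hypothesis isoU : iso_data U V.
Notation cj := (conjop U V).
Notation cjV := (conjop V U).
Implicit Types T S : E -> E.

Lemma isoB u v : U (u - v) = U u - U v.
Proof. by have := iso_lin isoU (-1) v u; rewrite !scaleN1r addrC => ->; rewrite addrC. Qed.

Lemma conjopK T : cjV (cj T) = T.
Proof. by apply/funext => u; rewrite /conjop (iso_K isoU) (iso_K isoU). Qed.

Lemma conjop_lin (a : C) T S : cj (a *: T + S) = a *: cj T + cj S.
Proof. by apply/funext => u; rewrite /conjop; exact: (iso_lin isoU). Qed.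

Lemma conjop0 : cj 0 = 0.
Proof.
apply/funext => u; rewrite /conjop.
have := iso_lin isoU 1 0 0; rewrite !scale1r addr0 -[LHS]addr0 => /addrI e.
exact/esym.
Qed.

Lemma conjop_comp T S : cj (T \o S) = cj T \o cj S.
Proof. by apply/funext => u; rewrite /conjop /= (iso_K isoU). Qed.

Lemma conjop_adjoint T S : is_adjoint T S -> is_adjoint (cj T) (cj S).
Proof.
move=> TS u v x; rewrite /conjop -[in LHS](iso_VK isoU v) -[in RHS](iso_VK isoU u).
by rewrite !(iso_ip isoU) TS.
Qed.

Lemma fnorm_iso u x : fnorm (U u) x = fnorm u x.
Proof. by rewrite /fnorm (iso_ip isoU). Qed.

Lemma enorm_iso u : enorm (U u) = enorm u.
Proof. by rewrite /enorm (_ : fnorm (U u) = fnorm u)//; apply/funext => x; exact: fnorm_iso. Qed.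

Lemma conjop_theta a b T : is_theta a b T -> is_theta (U a) (U b) (cj T).
Proof.
move=> ab u; have [f fE TE] := ab (V u); exists f.
  by move=> x; rewrite fE -(iso_ip isoU) (iso_VK isoU).
by rewrite /conjop TE (iso_ract isoU).
Qed.

Lemma conjop_norm_closure (A : set (E -> E)) (A' : set (E' -> E')) T :
  (forall S, A S -> A' (cj S)) -> norm_closure A T -> norm_closure A' (cj T).
Proof.
move=> AA' cT e e0; have [S AS TS] := cT e e0; exists (cj S); first exact: AA'.
move=> u; rewrite /conjop -isoB enorm_iso; apply: le_trans (TS _) _.
by rewrite -[in X in _ <= X](iso_VK isoU u) enorm_iso.
Qed.

Lemma conjop_compact T : compact_ops E T -> compact_ops E' (cj T).
Proof.
rewrite /compact_ops; set th' := [set S : E' -> E' | exists a b, is_theta a b S].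
apply: conjop_norm_closure.
apply: (@smallest_min _ _ _ [set S | lspan th' (cj S)]).
  have [l0 ll] := lspan_submodule th'.
  split; first by rewrite /= conjop0.
  by move=> a S Q hS hQ; rewrite /= conjop_lin; exact: ll.
move=> S [a [b ab]] W [_]; apply; exists (U a), (U b); exact: conjop_theta.
Qed.

End Conj.

Lemma conjop_iota (E E' : corr R Y X) (U : E -> E') (V : E' -> E) (f : C0 R X) :
  iso_data U V -> conjop U V (iota_op f) = iota_op f.
Proof. by move=> iU; apply/funext => u; rewrite /conjop /iota_op (iso_ract iU) (iso_VK iU). Qed.

Lemma conjop_phi (E E' : corr R Y X) (U : E -> E') (V : E' -> E) (g : C0 R Y) :
  iso_data U V -> conjop U V (phi_op g) = phi_op g.
Proof. by move=> iU; apply/funext => u; rewrite /conjop /phi_op (iso_lact iU) (iso_VK iU). Qed.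

(** The preimage under conjugation of any C*-subalgebra containing the generators is another such,
    so minimality on the side of E gives membership in all of them. *)
Lemma conjop_cstar_iota_phi (E E' : corr R Y X) (U : E -> E') (V : E' -> E) T :
  iso_data U V -> cstar_iota_phi E T -> cstar_iota_phi E' (conjop U V T).
Proof.
move=> iU hT W [Wc Wg]; have iV := iso_sym iU; have [W1 [W20 W2] W3 W4 W5] := Wc.
apply: (hT [set S | W (conjop U V S)]); split.
  split.
  - by move=> S /W1 /(conjop_compact iV); rewrite (conjopK iU).
  - split; first by rewrite /= (conjop0 iU).
    by move=> a S Q hS hQ; rewrite /= (conjop_lin iU); exact: W2.
  - by move=> S Q hS hQ; rewrite /= (conjop_comp iU); exact: W3.
  - move=> S hS; have [Q WQ SQ] := W4 _ hS; exists (conjop V U Q).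
      by rewrite /= (conjopK iV).
    by rewrite -(conjopK iU S); exact: conjop_adjoint iV _ _ SQ.
  - by move=> S cS; apply: W5; exact: (conjop_norm_closure iU) cS.
move=> S [[f _ <-]|[g _ <-]] /=; apply: Wg.
  by left; exists f => //; rewrite (conjop_iota f iU).
by right; exists g => //; rewrite (conjop_phi g iU).
Qed.

Lemma conjop_commutant (E E' : corr R Y X) (U : E -> E') (V : E' -> E)
    (A : set (E -> E)) (A' : set (E' -> E')) T :
  iso_data U V -> (forall S, A' S -> A (conjop V U S)) ->
  commutant A T -> commutant A' (conjop U V T).
Proof.
move=> iU AA [kT cT]; have iV := iso_sym iU; split; first exact: conjop_compact iU _ kT.
move=> S /AA /cT e; rewrite -[S](conjopK iV) -!(conjop_comp iU).
by rewrite e.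
Qed.

End IsoTransport.

Section IsoStar.
Variables (R : realType) (X Y : topologicalType) (E E' : corr R Y X).
Variables (U : E -> E') (V : E' -> E) (D : set (E -> E)) (D' : set (E' -> E')).
Hypothesis DD' : forall T, D T -> D' (conjop U V T).
Hypothesis D'D : forall T, D' T -> D (conjop V U T).

Lemma dvalE (F : corr R Y X) (A : set (F -> F)) (d : A) : A (\val d).
Proof. exact: set_mem (valP d). Qed.

Definition conj_si (d : D) : D' := exist _ (conjop U V (\val d)) (mem_set (DD' (dvalE d))).
Definition conj_siV (d : D') : D := exist _ (conjop V U (\val d)) (mem_set (D'D (dvalE d))).

End IsoStar.

Lemma conj_star_hom (R : realType) (X Y : topologicalType) (E E' : corr R Y X)
    (U : E -> E') (V : E' -> E) (D : set (E -> E)) (D' : set (E' -> E'))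
    (isoU : iso_data U V) (DD' : forall T, D T -> D' (conjop U V T)) :
  star_hom (conj_si DD').
Proof.
split=> [d1 d2 d3 e|a d1 d2 e|d1 d2 d3 e|d1 d2 adj] /=; rewrite ?e.
- by have := conjop_lin isoU 1 (\val d1) (\val d2); rewrite !scale1r => <-.
- by have := conjop_lin isoU a (\val d1) 0; rewrite (conjop0 isoU) !addr0.
- exact: conjop_comp.
- exact: conjop_adjoint.
Qed.

Lemma conj_siK (R : realType) (X Y : topologicalType) (E E' : corr R Y X)
    (U : E -> E') (V : E' -> E) (D : set (E -> E)) (D' : set (E' -> E'))
    (isoU : iso_data U V) (DD' : forall T, D T -> D' (conjop U V T))
    (D'D : forall T, D' T -> D (conjop V U T)) :
  cancel (conj_si DD') (conj_siV D'D).
Proof. by move=> d; apply: val_inj => /=; exact: conjopK. Qed.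

Definition conj_star_iso (R : realType) (X Y : topologicalType) (E E' : corr R Y X)
    (U : E -> E') (V : E' -> E) (D : set (E -> E)) (D' : set (E' -> E'))
    (isoU : iso_data U V) (DD' : forall T, D T -> D' (conjop U V T))
    (D'D : forall T, D' T -> D (conjop V U T)) : star_iso D D' :=
  @StarIso _ _ _ _ _ D D' (conj_si DD') (conj_si D'D)
    (conj_siK isoU DD' D'D) (conj_siK (iso_sym isoU) D'D DD')
    (conj_star_hom isoU DD') (conj_star_hom (iso_sym isoU) D'D).

Lemma VD_base_continuous (R : realType) (X Y : topologicalType) (c : tcorr R Y X)
    (lcX : locally_compact [set: X]) (T2X : hausdorff_space X)
    (D : set (Gamma0_corr c -> Gamma0_corr c)) (sH : symalg (symbols D))
    (DM : forall T, D T -> exists k, mult T k) :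
  continuous (@tbase R _ (VD D)).
Proof.
apply/continuousP => A oA.
(* Every element of the bundle lies in the tube about its own representative; any positive radius
   would do. *)
rewrite (_ : _ @^-1` A = \bigcup_(u in [set: Gamma0_corr c]) (VD_tube A u 1 : set (tot (VD D)))).
  by apply: bigcup_open => u _; exact: VD_tube_open.
apply/seteqP; split=> [[chi t] /= At|[chi t] [u _ []//]].
exists (vf t) => //; have [z cz] := spectrum_point lcX T2X sH DM chi.
apply/(VD_tubeE lcX T2X sH DM _ _ _ _ cz); split => //.
rewrite (_ : nx _ _ = 0)//; apply/nx_eq0 => w wz; rewrite /class_cut; case: asboolP => // _.
exact: subrr.
Qed.

Lemma nx_cut (R : realType) (X Y : topologicalType) (c : tcorr R Y X)
    (lcX : locally_compact [set: X]) (T2X : hausdorff_space X)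
    (D : set (Gamma0_corr c -> Gamma0_corr c)) (sH : symalg (symbols D))
    (DM : forall T, D T -> exists k, mult T k)
    (chi : spectrum D) z (d : D) (p : Gamma0_corr c) : at_point chi z -> lifts_minproj chi d ->
  nx (class_cut D z (G0_sec p)) (tc_s z) = nx (G0_sec (\val d p)) (tc_s z).
Proof.
move=> cz ld; have md := syP DM (dval d).
have [k1 k0] := (lifts_minprojE lcX T2X sH DM cz md).1 ld.
apply: nx_eq => w wz; rewrite md /class_cut; case: asboolP => zw; last by rewrite k0// scale0r.
by have [_ <-] := zw; [rewrite k1 scale1r|exact: (syH DM (dval d))].
Qed.

Section FiberFacts.
Variables (R : realType) (X Y : topologicalType) (c : tcorr R Y X).
Hypotheses (lcX : locally_compact [set: X]) (T2X : hausdorff_space X).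
Notation E := (Gamma0_corr c).
Variable D : set (E -> E).
Hypothesis sH : symalg (symbols D).
Hypothesis DM : forall T, D T -> exists k, mult T k.

Lemma vf_lift chi z (t : VD_fib chi) (d : D) w : at_point chi z -> lifts_minproj chi d ->
  tc_s w = tc_s z -> G0_sec (\val d (vf t)) w = G0_sec (vf t) w.
Proof.
move=> cz ld wz; have md := syP DM (dval d).
have [k1 k0] := (lifts_minprojE lcX T2X sH DM cz md).1 ld; rewrite md.
have [zw|nzw] := pselect (eqv (symbols D) z w); last first.
  by rewrite (vf_supp lcX T2X sH DM t cz wz nzw) scaler0.
by have [_ <-] := zw; [rewrite k1 scale1r|exact: (syH DM (dval d))].
Qed.

End FiberFacts.

Section IsoLocal.
Variables (R : realType) (X Y : topologicalType) (c c' : tcorr R Y X).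
Notation E := (Gamma0_corr c).
Notation E' := (Gamma0_corr c').
Variables (U : E -> E') (V : E' -> E).
Hypothesis isoU : iso_data U V.

Lemma nx_iso u x : nx (G0_sec (U u)) x = nx (G0_sec u) x.
Proof. exact: (fnorm_iso isoU). Qed.

(** [U] preserves the norm in each fiber over [X], so U (u - v) vanishes over [x] as soon as u - v
    does. *)
Lemma iso_local u v x : (forall z, tc_s z = x -> G0_sec u z = G0_sec v z) ->
  forall z', tc_s z' = x -> G0_sec (U u) z' = G0_sec (U v) z'.
Proof.
move=> uv z' zx; apply/eqP; rewrite -subr_eq0 -secB -(isoB isoU); apply/eqP.
apply: (nx_eq0 (G0_sec (U (u - v))) x).1 => //; rewrite nx_iso.
by apply/nx_eq0 => z /uv e; rewrite secB e subrr.
Qed.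

End IsoLocal.

Section GelfandDual.
Variables (R : realType) (X Y : topologicalType) (c c' : tcorr R Y X).
Hypotheses (lcX : locally_compact [set: X]) (T2X : hausdorff_space X).
Hypotheses (lcY : locally_compact [set: Y]) (T2Y : hausdorff_space Y).
Notation E := (Gamma0_corr c).
Notation E' := (Gamma0_corr c').
Variables (D : set (E -> E)) (D' : set (E' -> E')).
Hypothesis sH : symalg (symbols D).
Variable Pi : star_iso D D'.
Hypothesis iPi : intertwines Pi.

Lemma iota_mkd (f : C0 R X) : exists d : D, \val d = iota_op f.
Proof.
by have [d md] := sy_mkd (sa_s sH (C0_c0fun f)); exists d; apply: mult_inj md _; exact: mult_iota.
Qed.

Lemma phi_mkd (g : C0 R Y) : exists d : D, \val d = phi_op g.
Proof.
by have [d md] := sy_mkd (sa_r sH (C0_c0fun g)); exists d; apply: mult_inj md _; exact: mult_phi.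
Qed.

Lemma intertwines_s (chi : spectrum D') z z' : at_point chi z' ->
  at_point (gelfand_dual Pi chi) z -> tc_s z = tc_s z'.
Proof.
move=> cz' cz; apply: contrapT => ne.
have [f [f1 f0]] := C0_separates R lcX T2X ne; have [d df] := iota_mkd f.
have := cz d _; rewrite df => /(_ _ (mult_iota (c := c) f)).
have := cz' (Pi d) _; rewrite (iPi.1 f d df) => /(_ _ (mult_iota (c := c') f)).
by rewrite f1 f0 => e1 /eqP; rewrite -[ev _ d]/(ev chi (Pi d)) e1 eq_sym oner_eq0.
Qed.

Lemma intertwines_r (chi : spectrum D') z z' : at_point chi z' ->
  at_point (gelfand_dual Pi chi) z -> tc_r z = tc_r z'.
Proof.
move=> cz' cz; apply: contrapT => ne.
have [f [f1 f0]] := C0_separates R lcY T2Y ne; have [d df] := phi_mkd f.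
have := cz d _; rewrite df => /(_ _ (mult_phi (c := c) f)).
have := cz' (Pi d) _; rewrite (iPi.2 f d df) => /(_ _ (mult_phi (c := c') f)).
by rewrite f1 f0 => e1 /eqP; rewrite -[ev _ d]/(ev chi (Pi d)) e1 eq_sym oner_eq0.
Qed.

Lemma intertwines_sym : intertwines (star_iso_sym Pi).
Proof.
split=> [f d' df|g d' dg].
  have [d de] := iota_mkd f; have <- : Pi d = d' by apply: val_inj; rewrite /= df; exact: iPi.1.
  by rewrite /= si_funK.
have [d de] := phi_mkd g; have <- : Pi d = d' by apply: val_inj; rewrite /= dg; exact: iPi.2.
by rewrite /= si_funK.
Qed.

Lemma gelfand_dual_continuous : continuous (gelfand_dual Pi).
Proof.
apply: spectrum_continuous => d.
rewrite (_ : (fun v => _) = fun chi => ev chi (Pi d))//.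
exact: ev_continuous.
Qed.

End GelfandDual.

Section GelfandMaps.
Variables (R : realType) (X Y : topologicalType) (E E' : corr R Y X).
Variables (D : set (E -> E)) (D' : set (E' -> E')) (Pi : star_iso D D').

Lemma gelfand_dualK : cancel (gelfand_dual Pi) (gelfand_dual (star_iso_sym Pi)).
Proof.
move=> chi; apply: val_inj => /=; apply/funext => d.
by rewrite -[RHS]/(ev chi d) -[in RHS](si_invK Pi d).
Qed.

Lemma gelfand_dualVK : cancel (gelfand_dual (star_iso_sym Pi)) (gelfand_dual Pi).
Proof.
move=> chi; apply: val_inj => /=; apply/funext => d.
by rewrite -[RHS]/(ev chi d) -[in RHS](si_funK Pi d).
Qed.

End GelfandMaps.

Section IsoVD.
Variables (R : realType) (X Y : topologicalType) (c c' : tcorr R Y X).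
Hypotheses (lcX : locally_compact [set: X]) (T2X : hausdorff_space X).
Notation E := (Gamma0_corr c).
Notation E' := (Gamma0_corr c').
Variables (D : set (E -> E)) (D' : set (E' -> E')).
Hypotheses (sH : symalg (symbols D)) (sH' : symalg (symbols D')).
Hypothesis DM : forall T, D T -> exists k, mult T k.
Hypothesis DM' : forall T, D' T -> exists k, mult T k.
Variables (U : E -> E') (V : E' -> E).
Hypotheses (isoU : iso_data U V) (DD' : forall T, D T -> D' (conjop U V T)).
Hypothesis D'D : forall T, D' T -> D (conjop V U T).
Notation Pi := (conj_star_iso isoU DD' D'D).
Notation gd := (gelfand_dual (star_iso_sym Pi)).
Implicit Types (chi : spectrum D).

Lemma iso_intertwines : intertwines Pi.
Proof.
split=> [f d df|g d dg] /=; apply/funext => u.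
  by rewrite /conj_si/= df (conjop_iota f isoU).
by rewrite /conj_si/= dg (conjop_phi g isoU).
Qed.

Lemma gd_point chi z z' : at_point chi z -> at_point (gd chi) z' -> tc_s z' = tc_s z.
Proof. exact: (intertwines_s lcX T2X sH' (intertwines_sym sH iso_intertwines)). Qed.

(** Every character of D' is [gd] of one of D, evaluations correspond, and [gd] preserves the point
    of [X] underneath. Both conditions on a lift therefore carry over. *)
Lemma gd_lifts chi (d : D) : lifts_minproj chi d -> lifts_minproj (gd chi) (Pi d).
Proof.
have evE d' : ev (gd chi) (Pi d') = ev chi d'.
  by rewrite /ev/=; congr (sval chi _); exact: (conj_siK isoU DD' D'D).
move=> [c1 c0]; split; first by rewrite evE.
move=> w' sw nw; pose w := gelfand_dual Pi w'.
have gw : gd w = w'.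
  apply: spectrum_ext => d'; rewrite /ev/=; congr (sval w' _).
  exact: (conj_siK (iso_sym isoU) D'D DD').
have evw : ev w' (Pi d) = ev w d by [].
rewrite evw; apply: c0; last by move=> e; apply: nw; rewrite -gw e.
have [z cz] := spectrum_point lcX T2X sH DM chi.
have [a ca] := spectrum_point lcX T2X sH DM w.
have [z' cz'] := spectrum_point lcX T2X sH' DM' (gd chi).
have [a' ca'] := spectrum_point lcX T2X sH' DM' w'.
rewrite (sdualE lcX T2X sH ca) (sdualE lcX T2X sH cz).
rewrite (sdualE lcX T2X sH' ca') (sdualE lcX T2X sH' cz') in sw.
have ca'' : at_point (gd w) a' by rewrite gw.
by rewrite -(gd_point ca ca'') -(gd_point cz cz').
Qed.

(** The projection merely places U (vf t) in the type [VD_fib]; by [vf_iso_fib] it changes no value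
    along the fiber. *)
Definition iso_fib chi (t : VD_fib chi) : VD_fib (gd chi) :=
  pr lcX T2X sH' DM' (gd chi) (U (vf t)).
Definition iso_fibV chi (t : VD_fib (gd chi)) : VD_fib chi :=
  pr lcX T2X sH DM chi (V (vf t)).

(* U (vf t) is supported on the class of gd chi, since U d V lifts its projection. *)
Lemma vf_iso_fib chi z (t : VD_fib chi) w' : at_point chi z -> tc_s w' = tc_s z ->
  G0_sec (vf (iso_fib t)) w' = G0_sec (U (vf t)) w'.
Proof.
move=> cz wz; have [z' cz'] := spectrum_point lcX T2X sH' DM' (gd chi).
have wz' : tc_s w' = tc_s z' by rewrite (gd_point cz cz').
have [zw|nzw] := pselect (eqv (symbols D') z' w'); first by rewrite (vf_pr _ _ _ _ _ cz').
rewrite (vf_supp lcX T2X sH' DM' (iso_fib t) cz' wz' nzw).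
have [d ld] := lifts_exists lcX T2X sH DM chi.
have ld' := gd_lifts ld; have md' := syP DM' (dval (Pi d)).
have [k1 k0] := (lifts_minprojE lcX T2X sH' DM' cz' md').1 ld'.
have <- : G0_sec (\val (Pi d) (U (vf t))) w' = G0_sec (U (vf t)) w'.
  rewrite /=/conjop (iso_K isoU); apply: (iso_local isoU (x := tc_s z)) wz => w wz.
  exact: (vf_lift lcX T2X sH DM t cz ld wz).
by rewrite md' k0// scale0r.
Qed.

Lemma vf_iso_fibV chi z (t : VD_fib (gd chi)) w : at_point chi z -> tc_s w = tc_s z ->
  G0_sec (vf (iso_fibV t)) w = G0_sec (V (vf t)) w.
Proof.
move=> cz wz; have [z' cz'] := spectrum_point lcX T2X sH' DM' (gd chi).
have [zw|nzw] := pselect (eqv (symbols D) z w); first by rewrite (vf_pr _ _ _ _ _ cz).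
rewrite (vf_supp lcX T2X sH DM (iso_fibV t) cz wz nzw).
have [d ld] := lifts_exists lcX T2X sH DM chi; have md := syP DM (dval d).
have [k1 k0] := (lifts_minprojE lcX T2X sH DM cz md).1 ld.
have -> : G0_sec (V (vf t)) w = G0_sec (\val d (V (vf t))) w.
  rewrite -(iso_K isoU (\val d (V (vf t)))).
  apply: (iso_local (iso_sym isoU) (x := tc_s z)) wz => w' w'z.
  have w'z' : tc_s w' = tc_s z' by rewrite (gd_point cz cz').
  exact/esym/(vf_lift lcX T2X sH' DM' t cz' (gd_lifts ld) w'z').
by rewrite md k0// scale0r.
Qed.

Lemma iso_fibK chi : cancel (@iso_fib chi) (@iso_fibV chi).
Proof.
move=> t; have [z cz] := spectrum_point lcX T2X sH DM chi.
apply: (vf_inj lcX T2X sH cz) => w wz; rewrite (vf_iso_fibV _ cz wz).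
rewrite -[in RHS](iso_K isoU (vf t)).
apply: (iso_local (iso_sym isoU) (x := tc_s z)) wz => w' w'z.
exact: vf_iso_fib cz w'z.
Qed.

Lemma iso_fibVK chi : cancel (@iso_fibV chi) (@iso_fib chi).
Proof.
move=> t; have [z cz] := spectrum_point lcX T2X sH DM chi.
have [z' cz'] := spectrum_point lcX T2X sH' DM' (gd chi).
apply: (vf_inj lcX T2X sH' cz') => w' wz'.
have w'z : tc_s w' = tc_s z by rewrite wz' (gd_point cz cz').
rewrite (vf_iso_fib _ cz w'z) -[in RHS](iso_VK isoU (vf t)).
apply: (iso_local isoU (x := tc_s z)) w'z => w wz.
exact: vf_iso_fibV cz wz.
Qed.

Lemma iso_fib_linear chi : linear (@iso_fib chi).
Proof.
move=> a t t'; have [z cz] := spectrum_point lcX T2X sH DM chi.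
have [z' cz'] := spectrum_point lcX T2X sH' DM' (gd chi).
apply: (vf_inj lcX T2X sH' cz') => w' wz'.
have w'z : tc_s w' = tc_s z by rewrite wz' (gd_point cz cz').
rewrite (vf_lin lcX T2X sH' _ _ _ cz' wz') !(vf_iso_fib _ cz w'z).
rewrite -secZ -secD -(iso_lin isoU).
apply: (iso_local isoU (x := tc_s z)) w'z => w wz.
by rewrite (vf_lin lcX T2X sH _ _ _ cz wz) secD secZ.
Qed.

Definition iso_fib_lin chi : {linear VD D chi -> pullback gd (VD D') chi} :=
  HB.pack_for {linear VD D chi -> pullback gd (VD D') chi} (@iso_fib chi)
    (GRing.isLinear.Build _ _ _ _ (@iso_fib chi) (@iso_fib_linear chi)).

(** [U] is isometric on fibers and carries lifts of p_z to lifts, so tubes about [u] and about U u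
    correspond with the same radius. Continuity in both directions rests on this. *)
Lemma gd_tube chi z (t : VD_fib chi) (t' : VD_fib (gd chi)) (u : E) z' (e : R) :
  at_point chi z -> at_point (gd chi) z' ->
  (forall w', tc_s w' = tc_s z -> G0_sec (vf t') w' = G0_sec (U (vf t)) w') ->
  nx (class_cut D' z' (fun w => G0_sec (vf t') w - G0_sec (U u) w)) (tc_s z') =
  nx (class_cut D z (fun w => G0_sec (vf t) w - G0_sec u w)) (tc_s z).
Proof.
move=> cz cz' tt'; have [d ld] := lifts_exists lcX T2X sH DM chi.
rewrite (nx_cut lcX T2X sH DM (vf t - u) cz ld).
rewrite (nx_cut lcX T2X sH' DM' (vf t' - U u) cz' (gd_lifts ld)) (gd_point cz cz').
rewrite -(nx_iso isoU); apply: nx_eq => w' w'z.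
have md' := syP DM' (dval (Pi d)).
have -> : U (\val d (vf t - u)) = \val (Pi d) (U (vf t - u)) by rewrite /= /conjop (iso_K isoU).
by rewrite !md' (isoB isoU) !secB tt'.
Qed.

Lemma iso_vbundle : vbundle_iso (VD D) (pullback gd (VD D')).
Proof.
exists iso_fib_lin, iso_fibV; split.
- by move=> chi; exact: iso_fibK.
- by move=> chi; exact: iso_fibVK.
- apply: continuous_comp_initial.
  suff cg : continuous (fun t : tot (VD D) => @tpt R _ (VD D') (gd (projT1 t)) (iso_fib (projT2 t))).
    exact: (pair_continuous (VD_base_continuous lcX T2X sH DM) cg).
  apply: VD_continuous => W u e oW e0.
  rewrite (_ : _ @^-1` _ = VD_tube (gd @^-1` W) (V u) e).
    by apply: VD_tube_open => //; apply: open_comp => // ? _; exact: gelfand_dual_continuous.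
  apply/seteqP; rewrite /preimage/=; split=> -[chi v];
    have [z cz] := spectrum_point lcX T2X sH DM chi;
    have [z' cz'] := spectrum_point lcX T2X sH' DM' (gd chi).
    move=> /(VD_tubeE lcX T2X sH' DM' _ _ _ _ cz')[Wc lt]; apply/(VD_tubeE lcX T2X sH DM _ _ _ _ cz).
    split => //; rewrite -(@gd_tube chi z v (iso_fib v) (V u) z') ?(iso_VK isoU)//.
    by move=> w' w'z; exact: vf_iso_fib cz w'z.
  move=> /(VD_tubeE lcX T2X sH DM _ _ _ _ cz)[Wc lt]; apply/(VD_tubeE lcX T2X sH' DM' _ _ _ _ cz').
  split => //; rewrite -[u](iso_VK isoU) (@gd_tube chi z v (iso_fib v) (V u) z')//.
  by move=> w' w'z; exact: vf_iso_fib cz w'z.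
- apply: VD_continuous => W u e oW e0.
  pose j := fun t : {b : spectrum D & VD_fib (gd b)} =>
       (projT1 t, @tpt R _ (VD D') (gd (projT1 t)) (projT2 t)) : (spectrum D * tot (VD D'))%type.
  rewrite (_ : _ @^-1` _ = j @^-1` ((fst @^-1` W) `&` (snd @^-1` (VD_tube setT (U u) e)))).
    apply: (@initial_open _ _ j); apply: openI.
      by apply: (@open_comp _ _ fst) => // x _; exact: cvg_fst.
    apply: (@open_comp _ _ snd); first by move=> x _; exact: cvg_snd.
    by apply: VD_tube_open => //; exact: openT.
  apply/seteqP; rewrite /preimage/=; split=> -[chi v];
    have [z cz] := spectrum_point lcX T2X sH DM chi;
    have [z' cz'] := spectrum_point lcX T2X sH' DM' (gd chi).
    move=> /(VD_tubeE lcX T2X sH DM _ _ _ _ cz)[Wc lt]; split => //.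
    apply/(VD_tubeE lcX T2X sH' DM' _ _ _ _ cz'); split => //.
    rewrite (@gd_tube chi z (iso_fibV v) v u z')// => w' w'z.
    by rewrite -(vf_iso_fib _ cz w'z) iso_fibVK.
  move=> [Wc /(VD_tubeE lcX T2X sH' DM' _ _ _ _ cz')[_ lt]].
  apply/(VD_tubeE lcX T2X sH DM _ _ _ _ cz); split => //.
  rewrite -(@gd_tube chi z (iso_fibV v) v u z')// => w' w'z.
  by rewrite -(vf_iso_fib _ cz w'z) iso_fibVK.
Qed.

End IsoVD.

(** * Local conjugacy *)

(** An invertible matrix is square, and a nonzero determinant has a nonzero term in its Leibniz
    expansion. *)
Lemma biinvertible_transversal (K : fieldType) m n (A : 'M[K]_(m, n)) (B : 'M[K]_(n, m)) :
  A *m B = 1%:M -> B *m A = 1%:M ->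
  exists f : 'I_m -> 'I_n, exists g : 'I_n -> 'I_m,
    [/\ cancel f g, cancel g f & forall i, A i (f i) != 0].
Proof.
move=> AB BA; have mn : m = n by apply/eqP; rewrite eqn_leq (mulmx1_min AB) (mulmx1_min BA).
subst n; have : \det A != 0.
  apply/negP => /eqP dA; have := congr1 determinant AB.
  by rewrite det_mulmx dA mul0r det1 => /eqP; rewrite eq_sym oner_eq0.
move=> dA; have [p pP] : exists p : {perm 'I_m}, forall i, A i (p i) != 0.
  apply: contrapT => np; move/eqP: dA; apply; rewrite /determinant big1// => p _.
  have [i Ai0] : exists i, A i (p i) = 0.
    apply: contrapT => ni; apply: np; exists p => i; apply/negP => /eqP Ai.
    by apply: ni; exists i.
  by rewrite (bigD1 i)//= Ai0 mul0r mulr0.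
by exists p, (invF (@perm_inj _ p)); split => //; [exact: invF_f|exact: f_invF].
Qed.

Lemma sheet_map_continuous (R : realType) (X Y : topologicalType) (c c' : tcorr R Y X)
    (V V' W : set X) (sg : tc_Z c -> X -> tc_Z c) (sg' : tc_Z c' -> X -> tc_Z c')
    (lab : tc_Z c -> tc_Z c) (lab' : tc_Z c' -> tc_Z c') (F : tc_Z c -> tc_Z c') x0
    (phi : @tc_s _ _ _ c @^-1` W -> @tc_s _ _ _ c' @^-1` W) :
  W `<=` V `&` V' ->
  (forall a, V (tc_s a) -> lab a \in fib c x0 /\ sg (lab a) (tc_s a) = a) ->
  (forall a, V (tc_s a) -> \forall a' \near a, lab a' = lab a) ->
  (forall z, z \in fib c' x0 -> sg' z x0 = z /\
    forall x, V' x -> [/\ tc_s (sg' z x) = x, cont_at (sg' z) x & lab' (sg' z x) = z]) ->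
  (forall z, z \in fib c x0 -> F z \in fib c' x0) ->
  (forall a, \val (phi a) = sg' (F (lab (\val a))) (tc_s (\val a))) ->
  continuous phi.
Proof.
move=> WV H2 H3 H1' HF phiE; apply: continuous_comp_initial => a.
have Wa : W (tc_s (\val a)) by exact: set_mem (valP a).
have [Va V'a] := WV _ Wa; have [lf _] := H2 _ Va.
have [_ /(_ _ V'a)[_ cs _]] := H1' _ (HF _ lf).
have cv : continuous (fun a : @tc_s _ _ _ c @^-1` W => \val a) by exact: initial_continuous.
apply: (@cont_at_near _ _ (fun b : @tc_s _ _ _ c @^-1` W => sg' (F (lab (\val a))) (tc_s (\val b))) (set_val \o phi)).
  have : \forall b \near a, lab (\val b) = lab (\val a) by exact: (cv a _ (H3 _ Va)).
  by apply: filterS => b lb; rewrite /= -[RHS]/(\val (phi b)) phiE lb.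
apply: (cont_at_comp (f := fun b : @tc_s _ _ _ c @^-1` W => tc_s (\val b))) => //.
by apply: (cont_at_comp (f := fun b : @tc_s _ _ _ c @^-1` W => \val b)); [exact: cv|exact: s_cont].
Qed.

(** A bijection between the fibers over x0 acts on the labels of the sheets. Each point moves, over
    the same point of [X], to the sheet with the corresponding label, and this is continuous because
    labels are locally constant. *)
Lemma sheet_matching (R : realType) (X Y : topologicalType) (c c' : tcorr R Y X)
    (V V' W : set X) (sg : tc_Z c -> X -> tc_Z c) (sg' : tc_Z c' -> X -> tc_Z c')
    (lab : tc_Z c -> tc_Z c) (lab' : tc_Z c' -> tc_Z c')
    (F : tc_Z c -> tc_Z c') (G : tc_Z c' -> tc_Z c) x0 :
  W `<=` V `&` V' ->
  (forall z, z \in fib c x0 -> sg z x0 = z /\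
    forall x, V x -> [/\ tc_s (sg z x) = x, cont_at (sg z) x & lab (sg z x) = z]) ->
  (forall a, V (tc_s a) -> lab a \in fib c x0 /\ sg (lab a) (tc_s a) = a) ->
  (forall a, V (tc_s a) -> \forall a' \near a, lab a' = lab a) ->
  (forall z, z \in fib c' x0 -> sg' z x0 = z /\
    forall x, V' x -> [/\ tc_s (sg' z x) = x, cont_at (sg' z) x & lab' (sg' z x) = z]) ->
  (forall a, V' (tc_s a) -> lab' a \in fib c' x0 /\ sg' (lab' a) (tc_s a) = a) ->
  (forall a, V' (tc_s a) -> \forall a' \near a, lab' a' = lab' a) ->
  (forall z, z \in fib c x0 -> F z \in fib c' x0 /\ G (F z) = z) ->
  (forall z, z \in fib c' x0 -> G z \in fib c x0 /\ F (G z) = z) ->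
  (forall x z, W x -> z \in fib c x0 -> tc_r (sg' (F z) x) = tc_r (sg z x)) ->
  exists (phi : @tc_s _ _ _ c @^-1` W -> @tc_s _ _ _ c' @^-1` W)
         (psi : @tc_s _ _ _ c' @^-1` W -> @tc_s _ _ _ c @^-1` W),
      [/\ cancel phi psi, cancel psi phi, continuous phi, continuous psi &
          forall z, tc_s (\val (phi z)) = tc_s (\val z) /\
                    tc_r (\val (phi z)) = tc_r (\val z)].
Proof.
move=> WV H1 H2 H3 H1' H2' H3' HF HG Hr.
have Wv (d : tcorr R Y X) (a : @tc_s _ _ _ d @^-1` W) : W (tc_s (\val a)) by exact: set_mem (valP a).
have p1 (a : @tc_s _ _ _ c @^-1` W) : (@tc_s _ _ _ c' @^-1` W) (sg' (F (lab (\val a))) (tc_s (\val a))).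
  have Wa := Wv _ a; have [Va V'a] := WV _ Wa; have [lf _] := H2 _ Va.
  by have [_ /(_ _ V'a)[+ _ _]] := H1' _ (HF _ lf).1; rewrite /preimage /= => ->.
have p2 (a : @tc_s _ _ _ c' @^-1` W) : (@tc_s _ _ _ c @^-1` W) (sg (G (lab' (\val a))) (tc_s (\val a))).
  have Wa := Wv _ a; have [Va V'a] := WV _ Wa; have [lf _] := H2' _ V'a.
  by have [_ /(_ _ Va)[+ _ _]] := H1 _ (HG _ lf).1; rewrite /preimage /= => ->.
pose phi (a : @tc_s _ _ _ c @^-1` W) : @tc_s _ _ _ c' @^-1` W := exist _ (sg' (F (lab (\val a))) (tc_s (\val a))) (mem_set (p1 a)).
pose psi (a : @tc_s _ _ _ c' @^-1` W) : @tc_s _ _ _ c @^-1` W := exist _ (sg (G (lab' (\val a))) (tc_s (\val a))) (mem_set (p2 a)).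
exists phi, psi; split.
- move=> a; apply: val_inj => /=; have Wa := Wv _ a; have [Va V'a] := WV _ Wa.
  have [lf la] := H2 _ Va; have [_ /(_ _ V'a)[-> _ ->]] := H1' _ (HF _ lf).1.
  by rewrite (HF _ lf).2.
- move=> a; apply: val_inj => /=; have Wa := Wv _ a; have [Va V'a] := WV _ Wa.
  have [lf la] := H2' _ V'a; have [_ /(_ _ Va)[-> _ ->]] := H1 _ (HG _ lf).1.
  by rewrite (HG _ lf).2.
- by apply: (sheet_map_continuous WV H2 H3 H1' (F := F)) => // z /HF[].
- have WV' : W `<=` V' `&` V by move=> x /WV[].
  by apply: (sheet_map_continuous WV' H2' H3' H1 (F := G)) => // z /HG[].
- move=> a; have Wa := Wv _ a; have [Va V'a] := WV _ Wa; have [lf la] := H2 _ Va.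
  have [_ /(_ _ V'a)[ss _ _]] := H1' _ (HF _ lf).1; rewrite /=; split => //.
  by rewrite Hr// la.
Qed.

Section IsoConjugate.
Variables (R : realType) (X Y : topologicalType) (c c' : tcorr R Y X).
Hypotheses (lcX : locally_compact [set: X]) (T2X : hausdorff_space X).
Hypotheses (lcY : locally_compact [set: Y]) (T2Y : hausdorff_space Y).
Hypothesis s_surj : range (@tc_s R Y X c) = [set: X].
Hypothesis s'_surj : range (@tc_s R Y X c') = [set: X].
Notation C := (cplx R).
Notation E := (Gamma0_corr c).
Notation E' := (Gamma0_corr c').
Notation h := (lb_met (h := tc_L _)).

Definition fpt (d : tcorr R Y X) (x : X) (i : 'I_(size (fib d x))) : tc_Z d := tnth (in_tuple (fib d x)) i.

Lemma fpt_mem (d : tcorr R Y X) x i : @fpt d x i \in fib d x. Proof. exact: mem_tnth. Qed.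
Lemma fpt_s (d : tcorr R Y X) x i : tc_s (@fpt d x i) = x.
Proof. exact/mem_fib/fpt_mem. Qed.
Lemma fpt_inj (d : tcorr R Y X) x : injective (@fpt d x).
Proof. by apply/tuple_uniqP; exact: fib_uniq. Qed.
Lemma fpt_surj (d : tcorr R Y X) x z : z \in fib d x -> exists i, @fpt d x i = z.
Proof.
move=> zf; have : z \in in_tuple (fib d x) by [].
by case/tnthP => i ->; exists i.
Qed.

Definition frame_at (d : tcorr R Y X) (x : X) (i : 'I_(size (fib d x))) (p : Gamma0 d) : Prop :=
  [/\ \forall a \near fpt i, G0_sec p a <> 0,
    forall v : tc_L d (fpt i), v = h (G0_sec p (fpt i)) v *: G0_sec p (fpt i),
    h (G0_sec p (fpt i)) (G0_sec p (fpt i)) = 1,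
    forall a b, tc_s a = tc_s b -> G0_sec p a <> 0 -> G0_sec p b <> 0 -> a = b &
    forall j : 'I_(size (fib d x)), i <> j -> G0_sec p (fpt j) = 0].

Lemma fiber_frame (d : tcorr R Y X) x : exists p : 'I_(size (fib d x)) -> Gamma0 d,
  forall i, frame_at i (p i).
Proof.
suff H i : exists p, @frame_at d x i p by have /choice[p pP] := H; exists p.
have [p [np pe _ pinj]] := unit_section (@filterT _ (nbhs (fpt i)) _).
have [p1 pv] := nbhs_singleton np.
have pn0 : G0_sec p (fpt i) <> 0.
  by move=> p0; move: p1; rewrite p0 hl0 => /eqP; rewrite eq_sym oner_eq0.
exists p; split => //.
- by apply: sec_ne0 => //; exact: G0_cont.
- move=> j ij; apply: contrapT => pj; apply: ij; apply: fpt_inj; apply: pinj => //.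
  by rewrite !fpt_s.
Qed.

Lemma sec_sum (d : tcorr R Y X) (I : Type) (l : seq I) (f : I -> Gamma0 d) z :
  G0_sec (\sum_(i <- l) f i) z = \sum_(i <- l) G0_sec (f i) z.
Proof. by elim: l => [|i l IH]; [rewrite !big_nil|rewrite !big_cons secD IH]. Qed.

Lemma iso_sum (d d' : corr R Y X) (U : d -> d') (V : d' -> d) (I : Type) (l : seq I)
    (a : I -> C) (f : I -> d) : iso_data U V ->
  U (\sum_(i <- l) a i *: f i) = \sum_(i <- l) a i *: U (f i).
Proof.
move=> isoU; elim: l => [|i l IH]; last by rewrite !big_cons (iso_lin isoU) IH.
rewrite !big_nil; have := iso_lin isoU 1 0 0; rewrite !scale1r addr0 -[LHS]addr0 => /addrI e.
exact/esym.
Qed.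

(** Row i of the first matrix holds the coordinates of U (p i) over [x]. With images in rows,
    applying [V] after [U] is the product in the order shown. *)
Lemma iso_matrix (d d' : tcorr R Y X) (U : Gamma0_corr d -> Gamma0_corr d')
    (V : Gamma0_corr d' -> Gamma0_corr d) x
    (p : 'I_(size (fib d x)) -> Gamma0 d) (p' : 'I_(size (fib d' x)) -> Gamma0 d') :
  iso_data U V -> (forall i, frame_at i (p i)) -> (forall i, frame_at i (p' i)) ->
  (\matrix_(i, j) h (G0_sec (p' j) (fpt j)) (G0_sec (U (p i)) (fpt j))) *m
  (\matrix_(j, i) h (G0_sec (p i) (fpt i)) (G0_sec (V (p' j)) (fpt i))) = 1%:M.
Proof.
move=> iU pP p'P; apply/matrixP => i k; rewrite !mxE.
under eq_bigr => j _ do rewrite !mxE.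
pose a j := h (G0_sec (p' j) (fpt j)) (G0_sec (U (p i)) (fpt j)).
have E1 z' : tc_s z' = x -> G0_sec (U (p i)) z' = G0_sec (\sum_j a j *: p' j) z'.
  move=> /mem_fib/fpt_surj[k' <-]; rewrite sec_sum.
  under eq_bigr do rewrite secZ.
  rewrite (bigD1 k')// big1 ?addr0; last first.
    by move=> j /eqP jk; have [_ _ _ _ ->] := p'P j; rewrite ?scaler0.
  by have [_ pv _ _ _] := p'P k'; etransitivity; [exact: pv|exact/esym/addr0].
have := iso_local (iso_sym iU) E1 (fpt_s k); rewrite (iso_K iU).
rewrite (iso_sum _ _ _ (iso_sym iU)) sec_sum => /(congr1 (h (G0_sec (p k) (fpt k)))).
have -> : h (G0_sec (p k) (fpt k)) (G0_sec (p i) (fpt k)) = (i == k)%:R.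
  have [->|/eqP ik] := eqVneq i k; first by have [_ _ ->] := pP k.
  by have [_ _ _ _ ->] := pP i; rewrite ?met_r0.
move=> ->; elim: (index_enum _) => [|j l IH]; first by rewrite !big_nil met_r0.
by rewrite !big_cons hDr secZ hZr IH.
Qed.

Lemma iso_locally_conjugate (U : E -> E') (V : E' -> E) :
  iso_data U V -> locally_conjugate c c'.
Proof.
move=> iU x0; have iV := iso_sym iU.
have [p pP] := fiber_frame c x0; have [p' p'P] := fiber_frame c' x0.
have [f [g [fK gK Af]]] := biinvertible_transversal
  (iso_matrix iU pP p'P) (iso_matrix iV p'P pP).
have [V1 [sg [lab [[oV Vx] H1 H2 H3]]]] := local_sheets lcX T2X s_surj x0.
have [V1' [sg' [lab' [[oV' Vx'] H1' H2' H3']]]] := local_sheets lcX T2X s'_surj x0.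
have n1 : \forall x \near x0, forall i, i \in enum 'I_(size (fib c x0)) ->
    G0_sec (p i) (sg (fpt i) x) <> 0 /\ G0_sec (U (p i)) (sg' (fpt (f i)) x) <> 0.
  apply: near_all => i _.
  have [s0 /(_ _ Vx)[_ cs _]] := H1 _ (fpt_mem i).
  have [s0' /(_ _ Vx')[_ cs' _]] := H1' _ (fpt_mem (f i)).
  have na : \forall x \near x0, G0_sec (p i) (sg (fpt i) x) <> 0.
    by apply: (cont_at_nbhs (A := [set a | G0_sec (p i) a <> 0]) cs); rewrite s0; have [] := pP i.
  have nb : \forall x \near x0, G0_sec (U (p i)) (sg' (fpt (f i)) x) <> 0.
    apply: (cont_at_nbhs (A := [set a | G0_sec (U (p i)) a <> 0]) cs'); rewrite s0'.
    apply: sec_ne0; first exact: G0_cont.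
    by move=> U0; move: (Af i); rewrite mxE U0 met_r0 eqxx.
  by near=> x; split; near: x.
have nW : nbhs x0 (V1 `&` V1' `&` [set x | forall i,
    G0_sec (p i) (sg (fpt i) x) <> 0 /\ G0_sec (U (p i)) (sg' (fpt (f i)) x) <> 0]).
  apply: filterI; first by apply: filterI; exact: open_nbhs_nbhs.
  by apply: filterS n1 => x nx i; apply: nx; rewrite mem_enum.
move: nW; rewrite nbhsE => -[W [oW Wx] WV].
(* Were the two values of [r] different, a function on [Y] would annihilate p i over [x], hence also
   U (p i) there, while being 1 at the point of the matched sheet where U (p i) is nonzero. *)
have rr x i : W x -> tc_r (sg' (fpt (f i)) x) = tc_r (sg (fpt i) x).
  move=> /WV[[V1x V1'x] /(_ i)[pn Un]]; apply: contrapT => ne.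
  have [_ /(_ _ V1x)[ss _ _]] := H1 _ (fpt_mem i).
  have [_ /(_ _ V1'x)[ss' _ _]] := H1' _ (fpt_mem (f i)).
  have [k [k1 k0]] := C0_separates R lcY T2Y ne.
  have z0 (z : tc_Z c) : tc_s z = x -> G0_sec (lact k (p i : E) : E) z = G0_sec (0 : E) z.
    move=> zx; rewrite sec0; have [pz|pz] := pselect (G0_sec (p i) z = 0).
      by rewrite [LHS](_ : _ = k (tc_r z) *: G0_sec (p i) z)// pz scaler0.
    have [_ _ _ pinj _] := pP i.
    rewrite (pinj z (sg (fpt i) x))//; last by rewrite ss.
    by rewrite [LHS](_ : _ = k (tc_r (sg (fpt i) x)) *: G0_sec (p i) (sg (fpt i) x))// k0 scale0r.
  have := iso_local iU z0 ss'; rewrite (iso_lact iU).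
  rewrite [LHS](_ : _ = k (tc_r (sg' (fpt (f i)) x)) *: G0_sec (U (p i)) (sg' (fpt (f i)) x))//.
  rewrite k1 scale1r; have -> : U 0 = 0.
    by have := iso_lin iU 1 0 0; rewrite !scale1r addr0 -[LHS]addr0 => /addrI.
  by rewrite sec0.
have [z0 _] := fib_surj s_surj x0; have [z0' _] := fib_surj s'_surj x0.
pose F z := xget z0' [set z' | exists2 i, z = fpt i & z' = fpt (f i)].
pose G z' := xget z0 [set z | exists2 i, z' = fpt i & z = fpt (g i)].
have FP i : F (fpt i) = fpt (f i).
  rewrite /F; case: xgetP => [_ -> [j /fpt_inj -> ->]//|/(_ (fpt (f i)))].
  by case; exists i.
have GP i : G (fpt i) = fpt (g i).
  rewrite /G; case: xgetP => [_ -> [j /fpt_inj -> ->]//|/(_ (fpt (g i)))].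
  by case; exists i.
exists W => //.
apply: (sheet_matching (F := F) (G := G) _ H1 H2 H3 H1' H2' H3').
- by move=> x /WV[[]].
- move=> z /fpt_surj[i <-]; rewrite FP GP fK; split => //; exact: fpt_mem.
- move=> z /fpt_surj[i <-]; rewrite GP FP gK; split => //; exact: fpt_mem.
- by move=> x z Wx' /fpt_surj[i <-]; rewrite FP; exact: rr.
Unshelve. all: by end_near. Qed.

End IsoConjugate.

(** * Polar decomposition *)

Section ReIm.
Variable R : realType.
Implicit Types a b : cplx R.

Lemma imB a b : complex.Im (a - b) = complex.Im a - complex.Im b.
Proof. by case: a => [a1 a2]; case: b. Qed.

Lemma re_abs a : `|complex.Re a| <= nc a.
Proof.
case: a => a1 a2; rewrite /nc /ComplexField.Normc.normc /= -sqrtr_sqr.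
by rewrite ler_wsqrtr// lerDl sqr_ge0.
Qed.

Lemma im_abs a : `|complex.Im a| <= nc a.
Proof.
case: a => a1 a2; rewrite /nc /ComplexField.Normc.normc /= -sqrtr_sqr.
by rewrite ler_wsqrtr// lerDr sqr_ge0.
Qed.

Lemma nc_le_reim a : nc a <= `|complex.Re a| + `|complex.Im a|.
Proof.
case: a => a1 a2; rewrite /nc /ComplexField.Normc.normc /=.
rewrite -[leRHS]ger0_norm ?addr_ge0// -sqrtr_sqr ler_wsqrtr//.
rewrite sqrrD !real_normK ?num_real// -addrA lerD2l lerDr.
by rewrite mulrn_wge0// mulr_ge0.
Qed.

End ReIm.

Lemma small_all (R : realType) (q r M : R) : 0 <= q -> q < 1 -> 0 <= r ->
  (forall k, r <= M * q ^+ k) -> r = 0.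
Proof.
move=> q0 q1; rewrite le_eqVlt => /predU1P[<-//|rp] rM; exfalso.
have M0 : 0 < M by have := rM 0%N; rewrite expr0 mulr1; exact: lt_le_trans.
have [k qk] := geom_small q0 q1 (divr_gt0 rp M0).
have := rM k; rewrite leNgt => /negP; apply.
by rewrite mulrC -ltr_pdivlMr.
Qed.

Lemma geom_cauchy (R : realType) (x : nat -> cplx R) (M q : R) : 0 <= q -> q < 1 -> 0 <= M ->
  (forall k, nc (x k.+1 - x k) <= q ^+ k * M) ->
  forall k m, nc (x (k + m)%N - x k) <= q ^+ k / (1 - q) * M.
Proof.
move=> q0 q1 M0 xk k m; have q10 : 0 < 1 - q by rewrite subr_gt0.
suff : nc (x (k + m)%N - x k) <= q ^+ k * (1 - q ^+ m) / (1 - q) * M.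
  move=> H; apply: le_trans H _; apply: ler_wpM2r => //; apply: ler_wpM2r.
    by rewrite invr_ge0 ltW.
  by rewrite ler_piMr ?exprn_ge0// gerBl exprn_ge0.
elim: m => [|m IH]; first by rewrite addn0 subrr nc0 expr0 subrr mulr0 !mul0r.
rewrite addnS.
have -> : x (k + m).+1 - x k = (x (k + m).+1 - x (k + m)%N) + (x (k + m)%N - x k) by ring.
apply: le_trans (ncD _ _) _; apply: le_trans (lerD (xk _) IH) _.
rewrite le_eqVlt; apply/orP; left; apply/eqP.
by rewrite exprD exprS; field; rewrite gt_eqF.
Qed.

(** Completeness is taken from the reals: real and imaginary parts converge separately, being
    1-Lipschitz, and the tail estimate of [geom_cauchy] passes to the limit. *)
Lemma geom_limit (R : realType) (x : nat -> cplx R) (M q : R) : 0 <= q -> q < 1 -> 0 <= M ->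
  (forall k, nc (x k.+1 - x k) <= q ^+ k * M) ->
  exists l, forall k, nc (l - x k) <= q ^+ k / (1 - q) * M.
Proof.
move=> q0 q1 M0 xk; have xc := geom_cauchy q0 q1 M0 xk.
have q10 : 0 < 1 - q by rewrite subr_gt0.
have lim (f : cplx R -> R) : (forall a b, `|f a - f b| <= nc (a - b)) ->
    exists l : R, forall e, 0 < e -> \forall k \near \oo, `|l - f (x k)| < e.
  move=> fL; have cf : cvgn (fun k => f (x k)).
    apply/cauchy_cvgP/cauchy_exP => e e0.
    pose M' := M / (1 - q) + 1.
    have M'0 : 0 < M' by rewrite ltr_wpDl// divr_ge0// ltW.
    have [N qN] := geom_small q0 q1 (divr_gt0 (divr_gt0 e0 (ltr0n R 2)) M'0).
    have small k : (N <= k)%N -> `|f (x k) - f (x N)| < e / 2.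
      move=> Nk; apply: le_lt_trans (fL _ _) _; rewrite -(subnKC Nk).
      apply: le_lt_trans (xc _ _) _; rewrite ltr_pdivlMr// in qN.
      apply: le_lt_trans qN; rewrite /M' mulrAC -mulrA.
      by rewrite ler_wpM2l ?exprn_ge0// lerDl.
    exists (f (x N)); exists N => // k /= Nk.
    by rewrite -ball_normE /ball_ /= distrC; apply: lt_trans (small _ Nk) _; rewrite ltr_pdivrMr// ltr_pMr// ltr1n.
  exists (limn (fun k => f (x k))) => e e0.
  by move/cvgrPdist_lt : cf; exact.
have [|a aP] := lim (@complex.Re R).
  by move=> u v; rewrite -[X in `|X|](reB u v); exact: re_abs.
have [|b bP] := lim (@complex.Im R).
  by move=> u v; rewrite -imB; exact: im_abs.
exists (Complex a b) => k; apply/ler_addgt0Pr => e e0.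
have e2 : 0 < e / 2 by rewrite divr_gt0.
have : \forall m \near \oo, nc (Complex a b - x k) <= q ^+ k / (1 - q) * M + e.
  near=> m; have km : (k <= m)%N by near: m; exists k.
  have -> : Complex a b - x k = (Complex a b - x m) + (x m - x k) by ring.
  apply: le_trans (ncD _ _) _; rewrite addrC; apply: lerD.
    by rewrite -(subnKC km).
  apply: le_trans (nc_le_reim _) _; rewrite (splitr e) ltW//.
  have am : `|a - complex.Re (x m)| < e / 2 by near: m; exact: aP.
  have bm : `|b - complex.Im (x m)| < e / 2 by near: m; exact: bP.
  by rewrite imB -[complex.Re _]/(re _) reB; exact: ltrD.
by move=> [m _ /(_ m (leqnn m))].
Unshelve. all: by end_near. Qed.

(** * Sums and unit vectors along the fibers of s *)

Section FiberSum.
Variables (R : realType) (X Y : topologicalType) (c : tcorr R Y X).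
Hypotheses (lcX : locally_compact [set: X]) (T2X : hausdorff_space X).
Hypothesis s_surj : range (@tc_s R Y X c) = [set: X].
Notation Z := (tc_Z c).
Notation L := (tc_L c).
Notation s := (@tc_s R Y X c).
Notation h := (lb_met (h := L)).
Implicit Types (u v : sections L) (x : X) (z w : Z).

Lemma fiber_sum_cont_at (g : Z -> R) x : (forall z, s z = x -> cont_at g z) ->
  cont_at (fun y => \sum_(z <- fib c y) g z) x.
Proof.
move=> cg; have [V [sg [lab [[oV Vx] H1 H2 _]]]] := local_sheets lcX T2X s_surj x.
apply: (cont_at_near (f := fun y => re (\sum_(z <- fib c x) rC (g (sg z y))))).
  near=> y; have Vy : V y by near: y; exact: open_nbhs_nbhs.
  rewrite [RHS](perm_big _ (fiber_ip_sheets H1 H2 Vy)) big_map.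
  elim: (fib c x) => [|z l IH]; first by rewrite !big_nil.
  by rewrite !big_cons reD IH re_rC.
apply: cont_at_re; apply: cont_at_sum => z zf; have [z0 /(_ x Vx)[_ cs _]] := H1 z zf.
apply: (@cont_at_comp _ _ _ (sg z) (fun a => rC (g a))) => //.
by apply: cont_at_rC; rewrite z0; apply: cg; exact/mem_fib.
Unshelve. all: by end_near. Qed.

Lemma nx_le_sum u x : nx u x <= \sum_(z <- fib c x) lnrm (u z).
Proof.
have H (l : seq Z) : \sum_(z <- l) lnrm (u z) ^+ 2 <= (\sum_(z <- l) lnrm (u z)) ^+ 2 /\
    0 <= \sum_(z <- l) lnrm (u z).
  elim: l => [|z l [IH I0]]; first by rewrite !big_nil expr0n.
  rewrite !big_cons; have z0 := lnrm_ge0 (u z); split; last exact: addr_ge0.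
  by rewrite sqrrD -addrA lerD2l ler_wpDl// mulrn_wge0// mulr_ge0.
have [Hs H0] := H (fib c x).
by rewrite -(ler_pXn2r (n := 2)) ?nnegrE ?nx_ge0// nx_sum.
Qed.

Fact unit_at_subproof z : exists p : Gamma0_corr c,
  [/\ h (G0_sec p z) (G0_sec p z) = 1, forall v : L z, v = h (G0_sec p z) v *: G0_sec p z &
      forall w, s w = s z -> w <> z -> G0_sec p w = 0].
Proof.
have [p [/nbhs_singleton[p1 pv] _ _ pinj]] := unit_section (@filterT _ (nbhs z) _).
exists p; split => // w wz ne; apply: contrapT => pw; apply: ne; apply: pinj => //.
by move=> p0; move: p1; rewrite p0 hl0 => /eqP; rewrite eq_sym oner_eq0.
Qed.

(* On the fiber of s through z, a unit vector supported at z. *)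
Definition unit_at z : sections L := G0_sec (projT1 (cid (unit_at_subproof z))).

Lemma unit_at1 z : h (unit_at z z) (unit_at z z) = 1.
Proof. by rewrite /unit_at; case: cid => p []. Qed.
Lemma unit_atE z (v : L z) : v = h (unit_at z z) v *: unit_at z z.
Proof. by move: v; rewrite /unit_at; case: cid => p []. Qed.
Lemma unit_at0 z w : s w = s z -> w <> z -> unit_at z w = 0.
Proof. by rewrite /unit_at; case: cid => p [/= _ _ p0]; exact: p0. Qed.

Lemma unit_at_lcoord z (v w : L z) : h (unit_at z z) v = h (unit_at z z) w -> v = w.
Proof. by move=> e; rewrite (unit_atE v) e -unit_atE. Qed.

Lemma nc_coord z (v : L z) : nc (h (unit_at z z) v) = lnrm v.
Proof. by rewrite [in RHS](unit_atE v) lnrmZ (lnrm_unit (unit_at1 z)) mulr1. Qed.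

Lemma fiber_expand u x w : s w = x ->
  u w = (\sum_(z <- fib c x) h (unit_at z z) (u z) *: unit_at z) w.
Proof.
move=> wx; have wf : w \in fib c x by exact/mem_fib.
have E (l : seq Z) : (\sum_(z <- l) h (unit_at z z) (u z) *: unit_at z) w =
    \sum_(z <- l) h (unit_at z z) (u z) *: unit_at z w.
  by elim: l => [|z l IH]; [rewrite !big_nil|rewrite !big_cons -IH].
rewrite E (bigD1_seq w)//= ?fib_uniq// -unit_atE big_seq_cond big1 ?addr0//.
move=> z /andP[/mem_fib zx zw]; rewrite (@unit_at0 z w) ?scaler0 ?zx//.
by move=> e; rewrite e eqxx in zw.
Qed.

End FiberSum.

(** * Bundle maps, adjoints and fiberwise bounds *)

Section BundleMap.
Variables (R : realType) (X Y : topologicalType).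
Notation C := (cplx R).
Notation h := (lb_met (h := tc_L _)).
Implicit Types (c : tcorr R Y X).

(* Indicator functions of points of X in bm_act make W a family of linear maps between
   the spaces of sections over the fibers of s and s'; those of points of Y make it
   commute with the left actions. *)
Record bmap c c' (W : sections (tc_L c) -> sections (tc_L c')) : Prop := Bmap {
  bm_lin : forall (a : C) u v, W (a *: u + v) = a *: W u + W v;
  bm_act : forall (a : X -> Y -> C) u z',
    W (fun z => a (tc_s z) (tc_r z) *: u z) z' = a (tc_s z') (tc_r z') *: W u z';
  bm_cont : forall u, sec_cont u -> sec_cont (W u) }.

Lemma bm_local c c' W u v x : @bmap c c' W -> (forall z, tc_s z = x -> u z = v z) ->
  forall z', tc_s z' = x -> W u z' = W v z'.
Proof.
move=> bW uv z' zx; pose a (y : X) (_ : Y) : C := if `[< y = x >] then 1 else 0.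
have az : a (tc_s z') (tc_r z') = 1 by rewrite /a; case: asboolP.
have := bm_act bW a u z'; have := bm_act bW a v z'; rewrite az !scale1r => <- <-.
congr (W _ z'); apply: functional_extensionality_dep => z; rewrite /a.
by case: asboolP => [/uv ->//|_]; rewrite !scale0r.
Qed.

Lemma bmD c c' W u v : @bmap c c' W -> W (u + v) = W u + W v.
Proof. by move=> bW; have := bm_lin bW 1 u v; rewrite !scale1r. Qed.

Lemma bm0 c c' W : @bmap c c' W -> W 0 = 0.
Proof. by move=> bW; have := bmD 0 0 bW; rewrite addr0 -[LHS]addr0 => /addrI/esym. Qed.

Lemma bmZ c c' W a u : @bmap c c' W -> W (a *: u) = a *: W u.
Proof. by move=> bW; have := bm_lin bW a u 0; rewrite (bm0 bW) !addr0. Qed.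

Lemma bmB c c' W u v : @bmap c c' W -> W (u - v) = W u - W v.
Proof. by move=> bW; rewrite (bmD _ _ bW) -scaleN1r (bmZ _ _ bW) scaleN1r. Qed.

Lemma bm_sum c c' W (I : Type) (l : seq I) (a : I -> C) f : @bmap c c' W ->
  W (\sum_(i <- l) a i *: f i) = \sum_(i <- l) a i *: W (f i).
Proof.
move=> bW; elim: l => [|i l IH]; first by rewrite !big_nil (bm0 bW).
by rewrite !big_cons (bm_lin bW) IH.
Qed.

Lemma bmap_id c : @bmap c c id.
Proof. by []. Qed.

Lemma bmap_comp c1 c2 c3 W V : @bmap c2 c3 V -> @bmap c1 c2 W -> bmap (V \o W).
Proof.
move=> bV bW; split=> [a u v|a u z|u cu] /=.
- by rewrite (bm_lin bW) (bm_lin bV).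
- rewrite -(bm_act bV); congr (V _ z); apply: functional_extensionality_dep => z'.
  exact: bm_act bW a u z'.
- exact/(bm_cont bV)/(bm_cont bW).
Qed.

Lemma bmap_comb c c' W V (a : C) : @bmap c c' W -> @bmap c c' V ->
  bmap (fun u => a *: W u + V u).
Proof.
move=> bW bV; split=> [b u v|b u z|u cu] /=.
- rewrite (bm_lin bW) (bm_lin bV) !scalerDr !scalerA (mulrC a) -!addrA; congr (_ + _).
  by rewrite !addrA; congr (_ + _); rewrite addrC.
- rewrite -[LHS]/(a *: W _ z + V _ z) (bm_act bW) (bm_act bV).
  rewrite -[RHS]/(b _ _ *: (a *: W u z + V u z)).
  by rewrite scalerDr !scalerA (mulrC a).
- move=> z; apply: (sec_cont_at_lin (a := fun=> a)); first exact: cont_at_cst.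
    exact: bm_cont bW _ cu z.
  exact: bm_cont bV _ cu z.
Qed.

Lemma bmap_scale c c' W (f : X -> C) : (forall x, cont_at f x) -> @bmap c c' W ->
  bmap (fun u z' => f (tc_s z') *: W u z').
Proof.
move=> cf bW; split=> [b u v|b u z|u cu z] /=.
- apply: functional_extensionality_dep => z; rewrite (bm_lin bW).
  rewrite -[LHS]/(_ *: (b *: W u z + W v z)).
  rewrite -[RHS]/(b *: (f (tc_s z) *: W u z) + f (tc_s z) *: W v z).
  by rewrite scalerDr !scalerA (mulrC b).
- by rewrite (bm_act bW) !scalerA mulrC.
- apply: sec_cont_atZ; last exact: bm_cont bW _ cu z.
  by apply: cont_at_comp (cf _); exact: s_cont.
Qed.

Definition adjp c c' (A : sections (tc_L c) -> sections (tc_L c'))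
    (B : sections (tc_L c') -> sections (tc_L c)) : Prop :=
  forall u v x, fiber_ip (A u) v x = fiber_ip u (B v) x.

Lemma adjp_sym c c' A B : @adjp c c' A B -> adjp B A.
Proof. by move=> AB u v x; rewrite fip_conj -AB -fip_conj. Qed.

End BundleMap.

Section Adjoint.
Variables (R : realType) (X Y : topologicalType) (c c' : tcorr R Y X).
Hypotheses (lcX : locally_compact [set: X]) (T2X : hausdorff_space X).
Hypothesis s_surj : range (@tc_s R Y X c) = [set: X].
Hypothesis s'_surj : range (@tc_s R Y X c') = [set: X].
Notation C := (cplx R).
Notation h := (lb_met (h := tc_L _)).
Variable W : sections (tc_L c) -> sections (tc_L c').
Hypothesis bW : bmap W.

Lemma fip_linl (d : tcorr R Y X) x (a : C) (u v w : sections (tc_L d)) :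
  fiber_ip (a *: u + v) w x = a^* * fiber_ip u w x + fiber_ip v w x.
Proof. by rewrite fip_conj fip_linr rmorphD rmorphM /= -(fip_conj x w u) -(fip_conj x w v). Qed.

Lemma fip_l0 (d : tcorr R Y X) x (w : sections (tc_L d)) : fiber_ip 0 w x = 0.
Proof.
have := fip_linl x 1 0 0 w; rewrite scale1r addr0 conjC1 mul1r => e.
by apply: (addrI (fiber_ip 0 w x)); rewrite addr0; exact/esym.
Qed.

Lemma fip_subl (d : tcorr R Y X) x (u v w : sections (tc_L d)) :
  fiber_ip (u - v) w x = fiber_ip u w x - fiber_ip v w x.
Proof. by have := fip_linl x (-1) v u w; rewrite conjCN1 mulN1r scaleN1r addrC => ->; rewrite addrC. Qed.

Lemma fip_subr (d : tcorr R Y X) x (u v w : sections (tc_L d)) :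
  fiber_ip w (u - v) x = fiber_ip w u x - fiber_ip w v x.
Proof. by have := fip_linr x w (-1) v u; rewrite mulN1r scaleN1r addrC => ->; rewrite addrC. Qed.

Lemma fip_suml (d : tcorr R Y X) x (I : Type) (l : seq I) (a : I -> C)
    (f : I -> sections (tc_L d)) w :
  fiber_ip (\sum_(i <- l) a i *: f i) w x = \sum_(i <- l) (a i)^* * fiber_ip (f i) w x.
Proof.
elim: l => [|i l IH]; last by rewrite !big_cons fip_linl IH.
by rewrite !big_nil fip_l0.
Qed.

(** [unit_at] is chosen point by point and depends on [z] in no continuous way. A continuous unit
    section differs from it by a phase only, which cancels in [adj] and [opbound]; this gives their
    continuity. *)
Lemma unit_at_phase (p : Gamma0_corr c) z : h (G0_sec p z) (G0_sec p z) = 1 ->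
  (forall a b, tc_s a = tc_s b -> G0_sec p a <> 0 -> G0_sec p b <> 0 -> a = b) ->
  exists2 t : C, t^* * t = 1 & G0_sec p z = t *: unit_at z z /\
    forall z', tc_s z' = tc_s z -> W (G0_sec p) z' = t *: W (unit_at z) z'.
Proof.
move=> p1 pinj; exists (h (unit_at z z) (G0_sec p z)).
  by have := p1; rewrite {1 2}(unit_atE (G0_sec p z)) hZl hZr unit_at1 mulr1.
have pz : G0_sec p z = h (unit_at z z) (G0_sec p z) *: unit_at z z by exact: unit_atE.
split => // z' zz; rewrite -[RHS]/((_ *: W (unit_at z)) z') -(bmZ _ _ bW).
apply: (bm_local bW _ zz) => w wz; have [->//|/eqP ne] := eqVneq w z.
have -> : G0_sec p w = 0.
  apply: contrapT => pw; apply: ne; apply: pinj => // p0.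
  by move: p1; rewrite p0 hl0 => /eqP; rewrite eq_sym oner_eq0.
by rewrite -[RHS]/(h (unit_at z z) (G0_sec p z) *: unit_at z w) (unit_at0 wz ne) scaler0.
Qed.

(** The formula is forced: the coordinate of the adjoint at [z] is <W e_z, v>. The vector e_z occurs
    once linearly and once conjugate-linearly, so its phase is immaterial. *)
Definition adj (v : sections (tc_L c')) : sections (tc_L c) :=
  fun z => fiber_ip (W (unit_at z)) v (tc_s z) *: unit_at z z.

Lemma bmap_adj : bmap adj.
Proof.
split=> [a u v|a u z|v cv z].
- apply: functional_extensionality_dep => z; rewrite /adj fip_linr.
  by rewrite scalerDl -scalerA.
- rewrite /adj scalerA; congr (_ *: _); rewrite !fiber_ipE mulr_sumr.
  apply: eq_big_seq => z' /mem_fib zz; rewrite hZr zz.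
  (* [W] commutes with the indicator of the point r z of [Y], so the image of a vector supported at
     [z] vanishes at every z' with r z' different from r z. *)
  have [->//|/eqP ne] := eqVneq (tc_r z') (tc_r z).
  pose b (_ : X) (y : Y) : C := if `[< y = tc_r z >] then 1 else 0.
  have := bm_act bW b (unit_at z) z'; rewrite /b; case: asboolP => // _; rewrite scale0r.
  have -> : W (fun z0 => (if `[< tc_r z0 = tc_r z >] then 1 else 0) *: unit_at z z0) z' = W (unit_at z) z'.
    apply: (bm_local bW _ zz) => w wz; have [->|/eqP nw] := eqVneq w z.
      by case: asboolP => // _; rewrite scale1r.
    by rewrite unit_at0// scaler0.
  by move=> ->; rewrite hl0 !mulr0.
- have [p [np _ _ pinj]] := unit_section (@filterT _ (nbhs z) _).
  apply: (sec_cont_at_near (u := fun a => fiber_ip (W (G0_sec p)) v (tc_s a) *: G0_sec p a)).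
    apply: filterS np => a [p1 _]; have [t t1 [pa tp]] := unit_at_phase p1 pinj.
    rewrite pa scalerA /adj; congr (_ *: _).
    rewrite (fip_eq (u' := t *: W (unit_at a) + 0) (v' := v))//; last first.
      by move=> w wa; rewrite addr0 tp.
    by rewrite fip_linl fip_l0 addr0 mulrAC t1 mul1r.
  apply: sec_cont_atZ; last exact: G0_cont.
  apply: (cont_at_comp (f := @tc_s _ _ _ c)); first exact: s_cont.
  apply: fiber_ip_cont_at => // w _; split; last exact: cv.
  by apply: bm_cont bW _ _ w => a; exact: G0_cont.
Qed.

Lemma adjP : adjp W adj.
Proof.
move=> u v x.
rewrite (fip_eq (u' := W (\sum_(z <- fib c x) h (unit_at z z) (u z) *: unit_at z)) (v' := v))//; last first.
  by apply: (bm_local bW) => z zx; exact: fiber_expand.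
rewrite (bm_sum _ _ _ bW) fip_suml fiber_ipE; apply: eq_big_seq => z /mem_fib zx.
by rewrite /adj zx hZr -metC mulrC.
Qed.

(** The sum of the column norms bounds the operator norm over [x] and is visibly continuous in [x];
    the summand 1 makes it safe to divide by. *)
Definition opbound x : R := 1 + \sum_(z <- fib c x) nx (W (unit_at z)) (tc_s z).

Lemma opbound_ge1 x : 1 <= opbound x.
Proof. by rewrite lerDl sumr_ge0// => z _; exact: nx_ge0. Qed.

Lemma opboundP u x : nx (W u) x <= opbound x * nx u x.
Proof.
rewrite (nx_eq (v := W (\sum_(z <- fib c x) h (unit_at z z) (u z) *: unit_at z))); last first.
  by apply: (bm_local bW) => z zx; exact: fiber_expand.
rewrite (bm_sum _ _ _ bW) /opbound mulrDl mul1r ler_wpDl ?nx_ge0//.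
have : forall z, z \in fib c x -> tc_s z = x by move=> z /mem_fib.
elim: (fib c x) => [_|z l IH zl].
  rewrite !big_nil mul0r.
  have := nxZ 0 (0 : sections (tc_L c')) x; rewrite scale0r nc0 mul0r => ->//.
rewrite !big_cons mulrDl; apply: le_trans (nxD _ _ _) _; apply: lerD; last first.
  by apply: IH => w wl; apply: zl; rewrite inE wl orbT.
have zx : tc_s z = x by apply: zl; rewrite inE eqxx.
rewrite nxZ nc_coord mulrC zx; apply: ler_wpM2l; first exact: nx_ge0.
by rewrite -zx; exact: lnrm_le_nx.
Qed.

Lemma opbound_cont x : cont_at opbound x.
Proof.
have cS : cont_at (fun y => \sum_(z <- fib c y) nx (W (unit_at z)) (tc_s z)) x.
  apply: fiber_sum_cont_at => // z _.
  have [p [np _ _ pinj]] := unit_section (@filterT _ (nbhs z) _).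
  apply: (cont_at_near (f := fun a => nx (W (G0_sec p)) (tc_s a))).
    apply: filterS np => a [p1 _]; have [t t1 [_ tp]] := unit_at_phase p1 pinj.
    rewrite (nx_eq (v := t *: W (unit_at a))) ?nxZ; last by move=> w /tp.
    have : nc t ^+ 2 = 1 by apply: rC_inj; rewrite nc_sqr t1.
    move=> /eqP; rewrite sqrf_eq1 => /orP[/eqP->|/eqP t0]; first by rewrite mul1r.
    by have := nc_ge0 t; rewrite t0 ler0N1.
  apply: (cont_at_comp (f := @tc_s _ _ _ c)); first exact: s_cont.
  by apply: nx_cont_at => //; apply: bm_cont bW _ _ => a; exact: G0_cont.
by apply: (cvgD (cvg_cst _) cS).
Qed.

End Adjoint.

Section Coordinates.
Variables (R : realType) (X Y : topologicalType) (c : tcorr R Y X).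
Notation C := (cplx R).
Notation h := (lb_met (h := tc_L _)).
Implicit Types (u v : sections (tc_L c)).

Definition lcoord (z : tc_Z c) u : C := h (unit_at z z) (u z).

Lemma lcoordD z u v : lcoord z (u + v) = lcoord z u + lcoord z v. Proof. exact: hDr. Qed.
Lemma lcoordZ z a u : lcoord z (a *: u) = a * lcoord z u. Proof. exact: hZr. Qed.
Lemma lcoordN z u : lcoord z (- u) = - lcoord z u.
Proof. by rewrite -scaleN1r lcoordZ mulN1r. Qed.
Lemma lcoord_inj u v : (forall z, lcoord z u = lcoord z v) -> u = v.
Proof. by move=> uv; apply: functional_extensionality_dep => z; apply: unit_at_lcoord; exact: uv. Qed.

Lemma nx_small u x (q M : R) : 0 <= q -> q < 1 ->
  (forall k, nx u x <= M * q ^+ k) -> forall z, tc_s z = x -> u z = 0.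
Proof. by move=> q0 q1 uM; apply/nx_eq0; apply: small_all uM => //; exact: nx_ge0. Qed.

End Coordinates.

(** * The Newton-Schulz iteration and its limit *)

Section NewtonSchulz.
Variables (R : realType) (X Y : topologicalType) (c c' : tcorr R Y X).
Notation C := (cplx R).
Variables (A : sections (tc_L c) -> sections (tc_L c')).
Variables (B : sections (tc_L c') -> sections (tc_L c)).

Definition dft (d d' : tcorr R Y X) (A : sections (tc_L d) -> sections (tc_L d'))
  (B : sections (tc_L d') -> sections (tc_L d)) (u : sections (tc_L d)) : sections (tc_L d) :=
  u - B (A u).

(* One step of the Newton-Schulz iteration for the polar decomposition. *)
Definition nstep (d d' : tcorr R Y X) (A : sections (tc_L d) -> sections (tc_L d'))
  (B : sections (tc_L d') -> sections (tc_L d)) (u : sections (tc_L d)) : sections (tc_L d') :=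
  A (2^-1 *: dft A B u + u).

Hypotheses (bA : bmap A) (bB : bmap B).

Lemma bmap_dft : bmap (dft A B).
Proof.
rewrite (_ : dft A B = fun u => (-1) *: (B \o A) u + u).
  by apply: bmap_comb (bmap_id c); exact: bmap_comp.
by apply/funext => u; rewrite scaleN1r addrC.
Qed.

Lemma bmap_nstep : bmap (nstep A B).
Proof.
by apply: (bmap_comp bA (W := fun u => 2^-1 *: dft A B u + u)); apply: bmap_comb bmap_dft (bmap_id c).
Qed.

Lemma dftA u : dft B A (A u) = A (dft A B u).
Proof. by rewrite /dft (bmB _ _ bA). Qed.

(** With E = 1 - BA the step multiplies [A] by 1 + E/2 and [B] likewise, and 1 - (1 - E)(1 + E/2)^2
    has no constant or linear term. The two coefficients add up to 1, which gives the clean bound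
    q^2 next. *)
Lemma dft_nstep u : dft (nstep A B) (nstep B A) u =
  (3 / 4) *: dft A B (dft A B u) + 4^-1 *: dft A B (dft A B (dft A B u)).
Proof.
have bE := bmap_dft.
pose w := 2^-1 *: dft A B u + u; pose y := 2^-1 *: dft A B w + w.
have -> : dft (nstep A B) (nstep B A) u = u - (y - dft A B y).
  rewrite {1}/dft; congr (_ - _); rewrite /nstep -/w dftA -(bmZ _ _ bA) -(bmD _ _ bA) -/y.
  by rewrite /dft opprB addrC subrK.
rewrite /y /w !(bm_lin bE); apply: lcoord_inj => z.
by rewrite !(lcoordD, lcoordN, lcoordZ); field.
Qed.

Lemma dft_nstep_le x (q : R) : 0 <= q -> q <= 1 ->
  (forall u, nx (dft A B u) x <= q * nx u x) ->
  forall u, nx (dft (nstep A B) (nstep B A) u) x <= q ^+ 2 * nx u x.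
Proof.
move=> q0 q1 Eq u; rewrite dft_nstep; apply: le_trans (nxD _ _ _) _; rewrite !nxZ.
have -> : nc (3 / 4 : C) = 3 / 4.
  by rewrite -[RHS]nc_rC ?divr_ge0// rCM rCV /rC !rmorph_nat.
have -> : nc (4^-1 : C) = 4^-1.
  by rewrite -[RHS]nc_rC ?invr_ge0// rCV /rC !rmorph_nat.
have E2 v : nx (dft A B (dft A B v)) x <= q ^+ 2 * nx v x.
  by apply: le_trans (Eq _) _; rewrite expr2 -mulrA ler_wpM2l.
have E3 : nx (dft A B (dft A B (dft A B u))) x <= q ^+ 2 * nx u x.
  apply: le_trans (E2 _) _; rewrite ler_wpM2l ?exprn_ge0//.
  by apply: le_trans (Eq _) _; rewrite ler_piMl ?nx_ge0.
have := E2 u; move: E3 (nx_ge0 u x); lra.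
Qed.

Hypothesis AB : adjp A B.

Lemma dft_adj u v x : fiber_ip (dft A B u) v x = fiber_ip u (dft A B v) x.
Proof.
by rewrite /dft fip_subl fip_subr -(AB u (A v)) (adjp_sym AB (A u) v).
Qed.

Lemma nstep_adj : adjp (nstep A B) (nstep B A).
Proof.
move=> u v x; have -> : nstep B A v = 2^-1 *: dft A B (B v) + B v.
  by rewrite /nstep (bm_lin bB) /dft (bmB _ _ bB).
rewrite /nstep AB fip_linl fip_linr dft_adj; congr (_ * _ + _).
by rewrite fmorphV /= conjC_nat.
Qed.

(** |Au|^2 = <u, BAu> = <u, u - Eu> <= (1 + q)|u|^2. The constant 2 is not sharp, but it serves all
    iterates at once. *)
Lemma contr_le x (q : R) : q <= 1 -> (forall u, nx (dft A B u) x <= q * nx u x) ->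
  forall u, nx (A u) x <= 2 * nx u x.
Proof.
move=> q1 Eq u; have u0 := nx_ge0 u x.
rewrite -(ler_pXn2r (n := 2)) ?nnegrE ?mulr_ge0 ?nx_ge0//.
have : nx (A u) x ^+ 2 <= nx u x * nx (B (A u)) x.
  rewrite -(nc_rC (sqr_ge0 (nx (A u) x))) nx_sqr AB; exact: nx_cs.
have -> : B (A u) = u - dft A B u by rewrite /dft opprB addrC subrK.
have H : nx (u - dft A B u) x <= 2 * nx u x.
  apply: le_trans (nxD _ _ _) _; rewrite nxN mulr2n mulrDl mul1r lerD2l.
  by apply: le_trans (Eq _) _; rewrite ler_piMl.
move=> H'; apply: le_trans H' _; apply: le_trans (ler_wpM2l u0 H) _.
by rewrite expr2 mulrA; nra.
Qed.

Lemma nstep_dist x (q : R) : q <= 1 -> (forall u, nx (dft A B u) x <= q * nx u x) ->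
  forall u, nx (nstep A B u - A u) x <= q * nx u x.
Proof.
move=> q1 Eq u; rewrite /nstep (bmD _ _ bA) addrK (bmZ _ _ bA) nxZ.
have -> : nc (2^-1 : C) = 2^-1.
  by rewrite -[RHS]nc_rC ?invr_ge0// rCV /rC !rmorph_nat.
rewrite mulrC ler_pdivrMr//; apply: le_trans (contr_le q1 Eq _) _.
by rewrite mulrC ler_pM2r.
Qed.

End NewtonSchulz.

Section BmapLimit.
Variables (R : realType) (X Y : topologicalType) (c c' : tcorr R Y X).
Hypotheses (lcX : locally_compact [set: X]) (T2X : hausdorff_space X).
Hypothesis s_surj : range (@tc_s R Y X c) = [set: X].
Notation C := (cplx R).
Variables (An : nat -> sections (tc_L c) -> sections (tc_L c')) (q : X -> R).
Hypothesis bAn : forall k, bmap (An k).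
Hypotheses (q0 : forall x, 0 <= q x) (q1 : forall x, q x < 1).
Hypothesis cq : forall x, cont_at q x.
Hypothesis Anq : forall k u x, nx (An k.+1 u - An k u) x <= q x ^+ k * nx u x.

Lemma coord_le (d : tcorr R Y X) z (u : sections (tc_L d)) : nc (lcoord z u) <= nx u (tc_s z).
Proof. by rewrite nc_coord; exact: lnrm_le_nx. Qed.

Fact blim_subproof u z' : exists l : C, forall k,
  nc (l - lcoord z' (An k u)) <= q (tc_s z') ^+ k / (1 - q (tc_s z')) * nx u (tc_s z').
Proof.
apply: geom_limit => // [|k]; first exact: nx_ge0.
by rewrite -lcoordN -lcoordD; apply: le_trans (coord_le _ _) _; exact: Anq.
Qed.

(** The limit is taken in the coordinate at each point separately, for arbitrary sections;
    linearity, commutation and continuity are recovered from the rate. *)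
Definition blim u : sections (tc_L c') :=
  fun z' => projT1 (cid (blim_subproof u z')) *: unit_at z' z'.

Lemma blim_coord u z' k : nc (lcoord z' (blim u) - lcoord z' (An k u)) <=
  q (tc_s z') ^+ k / (1 - q (tc_s z')) * nx u (tc_s z').
Proof. by rewrite {1}/lcoord /blim hZr unit_at1 mulr1; case: cid => l /=. Qed.

Lemma blim_uniq u z' (l : C) (M : R) :
  (forall k, nc (l - lcoord z' (An k u)) <= q (tc_s z') ^+ k * M) -> lcoord z' (blim u) = l.
Proof.
move=> lM; set x := tc_s z'; apply/eqP; rewrite -subr_eq0 -nc_eq0; apply/eqP.
apply: (small_all (q := q x) (M := nx u x / (1 - q x) + M)) => //; first exact: nc_ge0.
move=> k; have -> : lcoord z' (blim u) - l =
    (lcoord z' (blim u) - lcoord z' (An k u)) + (lcoord z' (An k u) - l) by ring.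
apply: le_trans (ncD _ _) _; rewrite mulrDl; apply: lerD; last by rewrite nc_dist mulrC.
by apply: le_trans (blim_coord _ _ _) _; rewrite [leRHS]mulrC mulrA mulrAC.
Qed.

Lemma bmap_blim : bmap blim.
Proof.
split=> [a u v|a u z'|u cu z0].
- apply: lcoord_inj => z'; set x := tc_s z'.
  apply: (@blim_uniq _ z' _ ((nc a * nx u x + nx v x) / (1 - q x))) => k.
  rewrite (bm_lin (bAn k)) !lcoordD !lcoordZ.
  have -> : forall b b' d d' : C, a * b + d - (a * b' + d') = a * (b - b') + (d - d') by move=> *; ring.
  apply: le_trans (ncD _ _) _; rewrite ncM.
  have := blim_coord v z' k; have := ler_wpM2l (nc_ge0 a) (blim_coord u z' k).
  rewrite -/x; lra.
- apply: unit_at_lcoord; rewrite [RHS]hZr -[LHS]/(lcoord z' (blim _)) -/(lcoord z' (blim u)).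
  set b := a (tc_s z') (tc_r z'); set x := tc_s z'.
  apply: (@blim_uniq _ z' _ (nc b * nx u x / (1 - q x))) => k.
  rewrite (_ : lcoord z' (An k _) = b * lcoord z' (An k u)); last first.
    by rewrite /lcoord (bm_act (bAn k)) hZr.
  rewrite -mulrBr ncM.
  have := ler_wpM2l (nc_ge0 b) (blim_coord u z' k).
  rewrite -/x /lcoord; lra.
(* A rate strictly between q x0 and 1 is valid on a whole neighbourhood by continuity of [q], so
   convergence is uniform there and [sec_cont_lim] applies. *)
- set x0 := tc_s z0; pose p := (q x0 + 1) / 2.
  have p0 : 0 <= p by rewrite divr_ge0// addr_ge0.
  have p1 : p < 1 by rewrite ltr_pdivrMr// mul1r [ltRHS](_ : _ = 1 + 1)// ltrD2r.
  have pq : q x0 < p by rewrite ltr_pdivlMr// mulr2n mulrDr mulr1 ltrD2l.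
  have p10 : 0 < 1 - p by rewrite subr_gt0.
  apply: sec_cont_lim => e e0; pose M := nx u x0 + 1.
  have M0 : 0 < M by rewrite ltr_wpDl// nx_ge0.
  have [k pk] := geom_small p0 p1 (mulr_gt0 e0 (divr_gt0 p10 M0)).
  exists (An k u); first exact: bm_cont (bAn k) _ cu z0.
  have n1 : \forall x \near x0, q x < p.
    by apply: (cvgr_lt (q x0) _ p) => //; exact: cq.
  have n2 : \forall x \near x0, nx u x < M.
    by apply: (cvgr_lt (nx u x0) (nx_cont_at lcX T2X s_surj cu) M); rewrite /M ltrDl.
  have cs : cont_at (@tc_s _ _ _ c') z0 by exact: s_cont.
  have n3 : \forall z \near z0, q (tc_s z) < p /\ nx u (tc_s z) < M.
    apply: (@cont_at_nbhs _ _ _ _ [set x | q x < p /\ nx u x < M] cs).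
    exact: filterI n1 n2.
  apply: filterS n3 => z [qp uM]; rewrite -nc_coord.
  have -> : lb_met (unit_at z z) (blim u z - An k u z) = lcoord z (blim u) - lcoord z (An k u).
    by rewrite -lcoordN -lcoordD.
  apply: le_trans (blim_coord _ _ _) _.
  have h1 : q (tc_s z) ^+ k <= p ^+ k by apply: lerXn2r; rewrite ?nnegrE ?q0// ltW.
  have h2 : (1 - q (tc_s z))^-1 <= (1 - p)^-1.
    by rewrite lef_pV2 ?posrE// ?subr_gt0// lerB// ltW.
  apply: (@le_trans _ _ (p ^+ k / (1 - p) * M)).
    have qz0 : 0 < 1 - q (tc_s z) by rewrite subr_gt0.
    apply: ler_pM; [|exact: nx_ge0| |exact: ltW].
      by apply: divr_ge0; [exact: exprn_ge0|exact: ltW].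
    by apply: ler_pM => //; [exact: exprn_ge0|rewrite invr_ge0 ltW].
  by rewrite mulrAC ler_pdivrMr// -ler_pdivlMr// -mulrA ltW.
Unshelve. all: by end_near. Qed.

(** The cardinality of the fiber appears because the norm is bounded by the sum of the coordinates,
    each of which satisfies [blim_coord]. *)
Lemma blim_nx u x k : nx (blim u - An k u) x <=
  (size (fib c' x))%:R * (q x ^+ k / (1 - q x) * nx u x).
Proof.
apply: le_trans (nx_le_sum _ _) _.
have : forall z, z \in fib c' x -> tc_s z = x by move=> z /mem_fib.
elim: (fib c' x) => [_|z l IH zl]; first by rewrite big_nil mul0r.
rewrite big_cons /= -natr1 mulrDl mul1r addrC; apply: lerD.
  by apply: IH => w wl; apply: zl; rewrite inE wl orbT.
rewrite -nc_coord -[X in nc X]/(lcoord z _) lcoordD lcoordN.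
by have <- : tc_s z = x; [apply: zl; rewrite inE eqxx|exact: blim_coord].
Qed.

End BmapLimit.

Section Polar.
Variables (R : realType) (X Y : topologicalType).
Hypotheses (lcX : locally_compact [set: X]) (T2X : hausdorff_space X).
Notation C := (cplx R).

(* Cauchy-Schwarz for the positive form <u,u> - <Au,Au>. *)
Lemma dft_contract (c c' : tcorr R Y X) A B x (m : R) : @bmap _ _ _ c c' A -> adjp A B -> 1 <= m ->
  (forall u, nx (A u) x <= nx u x) -> (forall u, nx u x <= m * nx (A u) x) ->
  forall u, nx (dft A B u) x <= (1 - (m ^+ 2)^-1) * nx u x.
Proof.
move=> bA AB m1 Ale mA u; have m0 : 0 < m by exact: lt_le_trans m1.
have m20 : 0 < m ^+ 2 by rewrite exprn_gt0.
set q := 1 - (m ^+ 2)^-1.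
have q0 : 0 <= q by rewrite subr_ge0 invf_le1// exprn_ege1.
pose b u v : C := fiber_ip u v x - fiber_ip (A u) (A v) x.
have bE w : b w w = rC (nx w x ^+ 2 - nx (A w) x ^+ 2) by rewrite rCB !nx_sqr.
have blin w (a : C) v v' : b w (a *: v + v') = a * b w v + b w v'.
  by rewrite /b (bm_lin bA) !fip_linr; ring.
have bconj v w : b w v = (b v w)^*.
  by rewrite /b rmorphB /= -!fip_conj.
have bge0 w : 0 <= b w w.
  by rewrite bE rC_ge0 subr_ge0 lerXn2r ?nnegrE ?nx_ge0.
have bq w : hn b w ^+ 2 <= q * nx w x ^+ 2.
  rewrite -ler_rC hn_sqr// bE ler_rC /q mulrBl mul1r lerB// mulrC ler_pdivrMr//.
  have Am : 0 <= nx (A w) x * m by rewrite mulr_ge0 ?nx_ge0 ?ltW.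
  by rewrite -exprMn lerXn2r ?nnegrE ?nx_ge0// mulrC.
have bd w : fiber_ip w (dft A B u) x = b w u by rewrite /dft fip_subr /b AB.
set d := dft A B u; have d0 := nx_ge0 d x; have u0 := nx_ge0 u x.
(* The square of the norm of d = (1 - BA)u is b(d,u). Each factor on the right is at most the square
   root of [q] times the corresponding norm, and one factor |d| then cancels. *)
have H : nx d x ^+ 2 <= hn b d * hn b u.
  rewrite -(nc_rC (sqr_ge0 (nx d x))) nx_sqr bd; exact: cauchy_schwarz.
have hd := bq d; have hu := bq u.
have h0 v : 0 <= hn b v by exact: hn_ge0.
have H4 : (nx d x ^+ 2) ^+ 2 <= (q * (nx d x * nx u x)) ^+ 2.
  apply: (@le_trans _ _ ((hn b d * hn b u) ^+ 2)).
    by rewrite lerXn2r ?nnegrE ?sqr_ge0// mulr_ge0.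
  rewrite exprMn; apply: (@le_trans _ _ ((q * nx d x ^+ 2) * (q * nx u x ^+ 2))).
    by apply: ler_pM => //; exact: sqr_ge0.
  by rewrite le_eqVlt; apply/orP; left; apply/eqP; ring.
rewrite ler_pXn2r ?nnegrE ?sqr_ge0 ?mulr_ge0// in H4.
have [->|dn] := eqVneq (nx d x) 0; first by rewrite mulr_ge0.
have dp : 0 < nx d x by rewrite lt0r dn.
by rewrite -(ler_pM2l dp); move: H4; rewrite expr2; lra.
Qed.

Section Iteration.
Variables (c c' : tcorr R Y X).
Variables (A0 : sections (tc_L c) -> sections (tc_L c')).
Variables (B0 : sections (tc_L c') -> sections (tc_L c)).
Variable q : X -> R.
Hypotheses (bA0 : bmap A0) (bB0 : bmap B0) (AB0 : adjp A0 B0).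
Hypotheses (q0 : forall x, 0 <= q x) (q1 : forall x, q x < 1).
Hypothesis Aq : forall u x, nx (dft A0 B0 u) x <= q x * nx u x.
Hypothesis Bq : forall u x, nx (dft B0 A0 u) x <= q x * nx u x.

Fixpoint nsit k := if k is k'.+1 then let: (A, B) := nsit k' in (nstep A B, nstep B A)
  else (A0, B0).
Notation An k := (nsit k).1.
Notation Bn k := (nsit k).2.

Lemma nsitS k : nsit k.+1 = (nstep (An k) (Bn k), nstep (Bn k) (An k)).
Proof. by rewrite /=; case: nsit. Qed.

Lemma nsitP k : [/\ bmap (An k), bmap (Bn k), adjp (An k) (Bn k),
  forall u x, nx (dft (An k) (Bn k) u) x <= q x ^+ k.+1 * nx u x &
  forall u x, nx (dft (Bn k) (An k) u) x <= q x ^+ k.+1 * nx u x].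
Proof.
elim: k => [|k [bA bB AB hA hB]]; first by split => // u x; rewrite expr1.
have qk x : 0 <= q x ^+ k.+1 /\ q x ^+ k.+1 <= 1.
  by rewrite exprn_ge0// exprn_ile1// ltW.
(* Each step squares the defect; the weaker geometric rate is all that the limit needs. *)
have q2 x : (q x ^+ k.+1) ^+ 2 <= q x ^+ k.+2.
  by rewrite -exprM ler_wiXn2l// ?ltW// mulnC mul2n -addnn addnS ltnS leq_addr.
rewrite nsitS /=; split.
- exact: bmap_nstep.
- exact: bmap_nstep.
- exact: nstep_adj.
- move=> u x; have [h0 h1] := qk x.
  apply: le_trans (dft_nstep_le bA bB h0 h1 (hA^~ x) u) _.
  by rewrite ler_wpM2r ?nx_ge0.
- move=> u x; have [h0 h1] := qk x.
  apply: le_trans (dft_nstep_le bB bA h0 h1 (hB^~ x) u) _.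
  by rewrite ler_wpM2r ?nx_ge0.
Qed.

Lemma nsit_distA k u x : nx (An k.+1 u - An k u) x <= q x ^+ k * nx u x.
Proof.
have [bA bB AB hA hB] := nsitP k; rewrite nsitS /=.
apply: le_trans (nstep_dist bA AB _ (hA^~ x) u) _; first by rewrite exprn_ile1// ltW.
by rewrite ler_wpM2r ?nx_ge0// exprS ler_piMl ?exprn_ge0// ltW.
Qed.

Lemma nsit_distB k u x : nx (Bn k.+1 u - Bn k u) x <= q x ^+ k * nx u x.
Proof.
have [bA bB AB hA hB] := nsitP k; rewrite nsitS /=.
apply: le_trans (nstep_dist bB (adjp_sym AB) _ (hB^~ x) u) _; first by rewrite exprn_ile1// ltW.
by rewrite ler_wpM2r ?nx_ge0// exprS ler_piMl ?exprn_ge0// ltW.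
Qed.

Notation UA := (blim q0 q1 nsit_distA).
Notation UB := (blim q0 q1 nsit_distB).

Lemma polar_adj : adjp UA UB.
Proof.
move=> u v x; apply/eqP; rewrite -subr_eq0 -nc_eq0; apply/eqP.
pose M := (size (fib c' x))%:R * (nx u x / (1 - q x)) * nx v x +
          nx u x * ((size (fib c x))%:R * (nx v x / (1 - q x))).
apply: (small_all (q := q x) (M := M)) => //; first exact: nc_ge0.
move=> k; have [bA bB AB hA hB] := nsitP k.
have -> : fiber_ip (UA u) v x - fiber_ip u (UB v) x =
    fiber_ip (UA u - An k u) v x - fiber_ip u (UB v - Bn k v) x.
  by rewrite fip_subl fip_subr AB; ring.
apply: le_trans (ncD _ _) _; rewrite ncN.
have h1 := le_trans (nx_cs (UA u - An k u) v x) (ler_wpM2r (nx_ge0 v x) (blim_nx q0 q1 nsit_distA u x k)).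
have h2 := le_trans (nx_cs u (UB v - Bn k v) x) (ler_wpM2l (nx_ge0 u x) (blim_nx q0 q1 nsit_distB v x k)).
by apply: le_trans (lerD h1 h2) _; rewrite /M le_eqVlt; apply/orP; left; apply/eqP; ring.
Qed.

End Iteration.

Section PolarInverse.
Variables (c c' : tcorr R Y X).
Variables (An : nat -> sections (tc_L c) -> sections (tc_L c')) (Bn : nat -> sections (tc_L c') -> sections (tc_L c)).
Variables (UA : sections (tc_L c) -> sections (tc_L c')) (UB : sections (tc_L c') -> sections (tc_L c)).
Variables (q KA KB : X -> R).
Hypotheses (q0 : forall x, 0 <= q x) (q1 : forall x, q x < 1).
Hypothesis bB : forall k, bmap (Bn k).
Hypothesis Bn2 : forall k u x, nx (Bn k u) x <= 2 * nx u x.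
Hypothesis dq : forall k u x, nx (dft (An k) (Bn k) u) x <= q x ^+ k * nx u x.
Hypothesis UAn : forall k u x, nx (UA u - An k u) x <= q x ^+ k * (KA x * nx u x).
Hypothesis UBn : forall k u x, nx (UB u - Bn k u) x <= q x ^+ k * (KB x * nx u x).

(** [UB] UA - 1 = (UB - Bn)UA + Bn(UA - An) - (1 - Bn An), and every summand is of order q^k over a
    fixed point of [X]. *)
Lemma polar_inverse : cancel UA UB.
Proof.
move=> u; apply/eqP; rewrite -subr_eq0; apply/eqP.
apply: functional_extensionality_dep => z.
apply: (nx_small (x := tc_s z) (q := q (tc_s z)) (M := KB (tc_s z) * nx (UA u) (tc_s z) + 2 * (KA (tc_s z) * nx u (tc_s z)) + nx u (tc_s z))) => //.
move=> k; set x := tc_s z.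
have -> : UB (UA u) - u = (UB (UA u) - Bn k (UA u)) + Bn k (UA u - An k u) - dft (An k) (Bn k) u.
  by rewrite (bmB _ _ (bB k)) /dft opprB !addrA !subrK.
apply: le_trans (nxD _ _ _) _; rewrite nxN.
apply: le_trans (lerD (nxD _ _ _) (lexx _)) _.
have h1 := UBn k (UA u) x; have h2 := Bn2 k (UA u - An k u) x; have h3 := UAn k u x.
have h4 := dq k u x.
apply: le_trans (lerD (lerD h1 (le_trans h2 (ler_wpM2l _ h3))) h4) _ => //.
by rewrite le_eqVlt; apply/orP; left; apply/eqP; ring.
Qed.

End PolarInverse.

(* The unitary part of the polar decomposition of W. *)
Theorem polar (c c' : tcorr R Y X) W V :
  range (@tc_s R Y X c) = [set: X] -> range (@tc_s R Y X c') = [set: X] ->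
  @bmap _ _ _ c c' W -> bmap V -> cancel W V -> cancel V W ->
  exists U U', [/\ @bmap _ _ _ c c' U, bmap U', cancel U U', cancel U' U &
    forall u v x, fiber_ip (U u) (U v) x = fiber_ip u v x].
Proof.
move=> ss ss' bW bV WV VW.
pose l x := opbound W x; pose m x := opbound V x.
have l1 x : 1 <= l x by exact: opbound_ge1.
have m1 x : 1 <= m x by exact: opbound_ge1.
have lg x : 0 < l x by exact: lt_le_trans (l1 x).
have mg x : 0 < m x by exact: lt_le_trans (m1 x).
have cl x : cont_at l x by exact: opbound_cont.
have cm x : cont_at m x by exact: opbound_cont.
(* Dividing by a bound makes [W] a contraction on each fiber. A positive function on [X] does not
   alter the unitary part and keeps the map a [bmap]. *)
pose f x : C := rC (l x)^-1.
have clV x : cont_at (fun x => (l x)^-1) x by apply: cvgV; [rewrite gt_eqF|exact: cl].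
have cf x : cont_at f x by apply: cont_at_rC; exact: clV.
have ncf x : nc (f x) = (l x)^-1 by rewrite nc_rC// invr_ge0 ltW.
pose A0 u : sections (tc_L c') := fun z' => f (tc_s z') *: W u z'.
pose B0 v : sections (tc_L c) := fun z => f (tc_s z) *: adj W v z.
have bA0 : bmap A0 by exact: bmap_scale.
have bB0 : bmap B0 by apply: bmap_scale => //; exact: bmap_adj.
have fA u x : forall z', tc_s z' = x -> A0 u z' = (f x *: W u) z' by move=> z' <-.
have fB u x : forall z, tc_s z = x -> B0 u z = (f x *: adj W u) z by move=> z <-.
have AB0 : adjp A0 B0.
  move=> u v x; rewrite (fip_eq (fA u x) (v' := v))// (fip_eq (u := u) (u' := u) _ (fB v x))//.
  have := fip_linl x (f x) (W u) 0 v; rewrite addr0 fip_l0 addr0 => ->.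
  have := fip_linr x u (f x) (adj W v) 0; rewrite addr0 => ->.
  rewrite (fip_conj x 0 u) fip_l0 conjC0 addr0 (adjP bW) rC_conj//.
have Ale u x : nx (A0 u) x <= nx u x.
  rewrite (nx_eq (fA u x)) nxZ ncf mulrC ler_pdivrMr// mulrC; exact: opboundP.
have Ble v x : nx (B0 v) x <= nx v x.
  rewrite (nx_eq (fB v x)) nxZ ncf mulrC ler_pdivrMr// mulrC.
  have [->|dn] := eqVneq (nx (adj W v) x) 0; first by rewrite mulr_ge0 ?nx_ge0// ltW.
  rewrite -(ler_pM2l (x := nx (adj W v) x)); last by rewrite lt0r dn nx_ge0.
  rewrite -expr2 -(nc_rC (sqr_ge0 _)) nx_sqr -(adjP bW).
  apply: le_trans (nx_cs _ _ _) _; rewrite mulrA ler_wpM2r ?nx_ge0// mulrC.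
  exact: opboundP.
have Age u x : nx u x <= l x * m x * nx (A0 u) x.
  rewrite (nx_eq (fA u x)) nxZ ncf mulrA [l x * m x]mulrC -(mulrA (m x)) mulfV ?gt_eqF// mulr1 -{1}(WV u).
  exact: opboundP.
(* By duality: |v|^2 = <WVv, v> equals the inner product of Vv with the adjoint of [W] at v, and
   |Vv| <= m|v|. *)
have Bge v x : nx v x <= l x * m x * nx (B0 v) x.
  rewrite (nx_eq (fB v x)) nxZ ncf mulrA [l x * m x]mulrC -(mulrA (m x)) mulfV ?gt_eqF// mulr1.
  have [->|dn] := eqVneq (nx v x) 0; first by rewrite mulr_ge0 ?nx_ge0// ltW.
  rewrite -(ler_pM2l (x := nx v x)); last by rewrite lt0r dn nx_ge0.
  rewrite -expr2 -(nc_rC (sqr_ge0 _)) nx_sqr -{1}(VW v) (adjP bW).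
  apply: le_trans (nx_cs _ _ _) _; rewrite mulrA (mulrC (nx v x)) ler_wpM2r ?nx_ge0//.
  exact: opboundP.
(* The rate of [dft_contract] for the constant lm that bounds [A0] and [B0] below. It is less than 1
   at each [x] and continuous, though possibly not bounded away from 1. *)
pose q x : R := 1 - ((l x * m x) ^+ 2)^-1.
have lm1 x : 1 <= l x * m x by rewrite -[leLHS]mul1r ler_pM.
have lm0 x : 0 < (l x * m x) ^+ 2 by rewrite exprn_gt0// mulr_gt0.
have q0 x : 0 <= q x by rewrite subr_ge0 invf_le1// exprn_ege1.
have q1 x : q x < 1 by rewrite ltrBlDr ltrDl invr_gt0.
have cq x : cont_at q x.
  apply: (cvgB (cvg_cst _)); apply: cvgV; first by rewrite gt_eqF.
  by rewrite expr2; apply: cvgM; apply: cvgM; [exact: cl|exact: cm|exact: cl|exact: cm].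
have Aq u x : nx (dft A0 B0 u) x <= q x * nx u x by exact: (dft_contract bA0 AB0 (lm1 x) (Ale^~ x) (Age^~ x)).
have Bq u x : nx (dft B0 A0 u) x <= q x * nx u x.
  exact: (dft_contract bB0 (adjp_sym AB0) (lm1 x) (Ble^~ x) (Bge^~ x)).
have nP := nsitP bA0 bB0 AB0 q0 q1 Aq Bq.
pose dA := nsit_distA bA0 bB0 AB0 q0 q1 Aq Bq.
pose dB := nsit_distB bA0 bB0 AB0 q0 q1 Aq Bq.
pose U := blim q0 q1 dA; pose U' := blim q0 q1 dB.
have qS k x : q x ^+ k.+1 <= q x ^+ k by rewrite exprS ler_piMl ?exprn_ge0// ltW.
have q1k k x : q x ^+ k.+1 <= 1 by rewrite exprn_ile1// ltW.
have UU' : cancel U U'.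
  apply: (@polar_inverse c c' (fun k => (nsit A0 B0 k).1) (fun k => (nsit A0 B0 k).2) U U' q (fun x => (size (fib c' x))%:R / (1 - q x))
    (fun x => (size (fib c x))%:R / (1 - q x))) => //.
  - by move=> k; have [] := nP k.
  - move=> k u x; have [bA bB AB _ hB] := nP k.
    exact: (contr_le (adjp_sym AB) (q1k k x) (hB^~ x)).
  - move=> k u x; have [bA bB AB hA hB] := nP k; apply: le_trans (hA u x) _.
    by rewrite ler_wpM2r ?nx_ge0.
  - by move=> k u x; apply: le_trans (blim_nx q0 q1 dA u x k) _; rewrite le_eqVlt; apply/orP; left; apply/eqP; ring.
  - by move=> k u x; apply: le_trans (blim_nx q0 q1 dB u x k) _; rewrite le_eqVlt; apply/orP; left; apply/eqP; ring.
have U'U : cancel U' U.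
  apply: (@polar_inverse c' c (fun k => (nsit A0 B0 k).2) (fun k => (nsit A0 B0 k).1) U' U q (fun x => (size (fib c x))%:R / (1 - q x))
    (fun x => (size (fib c' x))%:R / (1 - q x))) => //.
  - by move=> k; have [] := nP k.
  - move=> k u x; have [bA bB AB hA _] := nP k.
    exact: (contr_le AB (q1k k x) (hA^~ x)).
  - move=> k u x; have [bA bB AB hA hB] := nP k; apply: le_trans (hB u x) _.
    by rewrite ler_wpM2r ?nx_ge0.
  - by move=> k u x; apply: le_trans (blim_nx q0 q1 dB u x k) _; rewrite le_eqVlt; apply/orP; left; apply/eqP; ring.
  - by move=> k u x; apply: le_trans (blim_nx q0 q1 dA u x k) _; rewrite le_eqVlt; apply/orP; left; apply/eqP; ring.
exists U, U'; split => //.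
- by apply: bmap_blim => // k; have [] := nP k.
- by apply: bmap_blim => // k; have [] := nP k.
- by move=> u v x; rewrite (polar_adj bA0 bB0 AB0 q0 q1 Aq Bq u (U v) x) -/U' UU'.
Qed.

End Polar.

(** * From bundles to correspondences *)

Section UnitaryCorr.
Variables (R : realType) (X Y : topologicalType).

(** The fiber norm of the image is that of [p], a function vanishing at infinity on [X]. It
    dominates the pointwise norm, and properness of [s] carries the decay over to [Z']. *)
Lemma unitary_Gamma0 (c c' : tcorr R Y X) U (p : Gamma0_corr c) :
  range (@tc_s R Y X c') = [set: X] -> @bmap R X Y c c' U ->
  (forall u v x, fiber_ip (U u) (U v) x = fiber_ip u v x) -> Gamma0_set (U (G0_sec p)).
Proof.
move=> s'_surj bU uU; have [_ _ vp] := G0_Gamma0 p; split; first exact: (bm_cont bU (G0_cont p)).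
- apply/vanishP => e e0; have [K cK HK] := (vanishP _).1 vp e e0.
  exists (@tc_s _ _ _ c' @^-1` K); first exact: s_proper.
  move=> z /HK; apply: le_lt_trans; rewrite -uU -nx_sqr -lnrm_sqr !nc_rC ?sqr_ge0//.
  by rewrite lerXn2r ?nnegrE ?lnrm_ge0 ?nx_ge0//; exact: lnrm_le_nx.
- by apply: eq_vanish vp => x; rewrite uU.
Qed.

Lemma unitary_corr_iso (c c' : tcorr R Y X) U U' :
  range (@tc_s R Y X c) = [set: X] -> range (@tc_s R Y X c') = [set: X] ->
  @bmap R X Y c c' U -> bmap U' -> cancel U U' -> cancel U' U ->
  (forall u v x, fiber_ip (U u) (U v) x = fiber_ip u v x) ->
  corr_iso (Gamma0_corr c) (Gamma0_corr c').
Proof.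
move=> s_surj s'_surj bU bU' UU' U'U uU.
have uU' u v x : fiber_ip (U' u) (U' v) x = fiber_ip u v x by rewrite -uU !U'U.
pose T (p : Gamma0_corr c) : Gamma0_corr c' := G0_mk (unitary_Gamma0 p s'_surj bU uU).
pose T' (p : Gamma0_corr c') : Gamma0_corr c := G0_mk (unitary_Gamma0 p s_surj bU' uU').
have Tlin : linear T.
  move=> a p q; apply: G0_inj => z; rewrite secD secZ.
  by rewrite -[LHS]/(U (a *: G0_sec p + G0_sec q) z) (bm_lin bU).
exists (HB.pack_for {linear Gamma0_corr c -> Gamma0_corr c'} T
  (GRing.isLinear.Build _ _ _ _ T Tlin)).
split.
- exists T' => p; apply: G0_inj => z.
    by rewrite -[LHS]/(U' (U (G0_sec p)) z) UU'.
  by rewrite -[LHS]/(U (U' (G0_sec p)) z) U'U.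
- by move=> u v x; exact: uU.
- by move=> p f; apply: G0_inj => z; exact: (bm_act bU (fun x _ => f x)).
- by move=> g p; apply: G0_inj => z; exact: (bm_act bU (fun _ y => g y)).
Qed.

End UnitaryCorr.

Section VBundleMap.
Variables (R : realType) (X Y : topologicalType) (c : tcorr R Y X).
Hypotheses (lcX : locally_compact [set: X]) (T2X : hausdorff_space X).
Hypotheses (lcY : locally_compact [set: Y]) (T2Y : hausdorff_space Y).
Hypothesis s_surj : range (@tc_s R Y X c) = [set: X].
Notation C := (cplx R).
Notation E := (Gamma0_corr c).
Variable D : set (E -> E).
Hypothesis sH : symalg (symbols D).
Hypothesis DM : forall T, D T -> exists k, mult T k.
Notation H := (symbols D).
Notation prD := (pr lcX T2X sH DM).
Implicit Types (chi : spectrum D).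

Lemma eqv_r z w : eqv H z w -> tc_r z = tc_r w.
Proof.
move=> [_ zw]; apply: contrapT => ne; have [f [f1 f0]] := C0_separates R lcY T2Y ne.
have := zw _ (sa_r sH (C0_c0fun f)); rewrite f1 f0 => /eqP.
by rewrite oner_eq0.
Qed.

Lemma pr_eq chi z (p q : E) : at_point chi z ->
  (forall w, eqv H z w -> G0_sec p w = G0_sec q w) -> prD chi p = prD chi q.
Proof.
move=> cz pq; apply: (vf_pr_eq lcX T2X sH DM cz) => w zw.
by rewrite (vf_pr lcX T2X sH DM _ cz zw) pq.
Qed.

Lemma vfZ chi z (a : C) (t : VD_fib chi) w : at_point chi z -> tc_s w = tc_s z ->
  G0_sec (vf (a *: t)) w = a *: G0_sec (vf t) w.
Proof.
move=> cz wz; have Qw : sdual chi (tc_s w) by rewrite (sdualE lcX T2X sH cz).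
exact: (rsecZ a (lspan_val t) Qw).
Qed.

Lemma pr_lin chi z (a : C) (p q t : E) : at_point chi z ->
  (forall w, eqv H z w -> G0_sec t w = a *: G0_sec p w + G0_sec q w) ->
  prD chi t = a *: prD chi p + prD chi q.
Proof.
move=> cz tE; apply/esym/(vf_pr_eq lcX T2X sH DM cz) => w zw; have [wz _] := zw.
by rewrite (vf_lin lcX T2X sH _ _ _ cz (esym wz)) !(vf_pr lcX T2X sH DM _ cz zw) tE.
Qed.

Lemma pr_scale chi z (a : C) (p t : E) : at_point chi z ->
  (forall w, eqv H z w -> G0_sec t w = a *: G0_sec p w) -> prD chi t = a *: prD chi p.
Proof.
move=> cz tE; apply/esym/(vf_pr_eq lcX T2X sH DM cz) => w zw; have [wz _] := zw.
by rewrite (vfZ _ _ cz (esym wz)) (vf_pr lcX T2X sH DM _ cz zw) tE.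
Qed.

Hypothesis rk : constant_rank D.

(** Constant rank gives one [d0] lifting the minimal projections at all nearby points of the
    spectrum. Membership in a tube thus becomes the condition that the fiber norm of d0 (p - v) be
    less than [e], which is open in [X]. *)
Lemma pr_continuous (p : E) : continuous (fun chi => @tpt R _ (VD D) chi (prD chi p)).
Proof.
apply: VD_continuous => U v e oU e0; rewrite openE => chi0 /= hyp.
have [z0 cz0] := spectrum_point lcX T2X sH DM chi0.
have [q [V [Hq [oV Vz0] q1 qq qeqv]]] := local_idempotent lcX T2X s_surj sH DM rk z0.
have [d0 md0] := sy_mkd Hq.
have lP chi z : at_point chi z -> V (tc_s z) -> q z <> 0 -> lifts_minproj chi d0.
  move=> cz Vz qz; apply/(lifts_minprojE lcX T2X sH DM cz md0).
  split=> [|w wz nzw]; first exact: qq.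
  by apply: contrapT => qw; apply: nzw; apply: qeqv.
have tubeP chi z : at_point chi z -> V (tc_s z) -> q z <> 0 ->
    VD_tube U v e (existT _ chi (prD chi p)) <-> U chi /\ nx (G0_sec (\val d0 (p - v))) (tc_s z) < e.
  move=> cz Vz qz; rewrite -(nx_cut lcX T2X sH DM _ cz (lP _ _ cz Vz qz)).
  have -> : nx (class_cut D z (G0_sec (p - v))) (tc_s z) =
     nx (class_cut D z (fun w => G0_sec (vf (prD chi p)) w - G0_sec v w)) (tc_s z).
    apply: nx_eq => w wz; rewrite /class_cut; case: asboolP => // zw.
    by rewrite (vf_pr lcX T2X sH DM _ cz zw).
  exact: (VD_tubeE lcX T2X sH DM _ _ _ _ cz).
have qz0 : q z0 <> 0 by rewrite q1; apply/eqP; exact: oner_neq0.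
have [Uc nlt] := (tubeP _ _ cz0 Vz0 qz0).1 hyp.
have nN : nbhs (tc_s z0) (V `&` [set x | nx (G0_sec (\val d0 (p - v))) x < e]).
  apply: filterI; first exact: open_nbhs_nbhs.
  apply: (cvgr_lt (nx (G0_sec (\val d0 (p - v))) (tc_s z0)) _ e) => //.
  by apply: nx_cont_at => //; exact: G0_cont.
have [b [K [cb [_ KV] b01 b1 bK]]] := c0fun_bump R lcX T2X nN.
have [d1 md1] := sy_mkd (sa_s sH cb).
(* A neighbourhood in the spectrum, described by characters alone: nonvanishing of [d0] puts a
   representative [z] into the range of [q], and nonvanishing of [d1] puts s z where the fiber norm
   is small. *)
have near1 (d : D) k : mult (\val d) k -> k z0 = 1 -> \forall chi \near chi0, ev chi d <> 0.
  move=> mk k1; apply: near_neq0; first exact: ev_continuous.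
  by rewrite (cz0 d k mk) k1; apply/eqP/oner_neq0.
have n0 := near1 _ _ md0 q1.
have n1 : \forall chi \near chi0, ev chi d1 <> 0.
  by apply: near1 md1 _; rewrite (nbhs_singleton b1).
have nU : \forall chi \near chi0, U chi by exact: open_nbhs_nbhs.
apply: filterS (filterI nU (filterI n0 n1)) => chi [Uchi [e0' e1']].
have [z cz] := spectrum_point lcX T2X sH DM chi.
rewrite (cz _ _ md0) in e0'; rewrite (cz _ _ md1) in e1'.
have [Vz nz] : (V `&` [set x | nx (G0_sec (\val d0 (p - v))) x < e]) (tc_s z).
  apply: KV; apply: contrapT => /bK bz; apply: e1'.
  by rewrite bz rC0.
by apply/(tubeP _ _ cz Vz e0').
Qed.

Lemma sec_globalize (u : sections (tc_L c)) (x0 : X) : sec_cont u ->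
  exists p : E, \forall x \near x0, forall z, tc_s z = x -> G0_sec p z = u z.
Proof.
move=> cu; have [b [K [cb [cK _] b01 b1 bK]]] := c0fun_bump R lcX T2X (@filterT _ (nbhs x0) _).
pose w : sections (tc_L c) := fun z => rC (b (tc_s z)) *: u z.
have cw : sec_cont w.
  move=> z; apply: sec_cont_atZ; last exact: cu.
  apply: (cont_at_comp (f := @tc_s _ _ _ c) (g := fun x => rC (b x))); first exact: s_cont.
  exact: cb.1.
have gw : Gamma0_set w.
  apply: (Gamma0_supp cw (s_proper s_surj cK)) => z nK; rewrite /w bK ?rC0 ?scale0r//.
exists (G0_mk gw); apply: filterS b1 => x bx z zx /=.
by rewrite /w zx bx rC1 scale1r.
Qed.

End VBundleMap.

Section VBundleIso.
Variables (R : realType) (X Y : topologicalType) (c c' : tcorr R Y X).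
Hypotheses (lcX : locally_compact [set: X]) (T2X : hausdorff_space X).
Hypotheses (lcY : locally_compact [set: Y]) (T2Y : hausdorff_space Y).
Hypothesis s_surj : range (@tc_s R Y X c) = [set: X].
Hypothesis s'_surj : range (@tc_s R Y X c') = [set: X].
Notation E := (Gamma0_corr c).
Notation E' := (Gamma0_corr c').
Variables (D : set (E -> E)) (D' : set (E' -> E')).
Hypotheses (sH : symalg (symbols D)) (sH' : symalg (symbols D')).
Hypothesis DM : forall T, D T -> exists k, mult T k.
Hypothesis DM' : forall T, D' T -> exists k, mult T k.
Hypotheses (rk : constant_rank D) (rk' : constant_rank D').
Variable Pi : star_iso D D'.
Hypothesis iPi : intertwines Pi.
Notation gd := (gelfand_dual (star_iso_sym Pi)).
Notation gdi := (gelfand_dual Pi).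
Notation prD := (pr lcX T2X sH DM).
Notation prD' := (pr lcX T2X sH' DM').
Variable h : forall chi, {linear VD D chi -> pullback gd (VD D') chi}.
Variable k : forall chi, pullback gd (VD D') chi -> VD D chi.
Hypotheses (hK : forall chi, cancel (h chi) (@k chi)) (kK : forall chi, cancel (@k chi) (h chi)).
Hypotheses (ch : continuous (totmap h)) (ck : continuous (totmap k)).
Implicit Types (chi : spectrum D).

Definition hfib chi (t : VD_fib chi) : VD_fib (gd chi) := h chi t.
Definition kfib chi (t : VD_fib (gd chi)) : VD_fib chi := @k chi t.

Lemma hfibK chi : cancel (@hfib chi) (@kfib chi). Proof. exact: hK. Qed.
Lemma kfibK chi : cancel (@kfib chi) (@hfib chi). Proof. exact: kK. Qed.

(** [h] acts on each class of a fiber separately. Classes partition the fiber, so its values are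
    assembled by evaluating at each z' the image of the component for the class of z'; [ext] admits
    arbitrary sections. *)
Definition fwd (u : sections (tc_L c)) : sections (tc_L c') :=
  fun z' => G0_sec (vf (hfib (prD (gdi (evz lcX T2X sH' DM' z')) (ext (tc_s z') u)))) z'.
Definition bwd (v : sections (tc_L c')) : sections (tc_L c) :=
  fun z => G0_sec (vf (kfib (prD' (gd (evz lcX T2X sH DM z)) (ext (tc_s z) v)))) z.

Lemma gd_points chi z z' : at_point chi z -> at_point (gd chi) z' ->
  tc_s z' = tc_s z /\ tc_r z' = tc_r z.
Proof.
have iV := intertwines_sym sH iPi; move=> cz cz'.
by split; [exact: (intertwines_s lcX T2X sH' iV cz)|exact: (intertwines_r lcY T2Y sH' iV cz)].
Qed.

Lemma fwdE u chi z' : at_point (gd chi) z' ->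
  fwd u z' = G0_sec (vf (hfib (prD chi (ext (tc_s z') u)))) z'.
Proof.
move=> cz'; rewrite /fwd; suff -> : gdi (evz lcX T2X sH' DM' z') = chi by [].
rewrite (at_point_uniq DM' (evz_at lcX T2X sH' DM' z') cz').
exact: gelfand_dualVK.
Qed.

Lemma bwdE v chi z : at_point chi z ->
  bwd v z = G0_sec (vf (kfib (prD' (gd chi) (ext (tc_s z) v)))) z.
Proof.
by move=> cz; rewrite /bwd (at_point_uniq DM (evz_at lcX T2X sH DM z) cz).
Qed.

Lemma pr_fwd u chi x : (exists2 z, at_point chi z & tc_s z = x) ->
  prD' (gd chi) (ext x (fwd u)) = hfib (prD chi (ext x u)).
Proof.
move=> [z cz zx]; have [z' cz'] := spectrum_point lcX T2X sH' DM' (gd chi).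
have [zz _] := gd_points cz cz'.
apply/esym/(vf_pr_eq lcX T2X sH' DM' cz') => w' zw'; have [sw _] := zw'.
have wx : tc_s w' = x by rewrite -sw zz.
rewrite extP// (fwdE _ (chi := chi)) ?wx//.
exact/(at_point_eqv lcX T2X sH' w' cz').
Qed.

Lemma pr_bwd v chi x : (exists2 z, at_point chi z & tc_s z = x) ->
  prD chi (ext x (bwd v)) = kfib (prD' (gd chi) (ext x v)).
Proof.
move=> [z cz zx].
apply/esym/(vf_pr_eq lcX T2X sH DM cz) => w zw; have [sw _] := zw.
have wx : tc_s w = x by rewrite -sw zx.
rewrite extP// (bwdE _ (chi := chi)) ?wx//.
exact/(at_point_eqv lcX T2X sH w cz).
Qed.

Lemma fwdK : cancel fwd bwd.
Proof.
move=> u; apply: functional_extensionality_dep => z; have cz := evz_at lcX T2X sH DM z.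
rewrite (bwdE _ cz) pr_fwd; last by exists z.
by rewrite hfibK (vf_pr lcX T2X sH DM _ cz (eqv_refl _ z)) extP.
Qed.

Lemma gd_gdi (chi' : spectrum D') : gd (gdi chi') = chi'.
Proof. exact: gelfand_dualK. Qed.

Lemma gdi_at z' : at_point (gd (gdi (evz lcX T2X sH' DM' z'))) z'.
Proof. by rewrite gd_gdi; exact: evz_at. Qed.

Lemma gdi_point z' : exists z, [/\ at_point (gdi (evz lcX T2X sH' DM' z')) z, tc_s z = tc_s z' & tc_r z = tc_r z'].
Proof.
have [z cz] := spectrum_point lcX T2X sH DM (gdi (evz lcX T2X sH' DM' z')).
by have [ss rr] := gd_points cz (gdi_at z'); exists z.
Qed.

Lemma bwdK : cancel bwd fwd.
Proof.
move=> v; apply: functional_extensionality_dep => z'; have cz' := gdi_at z'.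
have [z [cz zz _]] := gdi_point z'.
rewrite (fwdE _ cz') pr_bwd; last by exists z.
by rewrite kfibK (vf_pr lcX T2X sH' DM' _ cz' (eqv_refl _ z')) extP.
Qed.

Lemma hfib_lin chi a t t' : hfib (a *: t + t' : VD_fib chi) = a *: hfib t + hfib t'.
Proof. exact: linearP. Qed.

Lemma kfib_lin chi a t t' : kfib (a *: t + t' : VD_fib (gd chi)) = a *: kfib t + kfib t'.
Proof.
by apply: (can_inj (@hfibK chi)); rewrite hfib_lin !kfibK.
Qed.

Lemma hfibZ chi a t : hfib (a *: t : VD_fib chi) = a *: hfib t.
Proof. exact: linearZZ. Qed.

Lemma kfibZ chi a t : kfib (a *: t : VD_fib (gd chi)) = a *: kfib t.
Proof.
by apply: (can_inj (@hfibK chi)); rewrite hfibZ !kfibK.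
Qed.

(** Near [z0] the element t z stays in a thin tube about a representative of t z0. The
    representative is a continuous section, and [z] belongs to its own class, so the value at [z] is
    controlled. *)
Lemma tube_sec_cont (d : tcorr R Y X) (A : set (Gamma0_corr d -> Gamma0_corr d))
    (sA : symalg (symbols A)) (AM : forall T, A T -> exists k, mult T k)
    (g : tc_Z d -> spectrum A) (t : forall z, VD_fib (g z)) (z0 : tc_Z d) :
  (forall z, at_point (g z) z) ->
  cont_at (fun z => @tpt R _ (VD A) (g z) (t z)) z0 ->
  sec_cont_at (fun z => G0_sec (vf (t z)) z) z0.
Proof.
move=> gz ct; apply: sec_cont_lim => e e0; pose v := vf (t z0).
exists (G0_sec v); first exact: G0_cont.
have oT := VD_tube_open v (@openT (spectrum A)) e0.
have Tz0 : VD_tube setT v e (existT _ (g z0) (t z0)).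
  apply/(VD_tubeE lcX T2X sA AM _ _ _ _ (gz z0)); split => //.
  rewrite (_ : nx _ _ = 0)//; apply/nx_eq0 => w wz; rewrite /class_cut; case: asboolP => // _.
  exact: subrr.
have := cont_at_nbhs ct (open_nbhs_nbhs (conj oT Tz0)).
apply: filterS => z /(VD_tubeE lcX T2X sA AM _ _ _ _ (gz z))[_ lt].
apply: ltW; apply: le_lt_trans lt; apply: le_trans (lnrm_le_nx _ z).
rewrite /class_cut; case: asboolP => // -[]; exact: eqv_refl.
Qed.

Lemma bmap_fwd : bmap fwd.
Proof.
split=> [a u v|a u z'|u cu z0].
- apply: functional_extensionality_dep => z'; have [z [cz zz _]] := gdi_point z'.
  have cz' := gdi_at z'; rewrite -[RHS]/(a *: fwd u z' + fwd v z') !(fwdE _ cz').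
  rewrite (pr_lin lcX T2X sH DM (a := a) (p := ext (tc_s z') u) (q := ext (tc_s z') v) cz); last first.
    by move=> w [zw _]; rewrite !extP ?zz -?zw.
  by rewrite hfib_lin (vf_lin lcX T2X sH' _ _ _ cz' erefl).
- have [z [cz zz rr]] := gdi_point z'; have cz' := gdi_at z'; rewrite !(fwdE _ cz').
  rewrite (pr_scale lcX T2X sH DM (a := a (tc_s z') (tc_r z')) (p := ext (tc_s z') u) cz); last first.
    move=> w zw; have [sw _] := zw; rewrite !extP -?sw ?zz//.
    by rewrite -(eqv_r lcY T2Y sH zw) rr.
  by rewrite hfibZ (vfZ lcX T2X sH' _ _ cz' erefl).
(* The choice [ext (tc_s z') u] has no continuity in z'. One element of E agreeing with [u] over a
   neighbourhood yields the same bundle elements there and can be fed to [pr_continuous]. *)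
- have [p pu] := sec_globalize lcX T2X s_surj (tc_s z0) cu.
  pose g z' := gdi (evz lcX T2X sH' DM' z').
  apply: (sec_cont_at_near (u := fun z' => G0_sec (vf (hfib (prD (g z') p))) z')).
    have cs : cont_at (@tc_s _ _ _ c') z0 by exact: s_cont.
    apply: filterS (cont_at_nbhs cs pu) => z' pz'.
    have [z [cz zz rr]] := gdi_point z'; have cz' := gdi_at z'; rewrite (fwdE _ cz').
    congr (G0_sec (vf (hfib _)) z'); apply: (pr_eq lcX T2X sH DM cz) => w [sw _].
    have wz : tc_s w = tc_s z' by rewrite -sw.
    by rewrite extP// pz'.
  apply: (tube_sec_cont sH' DM' (g := fun z' => gd (g z'))).
    exact: gdi_at.
  pose j := fun t : {b : spectrum D & VD_fib (gd b)} =>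
    (projT1 t, @tpt R _ (VD D') (gd (projT1 t)) (projT2 t)) : (spectrum D * tot (VD D'))%type.
  have cg : continuous g.
    move=> z; apply: (@continuous_comp _ _ _ (evz lcX T2X sH' DM') gdi); first exact: evz_continuous.
    exact: gelfand_dual_continuous.
  have c1 : continuous (fun z' => totmap h (@tpt R _ (VD D) (g z') (prD (g z') p))).
    move=> z; apply: (@continuous_comp _ _ _ (fun z => @tpt R _ (VD D) (g z) (prD (g z) p)) (totmap h)).
      apply: (@continuous_comp _ _ _ g (fun chi => @tpt R _ (VD D) chi (prD chi p))); first exact: cg.
      exact: pr_continuous.
    exact: ch.
  have c2 : continuous (fun z' => j (totmap h (@tpt R _ (VD D) (g z') (prD (g z') p)))).
    move=> z; apply: (@cont_at_comp (tc_Z c') (tot (pullback gd (VD D'))) (spectrum D * tot (VD D'))%type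
      (fun z' => totmap h (@tpt R _ (VD D) (g z') (prD (g z') p))) j); first exact: c1.
    exact: initial_continuous.
  exact: (@cont_at_comp (tc_Z c') (spectrum D * tot (VD D'))%type (tot (VD D')) _ snd z0 (c2 z0) cvg_snd).
Qed.

Lemma bmap_bwd : bmap bwd.
Proof.
split=> [a u v|a u z|u cu z0].
- apply: functional_extensionality_dep => z; have cz := evz_at lcX T2X sH DM z.
  have [z' cz'] := spectrum_point lcX T2X sH' DM' (gd (evz lcX T2X sH DM z)); have [zz _] := gd_points cz cz'.
  rewrite -[RHS]/(a *: bwd u z + bwd v z) !(bwdE _ cz).
  rewrite (pr_lin lcX T2X sH' DM' (a := a) (p := ext (tc_s z) u) (q := ext (tc_s z) v) cz'); last first.
    by move=> w [zw _]; rewrite !extP -?zw ?zz.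
  by rewrite kfib_lin (vf_lin lcX T2X sH _ _ _ cz erefl).
- have cz := evz_at lcX T2X sH DM z.
  have [z' cz'] := spectrum_point lcX T2X sH' DM' (gd (evz lcX T2X sH DM z)); have [zz rr] := gd_points cz cz'.
  rewrite !(bwdE _ cz).
  rewrite (pr_scale lcX T2X sH' DM' (a := a (tc_s z) (tc_r z)) (p := ext (tc_s z) u) cz'); last first.
    move=> w zw; have [sw _] := zw; rewrite !extP -?sw ?zz//.
    by rewrite -(eqv_r lcY T2Y sH' zw) rr.
  by rewrite kfibZ (vfZ lcX T2X sH _ _ cz erefl).
- have [p pu] := sec_globalize lcX T2X s'_surj (tc_s z0) cu.
  pose g z := evz lcX T2X sH DM z.
  apply: (sec_cont_at_near (u := fun z => G0_sec (vf (kfib (prD' (gd (g z)) p))) z)).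
    have cs : cont_at (@tc_s _ _ _ c) z0 by exact: s_cont.
    apply: filterS (cont_at_nbhs cs pu) => z pz; have cz := evz_at lcX T2X sH DM z.
    have [z' cz'] := spectrum_point lcX T2X sH' DM' (gd (evz lcX T2X sH DM z)); have [zz rr] := gd_points cz cz'.
    rewrite (bwdE _ cz); congr (G0_sec (vf (kfib _)) z); apply: (pr_eq lcX T2X sH' DM' cz') => w [sw _].
    have wz : tc_s w = tc_s z by rewrite -sw.
    by rewrite extP// pz.
  apply: (tube_sec_cont sH DM (g := g)); first by move=> z; exact: evz_at.
  have cg : continuous g by exact: evz_continuous.
  have cp z : @cont_at (tc_Z c) (tot (VD D')) (fun z => @tpt R _ (VD D') (gd (g z)) (prD' (gd (g z)) p)) z.
    apply: (@cont_at_comp (tc_Z c) (spectrum D') (tot (VD D')) (fun z => gd (g z))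
      (fun x' : spectrum D' => @tpt R _ (VD D') x' (prD' x' p))).
      apply: (@cont_at_comp _ _ _ g gd); first exact: cg.
      exact: gelfand_dual_continuous.
    exact: pr_continuous.
  have c1 : continuous (fun z => @tpt R _ (pullback gd (VD D')) (g z) (prD' (gd (g z)) p)).
    by apply: continuous_comp_initial; exact: (pair_continuous cg cp).
  have : continuous (fun z => totmap k (@tpt R _ (pullback gd (VD D')) (g z) (prD' (gd (g z)) p))).
    by move=> z; apply: (@continuous_comp _ _ _ _ (totmap k)); [exact: c1|exact: ck].
  exact.
Qed.

Lemma vbundle_corr_iso : corr_iso E E'.
Proof.
have [U [U' [bU bU' UU' U'U uU]]] := polar lcX T2X s_surj s'_surj bmap_fwd bmap_bwd fwdK bwdK.
exact: (unitary_corr_iso s_surj s'_surj bU bU' UU' U'U uU).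
Qed.

End VBundleIso.

(** * Existence and uniqueness of the isomorphism of algebras *)

Section Germs.
Variables (R : realType) (X Y : topologicalType).

Lemma germ_sym (c c' : tcorr R Y X) z z' : @germ_eq _ _ _ c c' z z' -> germ_eq z' z.
Proof.
move=> [e [W [W' [Wz Wz' H]]]]; split=> //; exists W', W; split => // a a' Wa Wa' aa.
by apply/esym/H.
Qed.

(** The comparison passes through a point on the sheet of z'. Such a point exists over all of a
    neighbourhood since [s] is open, and the neighbourhood of [z] is shrunk accordingly. *)
Lemma germ_trans (c c' c'' : tcorr R Y X) z z' z'' :
  @germ_eq _ _ _ c c' z z' -> @germ_eq _ _ _ c' c'' z' z'' -> germ_eq z z''.
Proof.
move=> [e [W [W' [Wz Wz' H]]]] [e' [W1 [W1' [W1z W1z' H']]]].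
split; first by rewrite e.
have nW : nbhs z' (W' `&` W1) by exact: filterI.
have nS := s_open nW; rewrite -e in nS.
have nz : nbhs z (@tc_s _ _ _ c @^-1` (@tc_s _ _ _ c' @` (W' `&` W1))) by exact: (@s_cont _ _ _ c z _ nS).
exists (W `&` @tc_s _ _ _ c @^-1` (@tc_s _ _ _ c' @` (W' `&` W1))), W1'; split => //.
  exact: filterI.
move=> a a'' [Wa [b [W'b W1b] ba]] W1a aa.
by rewrite (H a b)// (H' b a'')// ba.
Qed.

Lemma locally_conjugate_sym (c c' : tcorr R Y X) : locally_conjugate c c' -> locally_conjugate c' c.
Proof.
move=> cc x; have [U oU [phi [psi [pK qK cp cq pP]]]] := cc x; exists U => //.
exists psi, phi; split => // z.
by have [s1 r1] := pP (psi z); rewrite qK in s1 r1.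
Qed.

Lemma locally_conjugate_germ (c c' : tcorr R Y X) : locally_conjugate c c' ->
  forall z : tc_Z c, exists z' : tc_Z c', germ_eq z z'.
Proof.
move=> cc z; have [U [oU Uz] [phi [psi [_ _ cphi _ phiP]]]] := cc (tc_s z).
pose A := @tc_s _ _ _ c @^-1` U.
have zA : A z by [].
pose inA a (Aa : A a) : A := exist _ a (mem_set Aa).
have [ss rr] := phiP (inA z zA); exists (\val (phi (inA z zA))); split; first by rewrite ss.
have [W' oW' inj] := inj_nbhd (\val (phi (inA z zA))).
have cv : {for inA z zA, continuous (fun a : A => \val (phi a))}.
  apply: (@continuous_comp _ _ _ phi (fun b => \val b)); first exact: cphi.
  exact: initial_continuous.
have nO := cv _ (open_nbhs_nbhs oW').
move: nO => -[N [oN Nz] NW].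
have [B oB BN] := oN.
exists (B `&` A), W'; split.
- apply: filterI; apply: open_nbhs_nbhs; split => //.
  + by rewrite -BN in Nz.
  + by apply: open_comp => // ? _; exact: s_cont.
- exact: open_nbhs_nbhs.
- move=> a a' [Ba Aa] W'a' aa; have [sa ra] := phiP (inA a Aa).
  have Wa : W' (\val (phi (inA a Aa))) by apply: NW; rewrite -BN.
  by rewrite (inj _ _ W'a' Wa) ?ra// -aa sa.
Qed.

End Germs.

Section Transfer.
Variables (R : realType) (X Y : topologicalType) (c c' : tcorr R Y X).
Hypotheses (lcX : locally_compact [set: X]) (T2X : hausdorff_space X).
Hypothesis s'_surj : range (@tc_s R Y X c') = [set: X].
Notation C := (cplx R).
Notation E := (Gamma0_corr c).
Notation E' := (Gamma0_corr c').
Variable pi : tc_Z c' -> tc_Z c.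
Hypothesis piP : forall z', germ_eq (pi z') z'.
Implicit Types (k : tc_Z c -> C).

Definition germ_inv (d : tcorr R Y X) (k : tc_Z d -> C) : Prop :=
  forall a b : tc_Z d, germ_eq a b -> k a = k b.

Lemma transfer_eq k z z' : germ_inv k -> germ_eq z z' -> k (pi z') = k z.
Proof. by move=> ki zz; apply: ki; exact: germ_trans (piP z') (germ_sym zz). Qed.

Lemma transfer_inv k : germ_inv k -> germ_inv (fun z' => k (pi z')).
Proof. by move=> ki a b ab; apply/esym/transfer_eq => //; exact: germ_trans (piP a) ab. Qed.

(** [pi] is a mere choice of points, without continuity. Equality of germs at one pair of points
    persists nearby, so near a point the function k o pi agrees with [k] along one sheet of the
    other space. *)
Lemma transfer_c0 k : germ_inv k -> c0fun k -> c0fun (fun z' => k (pi z')).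
Proof.
move=> ki ck; split.
- apply: cont_atP => z0'; apply/cont_atC => e e0; set z0 := pi z0'.
  have [ss [W [W' [Wz Wz' H]]]] := piP z0'.
  have nk := (cont_atC k z0).1 (cont_atW ck.1 z0) e e0.
  have nW : nbhs z0 W° by exact/nbhs_interior.
  have nWk : nbhs z0 (W° `&` [set a | nc (k z0 - k a) < e]) by exact: filterI.
  have nS := s_open nWk; rewrite ss in nS.
  have n1 : nbhs z0' (@tc_s _ _ _ c' @^-1` (@tc_s _ _ _ c @` (W° `&` [set a | nc (k z0 - k a) < e]))).
    exact: (@s_cont _ _ _ c' z0' _ nS).
  have n2 : nbhs z0' W'° by exact/nbhs_interior.
  apply: filterS (filterI n1 n2) => z' [[a [Wa ka] aa] W'a].
  rewrite (@transfer_eq k a z')//; split => //.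
  by exists W, W'; split.
- apply/vanishP => e e0; have [K cK HK] := (vanishP k).1 ck.2 e e0.
  exists (@tc_s _ _ _ c' @^-1` (@tc_s _ _ _ c @` K)).
    apply: s_proper => //; apply: continuous_compact => //.
    exact/continuous_subspaceT/s_cont.
  move=> z' nz'; apply: HK => Kz; apply: nz'; exists (pi z') => //.
  by have [] := piP z'.
Qed.

(** The operators whose symbol, composed with [pi], belongs to an operator of D' form a
    C*-subalgebra containing the generators, hence include the smallest one. *)
Lemma cstar_transfer (D' : set (E' -> E')) : range (@tc_s R Y X c) = [set: X] ->
  cstar_subalgebra D' -> range (iota_op (E := E')) `|` range (phi_op (E := E')) `<=` D' ->
  cstar_iota_phi E `<=` [set T | exists k, [/\ c0fun k, mult T k, germ_inv k &
    exists2 T', D' T' & mult T' (fun z' => k (pi z'))]].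
Proof.
move=> s_surj D'c D'g; have [D1 [D20 D2] D3 D4 D5] := D'c.
set A := [set T | _].
have AA : A `<=` Arel (@germ_eq _ _ _ c c) by move=> T [k [ck mT ki _]]; exists k.
have [B1 [B20 B2] B3 B4 B5] := Arel_cstar lcX T2X s_surj (@germ_eq _ _ _ c c).
apply: smallest_min; last first.
  move=> T [[f _ <-]|[g _ <-]].
    have [k [ck mT ki]] := iota_Arel s_surj f (fun z w (e : @germ_eq _ _ _ c c z w) => e).
    exists k; split => //; exists (iota_op f); first by apply: D'g; left; exists f.
    move=> u z'; rewrite (mult_uniq mT (mult_iota f)) (piP z').1; exact: mult_iota.
  have [k [ck mT ki]] := phi_Arel g (fun z w (e : @germ_eq _ _ _ c c z w) => e).
  exists k; split => //; exists (phi_op g); first by apply: D'g; right; exists g.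
  move=> u z'; rewrite (mult_uniq mT (mult_phi g)) (germ_eq_r (piP z')); exact: mult_phi.
split.
- by move=> T /AA/B1.
- split.
    exists (fun=> 0); split => //; first exact: c0fun0.
      by move=> u z; rewrite scale0r.
    by exists 0 => // u z; rewrite scale0r.
  move=> a T S [k [ck mT ki [T' DT' mT']]] [l [cl mS li [S' DS' mS']]].
  exists (fun z => a * k z + l z); split.
  + by apply: c0funD => //; exact: c0funZ.
  + exact: mult_lin.
  + by move=> z w zw; rewrite (ki z w)// (li z w).
  + by exists (a *: T' + S'); [exact: D2|exact: mult_lin].
- move=> T S [k [ck mT ki [T' DT' mT']]] [l [cl mS li [S' DS' mS']]].
  exists (fun z => k z * l z); split.
  + exact: c0funM.
  + exact: mult_comp.
  + by move=> z w zw; rewrite (ki z w)// (li z w).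
  + by exists (T' \o S'); [exact: D3|exact: mult_comp].
- move=> T [k [ck mT ki [T' DT' mT']]]; have ck' := c0fun_conj ck; exists (Mop ck'); last first.
    exact: (mult_adjoint mT (mult_Mop ck')).
  exists (fun z => (k z)^*); split => //.
    by move=> z w zw; rewrite (ki z w).
  have [S' DS' TS'] := D4 _ DT'; exists S' => //.
  have cc' := c0fun_conj (transfer_c0 ki ck).
  rewrite (adjoint_uniq TS' (mult_adjoint mT' (mult_Mop cc'))).
  exact: mult_Mop.
- move=> T cT; have [k [ck mT ki]] : Arel (@germ_eq _ _ _ c c) T.
    by apply: B5; apply: norm_closureS cT.
  exists k; split => //; have ct := transfer_c0 ki ck; exists (Mop ct); last exact: mult_Mop.
  apply: D5 => e e0; have [S [l [cl mS li [S' DS' mS']]] TS] := cT e e0.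
  have B := mult_norm_bound lcX T2X s_surj (ltW e0) mT mS TS.
  exists S' => // u; apply: (mult_enorm_le lcX T2X s'_surj (ltW e0)) (fun z => B (pi z)).
  by move=> z'; rewrite (mult_sub _ _ (mult_Mop ct) mS').
Qed.

Lemma Arel_transfer (T : E -> E) k : Arel (@germ_eq _ _ _ c c) T -> mult T k ->
  exists2 T' : E' -> E', Arel (@germ_eq _ _ _ c' c') T' & mult T' (fun z' => k (pi z')).
Proof.
move=> [l [cl mT li]] mk; have kl : k = l by apply/funext; exact: mult_uniq mk mT.
have ct := transfer_c0 li cl; exists (Mop ct); last by rewrite kl; exact: mult_Mop.
by exists (fun z' => l (pi z')); split; [exact: ct|exact: mult_Mop|exact: transfer_inv].
Qed.

Section StarHom.
Variables (D : set (E -> E)) (D' : set (E' -> E')).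
Hypothesis sH : symalg (symbols D).
Hypothesis DM : forall T, D T -> exists k, mult T k.
Hypothesis trD : forall T k, D T -> mult T k -> exists2 T', D' T' & mult T' (fun z' => k (pi z')).

Lemma transfer_ex (d : D) : exists d' : D', mult (\val d') (fun z' => sy (\val d) (pi z')).
Proof. by have [T' DT' mT'] := trD (dval d) (syP DM (dval d)); exists (mkd DT'). Qed.

Definition transfer (d : D) : D' := projT1 (cid (transfer_ex d)).

Lemma transferP (d : D) : mult (\val (transfer d)) (fun z' => sy (\val d) (pi z')).
Proof. by rewrite /transfer; case: cid. Qed.

Lemma transfer_mult (d : D) k : mult (\val d) k -> mult (\val (transfer d)) (fun z' => k (pi z')).
Proof. by move=> mk; have := transferP d; rewrite (syE mk). Qed.

Lemma transfer_hom : star_hom transfer.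
Proof.
split=> [d1 d2 d3 e|a d1 d2 e|d1 d2 d3 e|d1 d2 adj].
- have m3 : mult (\val d3) (fun z => sy (\val d1) z + sy (\val d2) z).
    move=> u z; rewrite e -[LHS]/(G0_sec (\val d1 u) z + G0_sec (\val d2 u) z).
    by rewrite (syP DM (dval d1)) (syP DM (dval d2)) scalerDl.
  apply: mult_inj (transfer_mult m3) _ => u z.
  rewrite -[LHS]/(G0_sec (\val (transfer d1) u) z + G0_sec (\val (transfer d2) u) z).
  by rewrite !transferP scalerDl.
- have m2 : mult (\val d2) (fun z => a * sy (\val d1) z).
    move=> u z; rewrite e -[LHS]/(a *: G0_sec (\val d1 u) z).
    by rewrite (syP DM (dval d1)) scalerA.
  apply: mult_inj (transfer_mult m2) _ => u z.
  rewrite -[LHS]/(a *: G0_sec (\val (transfer d1) u) z).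
  by rewrite !transferP scalerA.
- have m3 : mult (\val d3) (fun z => sy (\val d1) z * sy (\val d2) z).
    by rewrite e; apply: mult_comp; exact: (syP DM (dval _)).
  apply: mult_inj (transfer_mult m3) _.
  exact: mult_comp (transferP d1) (transferP d2).
- have cd := c0fun_conj (sa_c0 sH (syH DM (dval d1))).
  have m2 : mult (\val d2) (fun z => (sy (\val d1) z)^*).
    rewrite (adjoint_uniq adj (mult_adjoint (syP DM (dval d1)) (mult_Mop cd))).
    exact: mult_Mop.
  exact: mult_adjoint (transferP d1) (transfer_mult m2).
Qed.

Lemma transfer_intertwines :
  (forall (f : C0 R X) (d : D), \val d = iota_op f -> \val (transfer d) = iota_op f) /\
  (forall (g : C0 R Y) (d : D), \val d = phi_op g -> \val (transfer d) = phi_op g).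
Proof.
split=> [f d df|g d dg].
  have md : mult (\val d) (fun z => f (tc_s z)) by rewrite df; exact: mult_iota.
  apply: mult_inj (transfer_mult md) _ => u z'.
  by rewrite (piP z').1; exact: mult_iota.
have md : mult (\val d) (fun z => g (tc_r z)) by rewrite dg; exact: mult_phi.
apply: mult_inj (transfer_mult md) _ => u z'.
by rewrite (germ_eq_r (piP z')); exact: mult_phi.
Qed.

End StarHom.

End Transfer.

Section StarIsoExists.
Variables (R : realType) (X Y : topologicalType) (c c' : tcorr R Y X).
Notation E := (Gamma0_corr c).
Notation E' := (Gamma0_corr c').
Variables (pi : tc_Z c' -> tc_Z c) (pi' : tc_Z c -> tc_Z c').
Hypotheses (piP : forall z', germ_eq (pi z') z') (pi'P : forall z, germ_eq (pi' z) z).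
Variables (D : set (E -> E)) (D' : set (E' -> E')).
Hypothesis sH : symalg (symbols D).
Hypothesis DM : forall T, D T -> exists k, mult T k.
Hypothesis DM' : forall T, D' T -> exists k, mult T k.
Hypothesis trD : forall T k, D T -> mult T k -> exists2 T', D' T' & mult T' (fun z' => k (pi z')).
Hypothesis trD' : forall T k, D' T -> mult T k -> exists2 T', D T' & mult T' (fun z => k (pi' z)).

(** pi (pi' z) may differ from [z] but has the same germ, and symbols of D do not distinguish such
    points. *)
Lemma transferK : cancel (transfer DM trD) (transfer DM' trD').
Proof.
move=> d; apply: val_inj; have md := syP DM (dval d).
apply: (mult_inj (transfer_mult DM' trD' (transferP DM trD d))) => u z.
rewrite (transfer_eq piP (z := z)) ?md//; last exact: germ_sym.
by move=> a b ab; apply: (sa_germ sH) ab; exact: syH (dval d).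
Qed.

End StarIsoExists.

Lemma transfer_star_iso (R : realType) (X Y : topologicalType) (c c' : tcorr R Y X)
    (pi : tc_Z c' -> tc_Z c) (pi' : tc_Z c -> tc_Z c')
    (piP : forall z', germ_eq (pi z') z') (pi'P : forall z, germ_eq (pi' z) z)
    (D : set (Gamma0_corr c -> Gamma0_corr c)) (D' : set (Gamma0_corr c' -> Gamma0_corr c'))
    (sH : symalg (symbols D)) (sH' : symalg (symbols D'))
    (DM : forall T, D T -> exists k, mult T k) (DM' : forall T, D' T -> exists k, mult T k) :
  (forall T k, D T -> mult T k -> exists2 T', D' T' & mult T' (fun z' => k (pi z'))) ->
  (forall T k, D' T -> mult T k -> exists2 T', D T' & mult T' (fun z => k (pi' z))) ->
  exists Pi : star_iso D D', intertwines Pi.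
Proof.
move=> trD trD'.
exists (StarIso (transferK piP pi'P sH DM DM' trD trD')
  (transferK pi'P piP sH' DM' DM trD' trD)
  (transfer_hom sH DM trD) (transfer_hom sH' DM' trD')).
exact: transfer_intertwines.
Qed.

Section Uniqueness.
Variables (R : realType) (X Y : topologicalType) (c c' : tcorr R Y X).
Hypotheses (lcX : locally_compact [set: X]) (T2X : hausdorff_space X).
Hypotheses (lcY : locally_compact [set: Y]) (T2Y : hausdorff_space Y).
Hypothesis s_surj : range (@tc_s R Y X c) = [set: X].
Notation E := (Gamma0_corr c).
Notation E' := (Gamma0_corr c').
Variables (D : set (E -> E)) (D' : set (E' -> E')).
Hypotheses (sH : symalg (symbols D)) (sH' : symalg (symbols D')).
Hypothesis DM : forall T, D T -> exists k, mult T k.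
Hypothesis DM' : forall T, D' T -> exists k, mult T k.
Hypothesis rk : constant_rank D.

(** The idempotent [q] marks the class of [z] on nearby fibers, and its image under [Pi] marks the
    matching points near z'. Dual points have equal values of [r] because [Pi] intertwines C_0(Y),
    so [r] agrees along the two sheets. *)
Lemma intertwines_germ (Pi : star_iso D D') (chi : spectrum D') z z' : intertwines Pi ->
  at_point chi z' -> at_point (gelfand_dual Pi chi) z -> germ_eq z z'.
Proof.
move=> iPi cz' cz; split; first exact: (intertwines_s lcX T2X sH iPi cz').
have [q [V [Hq [oV Vz] q1 qq qeqv]]] := local_idempotent lcX T2X s_surj sH DM rk z.
have [d md] := sy_mkd Hq; have ml := syP DM' (dval (Pi d)); set l := sy _ in ml.
have lq chi' w w' : at_point chi' w' -> at_point (gelfand_dual Pi chi') w -> l w' = q w.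
  by move=> cw' cw; rewrite -(cw' _ _ ml) -(cw _ _ md).
have n1 : \forall a \near z, q a <> 0.
  apply: near_neq0; first exact: (sa_c0 sH Hq).1.
  by rewrite q1; apply/eqP/oner_neq0.
have n2 : \forall a \near z', l a <> 0.
  apply: near_neq0; first exact: (sa_c0 sH' (syH DM' (dval (Pi d)))).1.
  by rewrite (lq _ _ _ cz' cz) q1; apply/eqP/oner_neq0.
have n3 : \forall a \near z, V (tc_s a) by apply: s_cont; exact: open_nbhs_nbhs.
exists [set a | q a <> 0 /\ V (tc_s a)], [set a | l a <> 0]; split => //; first exact: filterI.
move=> a a' [/= qa Va] la aa.
have ca' := evz_at lcX T2X sH' DM' a'.
have [b cb] := spectrum_point lcX T2X sH DM (gelfand_dual Pi (evz lcX T2X sH' DM' a')).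
rewrite -(intertwines_r lcY T2Y sH iPi ca' cb); apply: (eqv_r lcY T2Y sH); apply: qeqv => //; first by rewrite aa (intertwines_s lcX T2X sH iPi ca' cb).
by rewrite -(lq _ _ _ ca' cb).
Qed.

(** The images of C_0(X) and C_0(Y) need not generate a double commutant, so agreement on them is
    not enough. By [intertwines_germ], both dual maps send a character at z' to points with the germ
    of z', where symbols of D coincide. *)
Lemma intertwines_uniq (Pi Pi' : star_iso D D') : intertwines Pi -> intertwines Pi' ->
  forall d, Pi' d = Pi d.
Proof.
move=> iP iP' d; apply: val_inj.
apply: (mult_inj (syP DM' (dval (Pi' d)))) => u z'.
rewrite (syP DM' (dval (Pi d))); congr (_ *: _).
have cz' := evz_at lcX T2X sH' DM' z'; set chi := evz _ _ _ _ _ in cz'.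
have [z cz] := spectrum_point lcX T2X sH DM (gelfand_dual Pi chi).
have [w cw] := spectrum_point lcX T2X sH DM (gelfand_dual Pi' chi).
have md := syP DM (dval d).
rewrite -(cz' _ _ (syP DM' (dval (Pi d)))) -(cz' _ _ (syP DM' (dval (Pi' d)))).
rewrite -[LHS]/(ev (gelfand_dual Pi chi) d) -[RHS]/(ev (gelfand_dual Pi' chi) d).
rewrite (cz _ _ md) (cw _ _ md); apply: (sa_germ sH); first exact: syH (dval d).
exact: germ_trans (intertwines_germ iP cz' cz) (germ_sym (intertwines_germ iP' cz' cw)).
Qed.

End Uniqueness.

(** * The two choices of D, and the theorem *)

Section Algebras.
Variables (R : realType) (X Y : topologicalType) (c : tcorr R Y X).
Hypotheses (lcX : locally_compact [set: X]) (T2X : hausdorff_space X).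
Hypotheses (lcY : locally_compact [set: Y]) (T2Y : hausdorff_space Y).
Hypothesis s_surj : range (@tc_s R Y X c) = [set: X].
Notation E := (Gamma0_corr c).

Lemma bicommutantE : commutant (commutant (cstar_iota_phi E)) = Arel (@germ_eq _ _ _ c c).
Proof.
apply/seteqP; split; first exact: bicommutant_Arel.
exact: Arel_bicommutant.
Qed.

Lemma iota_phi_germ_Arel :
  range (iota_op (E := E)) `|` range (phi_op (E := E)) `<=` Arel (@germ_eq _ _ _ c c).
Proof. by move=> T [[f _ <-]|[g _ <-]]; [exact: iota_Arel|exact: phi_Arel]. Qed.

Lemma iota_phi_cstar_iota_phi :
  range (iota_op (E := E)) `|` range (phi_op (E := E)) `<=` cstar_iota_phi E.
Proof. by move=> T TS W [_]; apply. Qed.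

Lemma algebra_cases (D : set (E -> E)) :
  D = cstar_iota_phi E \/ D = commutant (commutant (cstar_iota_phi E)) ->
  symalg (symbols D) /\ forall T, D T -> exists k, mult T k.
Proof.
move=> DE; have [Dc DA Dg] : [/\ cstar_subalgebra D, D `<=` Arel (@germ_eq _ _ _ c c) &
    range (iota_op (E := E)) `|` range (phi_op (E := E)) `<=` D].
  case: DE => ->; first by split; [exact: cstar_iota_phi_cstar|exact: cstar_iota_phi_Arel|exact: iota_phi_cstar_iota_phi].
  by rewrite bicommutantE; split; [exact: Arel_cstar|by []|exact: iota_phi_germ_Arel].
split; first exact: symbols_symalg.
by move=> T /DA[k [_ mT _]]; exists k.
Qed.

End Algebras.

Lemma corr_iso_data (R : realType) (X Y : topologicalType) (E E' : corr R Y X) :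
  corr_iso E E' -> exists U V, @iso_data R X Y E E' U V.
Proof.
move=> [U [[V UV VU] Uip Ur Ul]]; exists U, V; split => //.
- by move=> a u v; exact: linearP.
- by move=> a u v; apply: (can_inj UV); rewrite linearP !VU.
Qed.

Theorem corollary5p21 (R : realType) (X Y : topologicalType)
  (lcX : locally_compact [set: X]) (T2X : hausdorff_space X)
  (lcY : locally_compact [set: Y]) (T2Y : hausdorff_space Y)
  (c c' : tcorr R Y X)
  (s_surj : range (@tc_s R Y X c) = [set: X])
  (s'_surj : range (@tc_s R Y X c') = [set: X]) :
  let E := Gamma0_corr c in
  let E' := Gamma0_corr c' in
  forall (D : set (E -> E)) (D' : set (E' -> E')),
  (D = cstar_iota_phi E /\ D' = cstar_iota_phi E') \/
  (D = commutant (commutant (cstar_iota_phi E)) /\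
   D' = commutant (commutant (cstar_iota_phi E'))) ->
  constant_rank D -> constant_rank D' ->
  (* the isomorphism Pi of (b) exists, and is unique, when (a) holds *)
  (locally_conjugate c c' ->
     exists2 Pi : star_iso D D', intertwines Pi &
       forall Pi' : star_iso D D', intertwines Pi' -> forall d, Pi' d = Pi d) /\
  (corr_iso E E' <->
     locally_conjugate c c' /\
     exists2 Pi : star_iso D D', intertwines Pi &
       vbundle_iso (VD D) (pullback (gelfand_dual (star_iso_sym Pi)) (VD D'))).
Proof.
move=> E E' D D' DD rk rk'.
have [sH DM] : symalg (symbols D) /\ forall T, D T -> exists k, mult T k.
  by apply: algebra_cases => //; case: DD => -[-> _]; [left|right].
have [sH' DM'] : symalg (symbols D') /\ forall T, D' T -> exists k, mult T k.
  by apply: algebra_cases => //; case: DD => -[_ ->]; [left|right].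
split; [|split].
- move=> cc; have cc' := locally_conjugate_sym cc.
  have /choice[pi' pi'P] := locally_conjugate_germ cc.
  have /choice[pi piP] := locally_conjugate_germ cc'.
  have {}piP z' : germ_eq (pi z') z' by exact: germ_sym.
  have {}pi'P z : germ_eq (pi' z) z by exact: germ_sym.
  have [Pi iPi] : exists Pi : star_iso D D', intertwines Pi.
    apply: (transfer_star_iso piP pi'P sH sH' DM DM').
      (* The generated algebra is transferred by minimality, the double commutant through its
         description by germs. *)
      case: DD => -[-> ->] T k DT mk.
        have [l [cl ml li [T' DT' mT']]] := cstar_transfer lcX T2X s'_surj piP s_surj
          (cstar_iota_phi_cstar lcX T2X s'_surj) (@iota_phi_cstar_iota_phi _ _ _ c') DT.
        by exists T' => //; rewrite (_ : k = l)//; apply/funext; exact: mult_uniq mk ml.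
      rewrite bicommutantE//; apply: Arel_transfer => //; by rewrite -bicommutantE.
    case: DD => -[-> ->] T k DT mk.
      have [l [cl ml li [T' DT' mT']]] := cstar_transfer lcX T2X s_surj pi'P s'_surj
        (cstar_iota_phi_cstar lcX T2X s_surj) (@iota_phi_cstar_iota_phi _ _ _ c) DT.
      by exists T' => //; rewrite (_ : k = l)//; apply/funext; exact: mult_uniq mk ml.
    rewrite bicommutantE//; apply: Arel_transfer => //; by rewrite -bicommutantE.
  exists Pi => // Pi' iPi'.
  exact: (intertwines_uniq lcX T2X lcY T2Y s_surj sH sH' DM DM' rk iPi iPi').
- move=> /corr_iso_data[U [V iU]]; have iV := iso_sym iU.
  split; first exact: (iso_locally_conjugate lcX T2X lcY T2Y s_surj s'_surj iU).
  have [cDD cD'D] : (forall T, D T -> D' (conjop U V T)) /\ (forall T, D' T -> D (conjop V U T)).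
    have h1 T := @conjop_cstar_iota_phi _ _ _ _ _ _ _ T iU.
    have h2 T := @conjop_cstar_iota_phi _ _ _ _ _ _ _ T iV.
    case: DD => -[-> ->]; first by split.
    split=> T; apply: conjop_commutant => // S; exact: conjop_commutant.
  exists (conj_star_iso iU cDD cD'D); first exact: iso_intertwines.
  exact: (iso_vbundle lcX T2X sH sH' DM DM' iU cDD cD'D).
- move=> [_ [Pi iPi [h [k [hK kK ch ck]]]]].
  exact: (vbundle_corr_iso lcX T2X lcY T2Y s_surj s'_surj sH sH' DM DM' rk rk' iPi hK kK ch ck).
Qed.
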